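(* Let $\theta,\zeta$ and $\alpha_k$ $(k\in\mathbb Z\setminus\{0\})$ be real parameters in the principal domain, i.e. $$1-\alpha_k>0\ (k\ne0),\qquad \theta+\alpha_{-1}+\dots+\alpha_{-\ell}>0\ (\ell\ge0),\qquad \zeta+\alpha_1+\dots+\alpha_u>0\ (u\ge0).$$ Let $P$ be the distribution of the random coherent sequence of permutations $(\pi_n)$ whose initial ranks satisfy $i_1=1$ and, given $i_1,\dots,i_n$ (equivalently given $\pi_n$, with two-sided sequence of record values $r_{-\ell}<\dots<r_0<\dots<r_u$), $$i_{n+1}=\begin{cases}1&\text{with probability }\dfrac{\theta+\alpha_{-1}+\dots+\alpha_{-\ell}}{\theta+\zeta+n-1},\\[2mm] r&\text{with probability }\dfrac{1-\alpha_{k-1}/(r_k-r_{k-1})}{\theta+\zeta+n-1}\ \text{ for each } r \text{ with } r_{k-1}<r\le r_k,\ -\ell<k\le0,\\[2mm] r&\text{with probability }\dfrac{1-\alpha_k/(r_k-r_{k-1})}{\theta+\zeta+n-1}\ \text{ for each } r\text{ with } r_{k-1}<r\le r_k,\ 0<k\le u,\\[2mm] n+1&\text{with probability }\dfrac{\zeta+\alpha_1+\dots+\alpha_u}{\theta+\zeta+n-1}.\end{cases}$$ Then under $P$ the scaled record values of $\pi_n$ converge as $n\to\infty$: $$\frac{r_k}{n}\to\rho_k\quad\text{almost surely}\qquad(k\in\mathbb Z).$$ The distribution of $\rho_0$ is $\mathrm{beta}(\theta,\zeta)$. Given $\rho_0$, the sequences $(\rho_k,\,k<0)$ and $(\rho_k,\,k>0)$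 are independent and representable as $$\rho_k=\rho_0T_kT_{k+1}\cdots T_{-1}\quad(k<0),\qquad\rho_k=1-(1-\rho_0)Z_1Z_2\cdots Z_k\quad(k>0),$$ where $T_k$ is $\mathrm{beta}(\theta+\alpha_k+\alpha_{k+1}+\dots+\alpha_{-1},\,1-\alpha_k)$ for $k<0$, $Z_k$ is $\mathrm{beta}(\zeta+\alpha_1+\dots+\alpha_k,\,1-\alpha_k)$ for $k>0$, and the variables $\rho_0$, $T_k$ $(k<0)$ and $Z_k$ $(k>0)$ are all independent.
   Context: Permutations of $[n]=\{1,\dots,n\}$ are written $\pi_n=(\pi_{n1},\dots,\pi_{nn})$. The entry $\pi_{nj}$ is a lower record if $\pi_{nj}=\min(\pi_{n1},\dots,\pi_{nj})$, an upper record if $\pi_{nj}=\max(\pi_{n1},\dots,\pi_{nj})$; records with $j\ge2$ are called proper. If $\pi_n$ has $\ell$ proper lower and $u$ proper upper records, its record values are arranged in increasing order as $r_{-\ell}<\dots<r_{-1}<r_0<r_1<\dots<r_u$, where $r_0=\pi_{n1}$, $r_{-\ell},\dots,r_{-1}$ are the proper lower record values and $r_1,\dots,r_u$ the proper upper record values (all depend on $n$; $r_{-\ell}=1$, $r_u=n$). For the purpose of the limit the sequence is padded by $r_k=1$ for $k<-\ell$ and $r_k=n$ for $k>u$. A sequence $(\pi_n)_{n\ge1}$, $\pi_n\in\mathfrak S_n$, is coherent if for all $m\le n$ the ranking permutation of $(\pi_{n1},\dots,\pi_{nm})$ (each entry replaced by its rank in increasing order) is $\pi_m$. The initial rank $i_j\in\{1,\dots,j\}$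 is the rank in increasing order of $\pi_{nj}$ among $\pi_{n1},\dots,\pi_{nj}$ (any $n\ge j$); $(\pi_n)\mapsto(i_1,i_2,\dots)$ is a bijection of the coherent sequences onto $[1]\times[2]\times\cdots$. $\mathrm{beta}(a,b)$, $a,b>0$, is the distribution on $[0,1]$ with density $x^{a-1}(1-x)^{b-1}\Gamma(a+b)/(\Gamma(a)\Gamma(b))$. Empty sums are $0$. *)

(* Defs.v *)
From mathcomp Require Import all_boot all_order all_algebra all_fingroup.
From mathcomp Require Import all_classical all_reals all_analysis.

Set Implicit Arguments.
Unset Strict Implicit.
Unset Printing Implicit Defensive.

Import Order.TTheory GRing.Theory Num.Theory.
Import numFieldNormedType.Exports.

Local Open Scope classical_set_scope.
Local Open Scope ring_scope.

(* Permutations of [n] are elements of 'S_n; their one-line notation is a word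
   over {1, ..., n}, since 'I_n itself is {0, ..., n-1}. *)
Definition word (n : nat) (s : 'S_n) : seq nat :=
  [seq (s j).+1 | j <- enum 'I_n].

(* Positions in a word are counted from 1. *)
Definition entry (w : seq nat) (j : nat) : nat := nth 0%N w j.-1.

Definition lower_record (w : seq nat) (j : nat) : bool :=
  all (fun x => entry w j <= x)%N (take j w).

Definition upper_record (w : seq nat) (j : nat) : bool :=
  all (fun x => x <= entry w j)%N (take j w).

(* ell and u: the records at the positions 2, ..., n are the proper ones. *)
Definition nb_lower (w : seq nat) : nat :=
  count (lower_record w) (iota 2 (size w).-1).

Definition nb_upper (w : seq nat) : nat :=
  count (upper_record w) (iota 2 (size w).-1).

(* Position 1 is a lower and an upper record, but contributes one value. *)
Definition record_values (w : seq nat) : seq nat :=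
  sort leq [seq entry w j | j <- iota 1 (size w)
                          & lower_record w j || upper_record w j].

(* r_k, k in Z, padded by 1 on the left and by n on the right; the increasing
   list of record values starts with the index -ell. *)
Definition record_value (w : seq nat) (k : int) : nat :=
  if k < - (nb_lower w)%:Z then 1%N
  else if (nb_upper w)%:Z < k then size w
  else nth 0%N (record_values w) (absz ((nb_lower w)%:Z + k)).

Definition rank (x : nat) (w : seq nat) : nat := count (fun y => y <= x)%N w.

Definition ranking (w : seq nat) : seq nat := [seq rank x w | x <- w].

(* 'S_0 is a singleton, so the index n = 0 carries no information. *)
Definition coherent (s : forall n : nat, 'S_n) : Prop :=
  forall m n : nat, (m <= n)%N -> word (s m) = ranking (take m (word (s n))).

Definition initial_rank (w : seq nat) (j : nat) : nat :=
  rank (entry w j) (take j w).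

Section Domain.
Context {R : realType}.
Implicit Types (theta zeta : R) (alpha : int -> R).

Definition lower_sum theta alpha (l : nat) : R :=
  theta + \sum_(1 <= j < l.+1) alpha (- j%:Z).

Definition upper_sum zeta alpha (u : nat) : R :=
  zeta + \sum_(1 <= j < u.+1) alpha j%:Z.

(* The value alpha 0 is never used. *)
Definition principal_domain theta zeta alpha : Prop :=
  [/\ forall k : int, k != 0 -> 0 < 1 - alpha k,
      forall l : nat, 0 < lower_sum theta alpha l
    & forall u : nat, 0 < upper_sum zeta alpha u].

End Domain.

Section RandomSequence.
Context {R : realType} {d : measure_display} {Omega : measurableType d}.

(* P(i_(n+1) = r | pi_n = s) = q; nothing is required if pi_n = s has probability
   0. The initial rank i_(n+1) can be read off from pi_(n+1) by coherence. *)
Definition next_rank_prob (P : probability Omega R) (pi_ : forall n : nat, Omega -> 'S_n)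
    (n : nat) (s : 'S_n) (r : nat) (q : R) : Prop :=
  P [set omega | pi_ n omega = s
                 /\ initial_rank (word (pi_ n.+1 omega)) n.+1 = r] =
  (P [set omega | pi_ n omega = s] * q%:E)%E.

Definition initial_rank_law (P : probability Omega R) (theta zeta : R) (alpha : int -> R)
    (pi_ : forall n : nat, Omega -> 'S_n) : Prop :=
  forall (n : nat) (s : 'S_n), (0 < n)%N ->
    let r_ k := record_value (word s) k in
    let gap k : R := (r_ k)%:R - (r_ (k - 1))%:R in
    let l := nb_lower (word s) in
    let u := nb_upper (word s) in
    let D : R := theta + zeta + n%:R - 1 in
    [/\ next_rank_prob P pi_ s 1 (lower_sum theta alpha l / D),
        forall (k : int) (r : nat), - l%:Z < k <= 0 -> (r_ (k - 1)%R < r <= r_ k)%N ->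
          next_rank_prob P pi_ s r ((1 - alpha (k - 1) / gap k) / D),
        forall (k : int) (r : nat), 0 < k <= u%:Z -> (r_ (k - 1)%R < r <= r_ k)%N ->
          next_rank_prob P pi_ s r ((1 - alpha k / gap k) / D)
      & next_rank_prob P pi_ s n.+1 (upper_sum zeta alpha u / D)].

Definition Gamma (x : R) : R :=
  \int[lebesgue_measure]_(t in `]0, +oo[) (t `^ (x - 1) * expR (- t)).

Definition beta_density (a b x : R) : R :=
  x `^ (a - 1) * (1 - x) `^ (b - 1) * Gamma (a + b) / (Gamma a * Gamma b).

Definition has_beta_law (P : probability Omega R) (X : {RV P >-> R}) (a b : R) : Prop :=
  forall A : set R, measurable A ->
    distribution P X A =
    (\int[lebesgue_measure]_(x in A `&` `[0%R, 1%R]) (beta_density a b x)%:E)%E.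

Definition mutually_independent (P : probability Omega R) (I : eqType)
    (X : I -> {RV P >-> R}) : Prop :=
  forall (J : seq I) (B : I -> set R), uniq J -> (forall i, measurable (B i)) ->
    P (\bigcap_(i in [set` J]) (X i @^-1` B i)) =
    (\prod_(i <- J) P (X i @^-1` B i))%E.

Definition sigma_generated (P : probability Omega R) (I : Type)
    (X : I -> {RV P >-> R}) (K : set I) : set (set Omega) :=
  <<s \bigcup_(i in K) preimage_set_system setT (X i) measurable >>.

(* f(Y) is a version of the conditional probability P(A | Y). *)
Definition cond_prob_version (P : probability Omega R) (Y : {RV P >-> R})
    (A : set Omega) (f : R -> R) : Prop :=
  measurable_fun setT f /\
  forall C : set R, measurable C ->
    P (A `&` Y @^-1` C) = (\int[P]_(omega in Y @^-1` C) (f (Y omega))%:E)%E.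

(* P(A n B | Y) = P(A | Y) P(B | Y) almost surely, for all A in F and B in G;
   versions of a conditional probability are almost surely unique. *)
Definition cond_independent (P : probability Omega R) (Y : {RV P >-> R})
    (F G : set (set Omega)) : Prop :=
  forall A B : set Omega, F A -> G B ->
    exists f g : R -> R,
      [/\ cond_prob_version Y A f, cond_prob_version Y B g
        & cond_prob_version Y (A `&` B) (fun y => f y * g y)].

End RandomSequence.

(* Main.v *)
(* Let y_j be the number of values of pi_n below r_(-j), and z_j the number above r_j. A
   new entry raises y_j by one with probability proportional to theta + alpha_(-1) + ... +
   alpha_(-j) + y_j as soon as y_(j-1) > 0, and symmetrically for z_j, so the counts form
   a hierarchy of Polya urns. Consequently, for arbitrary exponents, the product of the
   moments of the beta laws with parameters updated by the current counts is a bounded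
   martingale. With all exponents 1 on one side it differs from y_j / n by O(1/n), hence
   has increments O(1/n), and converges almost surely along the cubes n = k^3 and between
   them: y_j / n has a limit W_j. For general exponents the martingale tends to the
   product of the powers of W_0, 1 - W_0 and of the ratios of consecutive limits, so the
   mixed moments of these variables are products of beta moments. Moments determine laws
   on [0, 1], which gives both the beta laws and the independence; each W_j is almost
   surely positive because beta laws have no atom at 0. *)
Require Import Defs.
From HB Require Import structures.
From mathcomp Require Import all_boot all_order all_algebra all_fingroup.
From mathcomp Require Import all_classical all_reals all_analysis.
From mathcomp Require Import measurable_realfun zify ring lra.

Set Implicit Arguments.
Unset Strict Implicit.
Unset Printing Implicit Defensive.

Import Order.TTheory GRing.Theory Num.Theory.
Import numFieldNormedType.Exports.

Local Open Scope classical_set_scope.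
Local Open Scope ring_scope.

(** * Words and record counts *)

Section Words.
Local Open Scope nat_scope.

(** Two limits that may both vanish cannot be divided, and this shapes the proof: passing to the
    limit in the general martingale requires W_j > 0, whereas the positivity of W_(j+1) is a
    consequence of the law of the ratio W_(j+1) / W_j. An exponent 0 breaks the circle, because the
    factor of that level is then constant: with a single positive exponent the law of one ratio
    follows from W_j > 0 alone, which yields W_(j+1) > 0, and the joint moments come afterwards.
    Conditional independence given rho_0 is derived from the unconditional independence of rho_0,
    the T_k and the Z_k: each rho_k is a function of rho_0 and of the factors on its own side, and
    Radon-Nikodym densities with respect to the law of rho_0 provide the versions of the conditional
    probabilities. *)

Definition step_word (w : seq nat) (i : nat) : seq nat := rcons (map (bump i) w) i.

Definition perm_word (w : seq nat) := perm_eq w (iota 1 (size w)).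

Lemma size_word n (s : 'S_n) : size (word s) = n.
Proof. by rewrite size_map size_enum_ord. Qed.

Lemma perm_word_word n (s : 'S_n) : perm_word (word s).
Proof.
rewrite /perm_word size_word; apply: uniq_perm; last 2 first.
- exact: iota_uniq.
- move=> x; rewrite mem_iota add1n; apply/mapP/idP => [[j _ ->]|/andP[x0 xn]].
    by have := ltn_ord (s j); lia.
  have xn' : x.-1 < n by lia.
  exists ((s^-1)%g (Ordinal xn')); first by rewrite mem_enum.
  by rewrite permKV /= prednK.
by rewrite map_inj_uniq ?enum_uniq// => i j [] /val_inj /perm_inj.
Qed.

Lemma mem_perm_word w x : perm_word w -> (x \in w) = (0 < x <= size w).
Proof. by move=> /perm_mem ->; rewrite mem_iota; lia. Qed.

Lemma perm_word_step w i : perm_word w -> 0 < i <= (size w).+1 -> perm_word (step_word w i).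
Proof.
move=> pw iP; have [uw mw] := (perm_uniq pw, perm_mem pw).
have us : uniq (step_word w i).
  rewrite rcons_uniq map_inj_uniq ?uw ?iota_uniq ?andbT; last exact: (can_inj (@bumpK i)).
  by apply/mapP => -[x _]; apply/eqP; exact: neq_bump.
apply: uniq_perm => //; first exact: iota_uniq.
have sub : {subset step_word w i <= iota 1 (size (step_word w i))}.
  move=> x; rewrite mem_rcons inE mem_iota size_rcons size_map => /predU1P[->|]; first by lia.
  by move=> /mapP[y]; rewrite mw mem_iota => yw ->; rewrite /bump; lia.
by have [] := uniq_min_size us sub; rewrite size_iota.
Qed.

Lemma count_leq_iota m x : count (fun y => y <= x) (iota 1 m) = minn x m.
Proof.
elim: m => [|m IH]; first by rewrite minn0.
rewrite -[m.+1]addn1 iotaD count_cat IH /=; lia.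
Qed.

Lemma rank_perm_word w x : perm_word w -> x <= size w -> rank x w = x.
Proof. by move=> /seq.permP pw xw; rewrite /rank pw count_leq_iota; lia. Qed.

(** Ranking without the last entry [v] lowers exactly the entries above [v] by one, and [bump v]
    undoes this. *)
Lemma bump_unrank w v x : perm_word (rcons w v) -> x \in w -> bump v (rank x w) = x.
Proof.
move=> pw xw.
have xw' : x \in rcons w v by rewrite mem_rcons inE xw orbT.
have := pw => /mem_perm_word - /(_ x); rewrite xw' => /esym /andP[x0 xs].
have := rank_perm_word pw xs; rewrite /rank -cats1 count_cat /= addn0 => e.
have xv : x != v.
  have := perm_uniq pw; rewrite iota_uniq rcons_uniq => /andP[vw _].
  by apply: contraNneq vw => <-.
by rewrite /bump; lia.
Qed.

(** The last entry of a permutation of 1, ..., n+1 is its own initial rank, so the initial ranks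
    alone drive the growth of a coherent sequence. *)
Lemma word_step (s : forall n : nat, 'S_n) n : coherent s ->
  let i := initial_rank (word (s n.+1)) n.+1 in
  (0 < i <= n.+1) /\ word (s n.+1) = step_word (word (s n)) i.
Proof.
move=> /(_ n n.+1 (leqnSn n)) + i.
have := perm_word_word (s n.+1); have := size_word (s n.+1).
rewrite {}/i; case/lastP: (word (s n.+1)) => // w v; rewrite size_rcons => -[sw] pw.
rewrite -cats1 take_cat sw ltnn subnn take0 cats0 => ->.
have vin : v \in rcons w v by rewrite mem_rcons mem_head.
have := mem_perm_word v pw; rewrite vin size_rcons sw => /esym vn.
have -> : initial_rank (w ++ [:: v]) n.+1 = v.
  rewrite /initial_rank /entry /= nth_cat sw ltnn subnn /= take_oversize ?size_cat ?sw ?addn1//.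
  by rewrite cats1 rank_perm_word // size_rcons sw; lia.
split=> //; rewrite /step_word cats1 /ranking -map_comp; congr rcons.
rewrite -[LHS]map_id; apply/eq_in_map => x xw /=.
by rewrite bump_unrank.
Qed.

Section step.
Variables (w : seq nat) (i : nat).
Hypotheses (w0 : 0 < size w) (pw : perm_word w) (pw' : perm_word (step_word w i)).
Let n := size w.
Hypothesis iP : 0 < i <= n.+1.

Let size_step : size (step_word w i) = n.+1.
Proof. by rewrite size_rcons size_map. Qed.

Lemma entry_step j : (0 < j <= n) -> entry (step_word w i) j = bump i (entry w j).
Proof.
move=> jn; rewrite /entry nth_rcons size_map -/n.
by rewrite ifT ?(nth_map 0); rewrite -/n; lia.
Qed.

Lemma entry_step_last : entry (step_word w i) n.+1 = i.
Proof. by rewrite /entry nth_rcons size_map ltnn eqxx. Qed.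

Lemma take_step j : j <= n -> take j (step_word w i) = map (bump i) (take j w).
Proof.
move=> jn; rewrite /step_word -cats1 take_cat size_map -/n map_take.
case: ltnP => // nj; have -> : j = n by lia.
by rewrite subnn take0 cats0 take_oversize ?size_map.
Qed.

Lemma lower_record_step j : 0 < j <= n -> lower_record (step_word w i) j = lower_record w j.
Proof.
move=> jn; rewrite /lower_record entry_step // take_step ?all_map; last by lia.
by apply: eq_all => x /=; rewrite leq_bump2.
Qed.

Lemma upper_record_step j : 0 < j <= n -> upper_record (step_word w i) j = upper_record w j.
Proof.
move=> jn; rewrite /upper_record entry_step // take_step ?all_map; last by lia.
by apply: eq_all => x /=; rewrite leq_bump2.
Qed.

Lemma lower_record_last : lower_record (step_word w i) n.+1 = (i == 1).
Proof.
rewrite /lower_record entry_step_last take_oversize ?size_step//.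
apply/allP/eqP => [/(_ 1)|i1 x].
  by rewrite mem_perm_word// size_step => /(_ isT); lia.
by rewrite mem_perm_word// i1 ?size_step => /andP[].
Qed.

Lemma upper_record_last : upper_record (step_word w i) n.+1 = (i == n.+1).
Proof.
rewrite /upper_record entry_step_last take_oversize ?size_step//.
apply/allP/eqP => [/(_ n.+1)|i1 x].
  by rewrite mem_perm_word// size_step leqnn => /(_ isT); lia.
by rewrite mem_perm_word// size_step i1 => /andP[].
Qed.

Let iota2 : iota 2 n = iota 2 n.-1 ++ [:: n.+1].
Proof. by rewrite -[in LHS](prednK (w0 : 0 < n)) -[n.-1.+1]addn1 iotaD /= add2n prednK. Qed.

Lemma nb_lower_step : nb_lower (step_word w i) = nb_lower w + (i == 1).
Proof.
rewrite /nb_lower size_step [n.+1.-1]/= iota2 count_cat.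
congr (_ + _).
  apply: eq_in_count => j; rewrite mem_iota => jn; rewrite lower_record_step//; lia.
by rewrite /= addn0 lower_record_last.
Qed.

Lemma nb_upper_step : nb_upper (step_word w i) = nb_upper w + (i == n.+1).
Proof.
rewrite /nb_upper size_step [n.+1.-1]/= iota2 count_cat.
congr (_ + _).
  apply: eq_in_count => j; rewrite mem_iota => jn; rewrite upper_record_step//; lia.
by rewrite /= addn0 upper_record_last.
Qed.

(** [bump i] preserves order, so old positions keep their status and only position [n.+1] can add a
    record. As [w] is nonempty, [i == 1] and [i == n.+1] exclude each other. *)
Lemma record_values_step : record_values (step_word w i) =
  (if i == 1 then cons 1 else if i == n.+1 then rcons^~ n.+1 else id)
    (map (bump i) (record_values w)).
Proof.
rewrite /record_values size_step -[n.+1 in LHS]addn1 iotaD filter_cat map_cat.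
set A := map _ (seq.filter _ (iota 1 n)).
have -> : A = map (bump i) [seq entry w j | j <- iota 1 n & lower_record w j || upper_record w j].
  rewrite /A -map_comp.
  have -> : seq.filter (fun j => lower_record (step_word w i) j || upper_record (step_word w i) j)
      (iota 1 n) = seq.filter (fun j => lower_record w j || upper_record w j) (iota 1 n).
    apply: eq_in_filter => j; rewrite mem_iota => jn.
    by rewrite lower_record_step ?upper_record_step//; lia.
  apply/eq_in_map => j; rewrite mem_filter mem_iota => /andP[_ jn] /=.
  by rewrite entry_step//; lia.
set B := [seq entry w j | j <- _ & _].
have smono : {homo bump i : x y / x <= y} by move=> x y; rewrite leq_bump2.
have sB : sorted leq (map (bump i) (sort leq B)).
  by rewrite sorted_map; apply: sub_sorted (sort_sorted leq_total B) => x y; apply: smono.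
have Bin x : x \in B -> 0 < x <= n.
  move=> /mapP[j]; rewrite mem_filter mem_iota => /andP[_ jn] ->.
  by rewrite -(mem_perm_word _ pw) mem_nth// -/n; lia.
rewrite /= lower_record_last upper_record_last.
have pB : perm_eq (map (bump i) B) (map (bump i) (sort leq B)).
  by apply: perm_map; rewrite perm_sym perm_sort.
have srt s t : sorted leq t -> perm_eq s t -> sort leq s = t.
  move=> st pst; apply: (sorted_eq leq_trans anti_leq) => //; first exact: sort_sorted leq_total _.
  by rewrite perm_sort.
case: eqVneq => [i1|i1] /=.
  apply: srt; last by rewrite entry_step_last i1 cats1 perm_rcons perm_cons -i1.
  rewrite [sorted _ _]/= (path_sortedE leq_trans) sB andbT.
  by apply/allP => x /mapP[y]; rewrite mem_sort => /Bin yn ->; rewrite /bump; lia.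
case: eqVneq => [iN|iN] /=.
  apply: srt; last by rewrite -cats1 entry_step_last iN perm_cat2r -iN.
  rewrite -cats1 sorted_pairwise ?pairwise_cat//= ?andbT; last exact: leq_trans.
  rewrite -sorted_pairwise ?sB ?andbT; last exact: leq_trans.
  rewrite allrel1r; apply/allP => x /mapP[y]; rewrite mem_sort => /Bin yn ->.
  by rewrite /bump; lia.
by rewrite cats0; apply: srt.
Qed.

End step.

(** What the indexing of the record values by -l, ..., u relies on: no value is repeated, and the
    two ends are 1 and n, so that the padding continues the list. *)
Definition good_word w :=
  [/\ sorted ltn (record_values w), size (record_values w) = nb_lower w + nb_upper w + 1,
      nth 0 (record_values w) 0 = 1
    & nth 0 (record_values w) (nb_lower w + nb_upper w) = size w].

Lemma good_word1 w : size w = 1 -> perm_word w -> good_word w.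
Proof.
case: w => [|x [|//]] // _ /perm_mem /(_ 1) /=; rewrite inE => /eqP <-.
by split.
Qed.

Lemma good_word_step w i : 0 < size w -> perm_word w -> perm_word (step_word w i) ->
  0 < i <= (size w).+1 -> good_word w -> good_word (step_word w i).
Proof.
move=> w0 pw pw' iP [sw zw hw tw]; rewrite /good_word record_values_step//.
rewrite nb_lower_step// nb_upper_step// size_rcons size_map.
set l := nb_lower w in zw tw *; set u := nb_upper w in zw tw *.
have sm : sorted ltn (map (bump i) (record_values w)).
  by rewrite sorted_map; apply: sub_sorted sw => x y /=; rewrite /bump; lia.
have pos x : x \in record_values w -> 1 <= x <= size w.
  rewrite /record_values mem_sort => /mapP[j]; rewrite mem_filter mem_iota => /andP[_ jn] ->.
  by rewrite -mem_perm_word// mem_nth//; move: jn; rewrite -!/(size w); set n := size w; lia.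
case: eqVneq => [i1|i1] /=.
  rewrite (_ : (i == (size w).+1) = false) ?addn0; last by lia.
  rewrite size_map zw; split => //.
  - rewrite (path_sortedE ltn_trans) sm andbT; apply/allP => x /mapP[y /pos yP ->].
    by rewrite /= /bump; lia.
  - by lia.
  - have -> : l + 1 + u = (l + u).+1 by lia.
    rewrite /= (nth_map 0) ?zw ?tw; last by lia.
    by rewrite /bump; lia.
rewrite addn0; case: eqVneq => [iN|iN] /=.
  rewrite size_rcons size_map zw; split => //.
  - rewrite sorted_pairwise -?cats1 ?pairwise_cat//= ?andbT; last exact: ltn_trans.
    rewrite -sorted_pairwise ?sm ?andbT; last exact: ltn_trans.
    rewrite allrel1r; apply/allP => x /mapP[y /pos yn ->].
    by rewrite /= /bump; lia.
  - by lia.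
  - rewrite nth_rcons size_map zw ifT; last by lia.
    by rewrite (nth_map 0) ?zw ?hw /bump; lia.
  - by rewrite nth_rcons size_map zw addnA ltnn eqxx.
rewrite size_map zw addn0; split => //.
- by rewrite (nth_map 0) ?zw ?hw /bump; lia.
- by rewrite (nth_map 0) ?zw ?tw /bump; lia.
Qed.

(* By the padding of the record values these counts vanish from j = nb_lower w,
   respectively j = nb_upper w, on. *)
Definition below w j := (record_value w (- j%:Z)%R).-1.
Definition above w j := size w - record_value w j%:Z.

Lemma record_valueN w j : record_value w (- j%:Z)%R =
  if j <= nb_lower w then nth 0 (record_values w) (nb_lower w - j) else 1.
Proof.
rewrite /record_value; case: leqP => jl.
  by rewrite !ifF; [congr nth|..]; lia.
by rewrite ifT//; lia.
Qed.

Lemma record_valueP w j : record_value w j%:Z =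
  if j <= nb_upper w then nth 0 (record_values w) (nb_lower w + j) else size w.
Proof.
rewrite /record_value ifF; last by lia.
case: leqP => jl; last by rewrite ifT//; lia.
by rewrite ifF; [congr nth|]; lia.
Qed.

Section good.
Variable w : seq nat.
Hypothesis gw : good_word w.
Let l := nb_lower w.
Let u := nb_upper w.

Lemma record_values_lt i j : i < j <= l + u ->
  nth 0 (record_values w) i < nth 0 (record_values w) j.
Proof.
case: gw => sw zw _ _ /andP[ij ju].
by apply: (sorted_ltn_nth ltn_trans 0 sw); rewrite ?inE ?zw -/l -/u; lia.
Qed.

Lemma record_values_bound i : i <= l + u -> 1 <= nth 0 (record_values w) i <= size w.
Proof.
case: gw => sw zw hw tw iu.
rewrite -{1}hw -tw; apply/andP; split.
  by case: i iu => // i iu; apply/ltnW/record_values_lt.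
have [->//|ne] := eqVneq i (l + u).
by apply/ltnW/record_values_lt; rewrite leqnn andbT ltn_neqAle ne.
Qed.

Lemma record_value_bound k : 0 < size w -> 1 <= record_value w k <= size w.
Proof.
move=> w0; rewrite /record_value; case: ifP => [_|h1]; first by rewrite w0.
case: ifP => [_|h2]; first by rewrite leqnn w0.
by apply: record_values_bound; rewrite /l /u; lia.
Qed.

Lemma below_gt0 j : (0 < below w j) = (j < l).
Proof.
case: gw => sw zw hw tw; rewrite /below record_valueN -/l.
case: (ltngtP j l) => // jl; last by rewrite jl subnn hw.
have := @record_values_lt 0 (l - j); rewrite hw; lia.
Qed.

Lemma above_gt0 j : 0 < size w -> (0 < above w j) = (j < u).
Proof.
move=> w0; case: gw => sw zw hw tw; rewrite /above record_valueP -/u.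
case: (ltngtP j u) => jl; last by rewrite jl tw subnn.
  have := @record_values_lt (l + j) (l + u); rewrite tw -/l; lia.
lia.
Qed.

(** The predecessor accounts for r_(-j-1), which is itself one of the values below r_(-j); past the
    last record both sides are 0. *)
Lemma belowS j : below w j.+1 <= (below w j).-1.
Proof.
case: gw => sw zw hw tw; rewrite /below !record_valueN -/l.
case: (leqP j.+1 l) => jl //.
by rewrite ifT; [have := @record_values_lt (l - j.+1) (l - j); lia|lia].
Qed.

Lemma aboveS j : above w j.+1 <= (above w j).-1.
Proof.
case: gw => sw zw hw tw; rewrite /above !record_valueP -/u -/l.
case: (leqP j.+1 u) => jl //; last by lia.
rewrite ifT; last by lia.
have := @record_values_lt (l + j) (l + j.+1).
have := @record_values_bound (l + j.+1); lia.
Qed.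

Lemma below_above0 : below w 0 + above w 0 = (size w).-1.
Proof.
case: gw => sw zw hw tw; rewrite /below /above record_valueN -/l /= subn0.
have := @record_values_bound l; lia.
Qed.

(** Level [j] is open once the record of index [-j], respectively [j], exists. The count is 0 at the
    outermost open level, which can be raised, and at the closed ones, which cannot. *)
Definition active (y : nat -> nat) j := (j == 0) || (0 < y j.-1).

Lemma active_below j : active (below w) j = (j <= l).
Proof. by case: j => // j; rewrite /active /= below_gt0. Qed.

Lemma active_above j : 0 < size w -> active (above w) j = (j <= u).
Proof. by case: j => // j w0; rewrite /active /= above_gt0. Qed.

Section step.
Variable i : nat.
Hypotheses (w0 : 0 < size w) (pw : perm_word w) (pw' : perm_word (step_word w i)).
Hypothesis iP : 0 < i <= (size w).+1.

(** A new minimum lengthens the list at its left end and increases [nb_lower], so every old record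
    keeps its index; its value is raised exactly when the new entry lands at or below it. In the
    padded range the new minimum 1 has nothing below it. *)
Lemma below_step j :
  below (step_word w i) j = below w j + (active (below w) j && (i <= (below w j).+1)).
Proof.
case: gw => sw zw hw tw.
rewrite active_below /below !record_valueN nb_lower_step// record_values_step// -/l.
case: (leqP j l) => jl /=.
  have rb := @record_values_bound (l - j).
  rewrite ifT; last by lia.
  have [i1|i1] /= := eqVneq i 1.
    rewrite -addnBAC ?addn1//= (nth_map 0) ?zw -/l -/u /bump; lia.
  case: eqVneq => iN /=; rewrite ?nth_rcons ?size_map ?addn0 ?zw -/l -/u ?ifT;
    rewrite ?(nth_map 0) ?zw -/l -/u /bump; lia.
have [i1|i1] /= := eqVneq i 1; last by rewrite ifF//; lia.
by case: ifP => // jl'; have -> : l + 1 - j = 0 by lia.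
Qed.

Lemma above_step j : above (step_word w i) j =
  above w j + (active (above w) j && (size w - above w j < i)).
Proof.
case: gw => sw zw hw tw.
rewrite active_above// /above !record_valueP nb_lower_step// nb_upper_step//.
rewrite record_values_step// -/l -/u size_rcons size_map.
case: (leqP j u) => jl /=.
  have rb := @record_values_bound (l + j).
  rewrite ifT; last by lia.
  have [i1|i1] /= := eqVneq i 1.
    rewrite addn1 addSn /= (nth_map 0) ?zw -/l -/u /bump; lia.
  case: eqVneq => iN /=; rewrite ?nth_rcons ?size_map ?addn0 ?zw -/l -/u ?ifT;
    rewrite ?(nth_map 0) ?zw -/l -/u /bump; lia.
rewrite subnn addn0 /=.
have [iN|iN] := eqVneq i (size w).+1; last by rewrite ifF; lia.
case: ifP => jl' /=; last by lia.
rewrite ifF; last by lia.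
rewrite nth_rcons size_map zw -/l -/u ifF; last by lia.
by rewrite ifT; lia.
Qed.

End step.
End good.

Lemma good_word_word (s : forall n : nat, 'S_n) n : coherent s -> 0 < n -> good_word (word (s n)).
Proof.
move=> cs; elim: n => // -[_ _|n IH _].
  by apply: good_word1; rewrite ?size_word//; exact: perm_word_word.
have [iP e] := word_step n.+1 cs.
move: (perm_word_word (s n.+2)); rewrite e => pw'.
by apply: good_word_step => //; rewrite ?size_word//; [exact: perm_word_word|exact: IH].
Qed.

End Words.

(** * Moments of beta laws *)

Section Rising.
Variable R : realFieldType.
Implicit Types a b : R.

Definition rising a (p : nat) : R := \prod_(i < p) (a + i%:R).

Lemma rising_gt0 a p : 0 < a -> 0 < rising a p.
Proof. by move=> a0; apply: prodr_gt0 => i _; rewrite ltr_wpDr. Qed.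

Lemma risingSr a p : rising a p.+1 = rising a p * (a + p%:R).
Proof. by rewrite /rising big_ord_recr. Qed.

Lemma risingS a p : a * rising (a + 1) p = rising a p * (a + p%:R).
Proof.
rewrite -risingSr /rising big_ord_recl addr0; congr (_ * _).
by apply: eq_bigr => i _; rewrite -addrA nat1r.
Qed.

(* The moment E[X^p (1 - X)^q] of a beta(a, b) variable X. *)
Definition mom a b p q : R := rising a p * rising b q / rising (a + b) (p + q).

Lemma mom_ge0 a b p q : 0 < a -> 0 < b -> 0 <= mom a b p q.
Proof.
by move=> a0 b0; rewrite /mom ltW// divr_gt0 ?mulr_gt0 ?rising_gt0// addr_gt0.
Qed.

(** One step of a Polya urn with weights a and b: the parameter of the colour drawn grows by one,
    and the beta moment is preserved on average. This comes down to [risingS], applied to a, b and a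
    + b. *)
Lemma mom_step a b p q : 0 < a -> 0 < b ->
  a * mom (a + 1) b p q + b * mom a (b + 1) p q = (a + b) * mom a b p q.
Proof.
move=> a0 b0; rewrite /mom [a + (b + 1)]addrA (addrAC a 1 b).
have ab0 : 0 < a + b by rewrite addr_gt0.
have e := risingS (a + b) (p + q).
have r0 : rising (a + b) (p + q) != 0 by rewrite gt_eqF ?rising_gt0.
have r1 : rising (a + b + 1) (p + q) != 0 by rewrite gt_eqF ?rising_gt0// addr_gt0.
have -> : a * (rising (a + 1) p * rising b q / rising (a + b + 1) (p + q)) +
  b * (rising a p * rising (b + 1) q / rising (a + b + 1) (p + q)) =
  (a * rising (a + 1) p * rising b q + b * rising (b + 1) q * rising a p) /
    rising (a + b + 1) (p + q) by ring.
rewrite [RHS]mulrA; apply/eqP; rewrite eqr_div// !risingS.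
have -> : (rising a p * (a + p%:R) * rising b q + rising b q * (b + q%:R) * rising a p) *
  rising (a + b) (p + q) =
  rising a p * rising b q * (rising (a + b) (p + q) * (a + b + (p + q)%:R)).
  by rewrite natrD; ring.
by rewrite -e; apply/eqP; ring.
Qed.

Lemma mom00 a b : 0 < a -> 0 < b -> mom a b 0 0 = 1.
Proof. by move=> a0 b0; rewrite /mom /rising !big_ord0 mulr1 divff// oner_eq0. Qed.

(** Factors are compared one by one: a + i with a + b + i, then b + q with a + b + p + q. *)
Lemma mom_le1 a b p q : 0 < a -> 0 < b -> mom a b p q <= 1.
Proof.
move=> a0 b0; have ab0 : 0 < a + b by rewrite addr_gt0.
rewrite /mom ler_pdivrMr ?rising_gt0// mul1r.
elim: q => [|q IH].
  rewrite addn0 {2}/rising big_ord0 mulr1.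
  apply: ler_prod => i _; apply/andP; split; first by rewrite addr_ge0// ltW.
  by rewrite lerD2r lerDl ltW.
rewrite addnS !risingSr mulrA; apply: ler_pM => //.
- by rewrite ltW// mulr_gt0 ?rising_gt0.
- by rewrite addr_ge0// ltW.
by rewrite natrD; have := ler0n R p; lra.
Qed.

End Rising.

(** * The hierarchy of urns on one side of the first entry *)

Section Chain.
Variables (R : realFieldType) (a b : nat -> R) (c : R) (p : nat -> nat).
Variables (y : nat -> nat) (rs : seq nat) (Q : nat -> R) (s : nat -> nat -> bool).
Hypothesis a0 : forall j, 0 < a j.
Hypothesis b0 : forall j, 0 < b j.+1.
Hypothesis abS : forall j, a j.+1 + b j.+1 = a j + 1.
Hypothesis yS : forall j, (y j.+1 <= (y j).-1)%N.
Hypothesis sS : forall j r, s j.+1 r -> s j r.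
Hypothesis QE : forall j, active y j -> \sum_(r <- rs | s j r) Q r = c * (a j + (y j)%:R).

Definition chain_step (r j : nat) : nat := (y j + (active y j && s j r))%N.

(** The moment of the ratio T_(-j-1) under its posterior law: of the [v j] values below r_(-j) one
    is the next record, [v j.+1] lie below that record and the others in between. Because of [.-1],
    the counts [v j = 0] and [v j = 1] (with [v j.+1 = 0]) give the same value: the mere arrival of
    the next record carries no information on the ratio. *)
Definition level_mom (v : nat -> nat) (j : nat) : R :=
  mom (a j.+1 + (v j.+1)%:R) (b j.+1 + ((v j).-1 - v j.+1)%N%:R) (p j) 0.

Lemma s_mono j k r : (j <= k)%N -> s k r -> s j r.
Proof.
move=> /subnK <-; elim: (k - j)%N => // m IH.
by rewrite addSn => /sS.
Qed.

Lemma y0_tail j k : (j < k)%N -> y j = 0%N -> y k = 0%N.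
Proof.
move=> /subnK <-; rewrite addnS; elim: (k - j.+1)%N => [|m IH] y0.
  by have := yS j; rewrite y0 add0n; lia.
by have := yS (m + j).+1; rewrite addSn IH//; lia.
Qed.

(** Restricting the sum to the ranks that raise level [k] lets the induction on the number of levels
    close: these ranks split into those that also raise level [k.+1], of weight c A, and the others,
    of weight c B, and [mom_step] averages the two updated moments. *)
Lemma chain k m : active y k ->
  \sum_(r <- rs | s k r) Q r * \prod_(k <= j < k + m) level_mom (chain_step r) j =
  c * (a k + (y k)%:R) * \prod_(k <= j < k + m) level_mom y j.
Proof.
elim: m k => [|m IH] k ak.
  rewrite addn0 !big_geq// mulr1 -QE//.
  by apply: eq_bigr => r _; rewrite big_geq ?mulr1.
(* If [y k = 0], all deeper counts are 0 as well, and the step only turns [y k] into 1, which no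
   factor from level [k] on notices. *)
have [yk|yk] := posnP (y k).
  rewrite -QE// big_distrl/=; apply: eq_bigr => r skr; congr (_ * _).
  apply: eq_big_nat => j /andP[kj _]; rewrite /level_mom.
  have yj : y j = 0%N by move: kj; rewrite leq_eqVlt => /orP[/eqP<-//|/y0_tail/(_ yk)].
  have yj1 : y j.+1 = 0%N by apply: (y0_tail _ yk); rewrite ltnS.
  have -> : chain_step r j.+1 = y j.+1 by rewrite /chain_step /active /= yj ltnn addn0.
  rewrite /chain_step; move: kj; rewrite leq_eqVlt => /orP[/eqP<-|kj].
    by rewrite ak skr yk.
  case: j kj yj {yj1} => // j kj yj; rewrite /active /= (_ : y j = 0%N) ?yj//.
  by move: kj; rewrite ltnS leq_eqVlt => /orP[/eqP<-//|/y0_tail/(_ yk)].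
have ak1 : active y k.+1 by rewrite /active /= yk.
set A := a k.+1 + (y k.+1)%:R; set B := b k.+1 + ((y k).-1 - y k.+1)%N%:R.
have A0 : 0 < A by rewrite ltr_wpDr.
have B0 : 0 < B by rewrite ltr_wpDr.
(* The predecessor in [B] absorbs the 1 in [abS]. *)
have AB : A + B = a k + (y k)%:R.
  have := abS k; have := yS k; rewrite /A /B => ys.
  by rewrite natrB//; move: yk; case: (y k) => // v _ /=; rewrite -[v.+1%:R]natr1; lra.
rewrite (bigID (s k.+1)) /=.
have kk : (k + m.+1 = k.+1 + m)%N by lia.
have kl : (k < k + m.+1)%N by lia.
rewrite (eq_bigl (s k.+1)); last first.
  by move=> r; apply/andP/idP => [[]//|h]; split => //; exact: sS.
rewrite (eq_bigr (fun r => mom (A + 1) B (p k) 0 *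
    (Q r * \prod_(k.+1 <= j < k.+1 + m) level_mom (chain_step r) j))); last first.
  move=> r sr; rewrite big_ltn// kk mulrCA; congr (_ * _).
  rewrite /level_mom /chain_step ak1 ak sr (sS sr) /= natrD addrA; congr mom.
  by rewrite /B; congr (_ + _%:R); lia.
rewrite -big_distrr/= IH//.
rewrite [X in _ + X](eq_bigr (fun r => Q r * (mom A (B + 1) (p k) 0 *
    \prod_(k.+1 <= j < k.+1 + m) level_mom y j))); last first.
  move=> r /andP[skr sr]; congr (_ * _).
  have st j : (k < j)%N -> chain_step r j = y j.
    move=> kj; rewrite /chain_step (_ : s j r = false) ?andbF ?addn0//.
    by apply: contraNF sr; apply: s_mono.
  rewrite big_ltn// kk; congr (_ * _).
    rewrite /level_mom st// /chain_step ak skr; congr mom.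
    by rewrite /B -addrA natr1; congr (_ + _%:R); have := yS k; lia.
  by apply: eq_big_nat => j /andP[kj _]; rewrite /level_mom !st//; lia.
rewrite -big_distrl/=.
have -> : \sum_(r <- rs | s k r && ~~ s k.+1 r) Q r = c * B.
  have := QE ak; rewrite (bigID (s k.+1)) /=.
  rewrite (eq_bigl (s k.+1)); last first.
    by move=> r; apply/andP/idP => [[]//|h]; split => //; exact: sS.
  by rewrite QE// -AB -/A [RHS]mulrDr => /addrI.
rewrite -AB [in RHS]big_ltn// kk -/A.
rewrite (_ : level_mom y k = mom A B (p k) 0)// [in RHS]mulrA -[c * _ * mom _ _ _ _]mulrA -mom_step//.
by ring.
Qed.

End Chain.

(** * Joining the two sides *)

Section TwoSided.
Variables (R : realFieldType) (a b a' b' : nat -> R) (c : R).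
Variables (p0 q0 : nat) (p p' : nat -> nat).
Variables (y z : nat -> nat) (rs : seq nat) (Q : nat -> R) (s t : nat -> nat -> bool).
Hypotheses (a0 : forall j, 0 < a j) (a0' : forall j, 0 < a' j).
Hypotheses (b0 : forall j, 0 < b j.+1) (b0' : forall j, 0 < b' j.+1).
Hypothesis abS : forall j, a j.+1 + b j.+1 = a j + 1.
Hypothesis abS' : forall j, a' j.+1 + b' j.+1 = a' j + 1.
Hypothesis yS : forall j, (y j.+1 <= (y j).-1)%N.
Hypothesis zS : forall j, (z j.+1 <= (z j).-1)%N.
Hypothesis sS : forall j r, s j.+1 r -> s j r.
Hypothesis tS : forall j r, t j.+1 r -> t j r.
Hypothesis st : forall r, t 0%N r = ~~ s 0%N r.
Hypothesis QE : forall j, active y j -> \sum_(r <- rs | s j r) Q r = c * (a j + (y j)%:R).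
Hypothesis QE' : forall j, active z j -> \sum_(r <- rs | t j r) Q r = c * (a' j + (z j)%:R).

(* The conditional expectation of rho_0^p0 (1 - rho_0)^q0 \prod_j T_(-j-1)^(p j)
   \prod_j Z_(j+1)^(p' j), given that v j values lie below r_(-j) and w j above r_j. *)
Definition state_mom (l u : nat) (v w : nat -> nat) : R :=
  mom (a 0%N + (v 0%N)%:R) (a' 0%N + (w 0%N)%:R) p0 q0 *
  \prod_(0 <= j < l) level_mom a b p v j * \prod_(0 <= j < u) level_mom a' b' p' w j.

(** A new entry falls on exactly one side of r_0 and leaves the counts of the other side alone;
    [chain] treats each side, and a last urn step with the two level-0 weights joins them. *)
Lemma state_mom_step l u :
  \sum_(r <- rs) Q r * state_mom l u (chain_step y s r) (chain_step z t r) =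
  (\sum_(r <- rs) Q r) * state_mom l u y z.
Proof.
set A := a 0%N + (y 0%N)%:R; set B := a' 0%N + (z 0%N)%:R.
have A0 : 0 < A by rewrite ltr_wpDr.
have B0 : 0 < B by rewrite ltr_wpDr.
rewrite !(bigID (s 0%N) predT) /=.
rewrite (eq_bigr (fun r => mom (A + 1) B p0 q0 * \prod_(0 <= j < u) level_mom a' b' p' z j *
   (Q r * \prod_(0 <= j < 0 + l) level_mom a b p (chain_step y s r) j))); last first.
  move=> r sr; have tr j : t j r = false.
    by apply/negP => /(s_mono tS (leq0n j)); rewrite st sr.
  rewrite /state_mom /chain_step /= sr st sr /= addn0 add0n natrD addrA -/A -/B.
  rewrite (_ : (fun j => z j + (active z j && t j r))%N = z); last first.
    by apply/funext => j; rewrite tr andbF addn0.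
  by rewrite -mulrA; set X := mom _ _ _ _; ring.
rewrite -big_distrr/= (chain p a0 b0 abS yS sS QE l (erefl _ : active y 0%N)).
rewrite [X in _ + X](eq_bigr (fun r => mom A (B + 1) p0 q0 * \prod_(0 <= j < l) level_mom a b p y j *
   (Q r * \prod_(0 <= j < 0 + u) level_mom a' b' p' (chain_step z t r) j))); last first.
  move=> r sr; have tr j : s j r = false.
    by apply/negP => /(s_mono sS (leq0n j)); rewrite (negbTE sr).
  rewrite /state_mom /chain_step /= st (negbTE sr) /= addn0 add0n natrD addrA -/A -/B.
  rewrite (_ : (fun j => y j + (active y j && s j r))%N = y); last first.
    by apply/funext => j; rewrite tr andbF addn0.
  by set X := mom _ _ _ _; ring.
rewrite -big_distrr/= [X in _ + _ * X](eq_bigl (t 0%N)); last by move=> r; rewrite st.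
rewrite (chain p' a0' b0' abS' zS tS QE' u (erefl _ : active z 0%N)).
rewrite [X in _ = (_ + X) * _](eq_bigl (t 0%N)); last by move=> r; rewrite st.
rewrite QE// QE'// /state_mom !add0n -/A -/B -mulrDr.
have := mom_step p0 q0 A0 B0.
set X := mom (A + 1) _ _ _; set Y := mom A (B + 1) _ _; set Z := mom A B _ _ => e.
transitivity (c * (A * X + B * Y) * \prod_(0 <= j < l) level_mom a b p y j *
  \prod_(0 <= j < u) level_mom a' b' p' z j); first by ring.
by rewrite e; ring.
Qed.

End TwoSided.

(** * The chain of record counts *)

Section BoundedRV.
Context {R : realType} {d : measure_display} {Omega : measurableType d}.
Variable P : probability Omega R.
Implicit Types f g : Omega -> R.

Definition bdm f := measurable_fun setT f /\ exists M, forall x, `|f x| <= M.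

Definition Ex f : R := \int[P]_x f x.

Lemma bdm_cst r : bdm (fun=> r).
Proof. by split => //; exists `|r|. Qed.

Lemma bdmD f g : bdm f -> bdm g -> bdm (fun x => f x + g x).
Proof.
move=> [mf [M fM]] [mg [N gN]]; split; first exact: measurable_funD.
by exists (M + N) => x; rewrite (le_trans (ler_normD _ _))// lerD.
Qed.

Lemma bdmM f g : bdm f -> bdm g -> bdm (fun x => f x * g x).
Proof.
move=> [mf [M fM]] [mg [N gN]]; split; first exact: measurable_funM.
by exists (M * N) => x; rewrite normrM ler_pM.
Qed.

Lemma bdmN f : bdm f -> bdm (fun x => - f x).
Proof. by move=> bf; under eq_fun do rewrite -mulN1r; exact: bdmM (bdm_cst _) bf. Qed.

Lemma bdmB f g : bdm f -> bdm g -> bdm (fun x => f x - g x).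
Proof. by move=> bf bg; apply: bdmD => //; exact: bdmN. Qed.

Lemma bdmX f n : bdm f -> bdm (fun x => f x ^+ n).
Proof.
move=> bf; elim: n => [|n IH].
  by under eq_fun do rewrite expr0; exact: bdm_cst.
by under eq_fun do rewrite exprS; exact: bdmM.
Qed.

Lemma bdm_sum (I : eqType) (s : seq I) (h : I -> Omega -> R) :
  (forall i, i \in s -> bdm (h i)) -> bdm (fun x => \sum_(i <- s) h i x).
Proof.
elim: s => [|i s IH] hs.
  by under eq_fun do rewrite big_nil; exact: bdm_cst.
under eq_fun do rewrite big_cons; apply: bdmD; first by apply: hs; rewrite mem_head.
by apply: IH => j js; apply: hs; rewrite inE js orbT.
Qed.

Lemma bdm_prod (I : eqType) (s : seq I) (h : I -> Omega -> R) :
  (forall i, i \in s -> bdm (h i)) -> bdm (fun x => \prod_(i <- s) h i x).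
Proof.
elim: s => [|i s IH] hs.
  by under eq_fun do rewrite big_nil; exact: bdm_cst.
under eq_fun do rewrite big_cons; apply: bdmM; first by apply: hs; rewrite mem_head.
by apply: IH => j js; apply: hs; rewrite inE js orbT.
Qed.

Lemma bdm_indic A : measurable A -> bdm (\1_A : Omega -> R).
Proof.
move=> mA; split; first exact: measurable_indic.
by exists 1 => x; rewrite indicE; case: (_ \in _); rewrite ?normr1 ?normr0.
Qed.

Lemma bdm_integrable f : bdm f -> P.-integrable setT (EFin \o f).
Proof.
move=> [mf [M fM]]; apply: measurable_bounded_integrable => //.
  by rewrite ltey_eq fin_num_measure.
exists M; split; rewrite ?num_real// => x Mx y _ /=.
exact: le_trans (fM y) (ltW Mx).
Qed.

Lemma ExD f g : bdm f -> bdm g -> Ex (fun x => f x + g x) = Ex f + Ex g.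
Proof. by move=> bf bg; rewrite /Ex RintegralD//; exact: bdm_integrable. Qed.

Lemma ExZ r f : bdm f -> Ex (fun x => r * f x) = r * Ex f.
Proof. by move=> bf; rewrite /Ex RintegralZl//; exact: bdm_integrable. Qed.

Lemma ExB f g : bdm f -> bdm g -> Ex (fun x => f x - g x) = Ex f - Ex g.
Proof. by move=> bf bg; rewrite /Ex RintegralB//; exact: bdm_integrable. Qed.

Lemma Ex_cst r : Ex (fun=> r) = r.
Proof. by rewrite /Ex Rintegral_cst//= probability_setT mulr1. Qed.

Lemma Ex_sum (I : eqType) (s : seq I) (h : I -> Omega -> R) :
  (forall i, i \in s -> bdm (h i)) -> Ex (fun x => \sum_(i <- s) h i x) = \sum_(i <- s) Ex (h i).
Proof.
elim: s => [|i s IH] hs.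
  by under eq_fun do rewrite big_nil; rewrite Ex_cst big_nil.
have hs' j : j \in s -> bdm (h j) by move=> js; apply: hs; rewrite inE js orbT.
under eq_fun do rewrite big_cons.
rewrite ExD ?IH ?big_cons//; first by apply: hs; rewrite mem_head.
exact: bdm_sum.
Qed.

Lemma Ex_le f g : bdm f -> bdm g -> (forall x, f x <= g x) -> Ex f <= Ex g.
Proof. by move=> bf bg fg; apply: le_Rintegral => //; exact: bdm_integrable. Qed.

Lemma Ex_ge0 f : (forall x, 0 <= f x) -> 0 <= Ex f.
Proof. by move=> f0; exact: Rintegral_ge0. Qed.

Lemma Ex_indic A : measurable A -> Ex \1_A = fine (P A).
Proof.
by move=> mA; rewrite /Ex /Rintegral integral_indic// setIT.
Qed.

Lemma EFin_Ex f : bdm f -> (Ex f)%:E = (\int[P]_x (f x)%:E)%E.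
Proof.
by move=> bf; rewrite /Ex /Rintegral fineK// integrable_fin_num//; exact: bdm_integrable.
Qed.

End BoundedRV.

(** * The martingale property under the given law *)

Section Law.
Context {R : realType} {d : measure_display} {Omega : measurableType d}.
Variables (theta zeta : R) (alpha : int -> R).
Variables (P : probability Omega R) (pi_ : forall n : nat, Omega -> 'S_n).
Hypothesis hdom : principal_domain theta zeta alpha.
Hypothesis hmeas : forall (n : nat) (s : 'S_n), measurable [set omega | pi_ n omega = s].
Hypothesis hcoh : forall omega : Omega, coherent (fun n => pi_ n omega).
Hypothesis hlaw : initial_rank_law P theta zeta alpha pi_.

Definition atom n (s : 'S_n) : set Omega := [set omega | pi_ n omega = s].

Definition rank_atom n (s : 'S_n) (r : nat) : set Omega :=
  [set omega | pi_ n omega = s /\ initial_rank (word (pi_ n.+1 omega)) n.+1 = r].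

Definition atom_prob n (s : 'S_n) : R := fine (P (atom s)).
Definition rank_prob n (s : 'S_n) (r : nat) : R := fine (P (rank_atom s r)).

Lemma measurable_rank_atom n (s : 'S_n) r : measurable (rank_atom s r).
Proof.
rewrite (_ : rank_atom s r = \bigcup_(t in [set t : 'S_n.+1 | initial_rank (word t) n.+1 = r])
    (atom s `&` atom t)); last first.
  apply/seteqP; split => omega /=; first by case=> ? ?; exists (pi_ n.+1 omega).
  by case=> t /= tr [? e]; split; rewrite ?e.
apply: fin_bigcup_measurable; last by move=> t _; apply: measurableI; exact: hmeas.
exact: finite_finset.
Qed.

Let D n : R := theta + zeta + n%:R - 1.

Lemma rank_probE n (s : 'S_n) r q : next_rank_prob P pi_ s r q ->
  rank_prob s r = atom_prob s * q.
Proof.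
rewrite /next_rank_prob /rank_prob /rank_atom => ->.
by rewrite fineM ?fin_num_measure//; exact: hmeas.
Qed.

(** The induction runs from the outermost record inwards. A new minimum has weight [lower_sum] at l;
    the ranks in the gap below r_(-j) add its length minus alpha_(-j-1), which cancels the last term
    of [lower_sum] at j+1. *)
Lemma sum_rank_below n (s : 'S_n) m : (0 < n)%N -> good_word (word s) ->
  (m <= nb_lower (word s))%N ->
  let j := (nb_lower (word s) - m)%N in
  \sum_(1 <= r < (below (word s) j).+2) rank_prob s r =
  atom_prob s / D n * (lower_sum theta alpha j + (below (word s) j)%:R).
Proof.
move=> n0 gw; have [h1 h2 _ _] := hlaw s n0.
set w := word s in gw h1 h2 *; set l := nb_lower w.
have sw : size w = n by rewrite size_word.
elim: m => [|m IH] ml /=.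
  have -> : below w (l - 0) = 0%N.
    by apply/eqP; rewrite -leqn0 leqNgt below_gt0// subn0 ltnn.
  by rewrite big_nat1 (rank_probE h1) subn0 addr0 mulrA mulrAC.
have /= := IH (ltnW ml); have -> : (l - m = (l - m.+1).+1)%N by lia.
set j := (l - m.+1)%N => {}IH.
have jl : (j < l)%N by rewrite /j; lia.
have b1 := record_value_bound gw (- j%:Z) ltac:(by rewrite sw).
have b2 := record_value_bound gw (- j.+1%:Z) ltac:(by rewrite sw).
have lt : (below w j.+1 < below w j)%N.
  by have := belowS gw j; have := below_gt0 gw j; rewrite -/w -/l jl; lia.
rewrite (@big_cat_nat _ _ _ (below w j.+1).+2)//=; last by lia.
rewrite IH.
have e1 : (below w j).+1 = record_value w (- j%:Z) by rewrite /below; lia.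
have e2 : (below w j.+1).+1 = record_value w (- j%:Z - 1).
  by rewrite /below (_ : - j%:Z - 1 = - j.+1%:Z) -/w; lia.
have gE : ((record_value w (- j%:Z))%:R - (record_value w (- j%:Z - 1))%:R : R) =
    (below w j)%:R - (below w j.+1)%:R by rewrite -e1 -e2 -!natr1; ring.
have g0 : (below w j)%:R - (below w j.+1)%:R != 0 :> R.
  by rewrite subr_eq0 eqr_nat; lia.
rewrite (eq_big_nat _ _ (F2 := fun=> atom_prob s *
    ((1 - alpha (- j.+1%:Z) / ((below w j)%:R - (below w j.+1)%:R)) / D n))); last first.
  move=> r rj; rewrite -gE.
  have -> : - j.+1%:Z = - j%:Z - 1 by lia.
  by apply: rank_probE; apply: h2; rewrite -/w -/l -?e1 -?e2; lia.
rewrite sumr_const_nat -[X in _ + X = _]mulr_natr natrB; last by lia.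
rewrite /lower_sum big_nat_recr//= -!natr1.
have -> : forall a b c : R, a * ((1 - b / c) / D n) * ((below w j)%:R + 1 + 1 - ((below w j.+1)%:R + 1 + 1)) =
   a / D n * ((1 - b / c) * ((below w j)%:R - (below w j.+1)%:R)) by move=> *; ring.
rewrite mulrBl mul1r divfK//; ring.
Qed.

Lemma sum_rank_above n (s : 'S_n) m : (0 < n)%N -> good_word (word s) ->
  (m <= nb_upper (word s))%N ->
  let j := (nb_upper (word s) - m)%N in
  \sum_((n - above (word s) j).+1 <= r < n.+2) rank_prob s r =
  atom_prob s / D n * (upper_sum zeta alpha j + (above (word s) j)%:R).
Proof.
move=> n0 gw; have [_ _ h1 h2] := hlaw s n0.
set w := word s in gw h1 h2 *; set u := nb_upper w.
have sw : size w = n by rewrite size_word.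
have sw0 : (0 < size w)%N by rewrite sw.
elim: m => [|m IH] ml /=.
  have -> : above w (u - 0) = 0%N.
    by apply/eqP; rewrite -leqn0 leqNgt above_gt0// subn0 ltnn.
  by rewrite !subn0 big_nat1 (rank_probE h2) addr0 mulrA mulrAC.
have /= := IH (ltnW ml); have -> : (u - m = (u - m.+1).+1)%N by lia.
set j := (u - m.+1)%N => {}IH.
have ju : (j < u)%N by rewrite /j; lia.
have b1 := record_value_bound gw j%:Z sw0.
have b2 := record_value_bound gw j.+1%:Z sw0.
have lt : (above w j.+1 < above w j)%N.
  by have := aboveS gw j; have := above_gt0 gw j sw0; rewrite -/w -/u ju; lia.
rewrite -/w sw in b1 b2.
rewrite (@big_cat_nat _ _ _ (n - above w j.+1).+1)//=; [|by lia..].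
rewrite IH.
have e1 : (n - above w j)%N = record_value w (j.+1%:Z - 1).
  by rewrite /above (_ : j.+1%:Z - 1 = j%:Z) -/w ?sw; lia.
have e2 : (n - above w j.+1)%N = record_value w j.+1%:Z by rewrite /above sw; lia.
have gE : ((record_value w j.+1%:Z)%:R - (record_value w (j.+1%:Z - 1))%:R : R) =
    (above w j)%:R - (above w j.+1)%:R.
  rewrite -e1 -e2 !natrB; [ring|rewrite /above; lia..].
have g0 : (above w j)%:R - (above w j.+1)%:R != 0 :> R.
  by rewrite subr_eq0 eqr_nat; lia.
rewrite (eq_big_nat _ _ (F2 := fun=> atom_prob s *
    ((1 - alpha j.+1%:Z / ((above w j)%:R - (above w j.+1)%:R)) / D n))); last first.
  move=> r rj; rewrite -gE.
  by apply: rank_probE; apply: h1; rewrite -/w -/u -?e1 -?e2; lia.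
rewrite sumr_const_nat -[X in X + _ = _]mulr_natr.
have -> : ((n - above w j.+1).+1 - (n - above w j).+1 = above w j - above w j.+1)%N.
  by move: b1; rewrite /above; lia.
rewrite (@natrB _ (above w j) (above w j.+1)); last by lia.
rewrite /upper_sum big_nat_recr//=.
have -> : forall a b c x : R, a * ((1 - b / c) / D n) * x =
   a / D n * ((1 - b / c) * x) by move=> *; ring.
rewrite mulrBl mul1r divfK//; ring.
Qed.

Lemma rank_sum_below n (s : 'S_n) j : (0 < n)%N -> good_word (word s) ->
  active (below (word s)) j ->
  \sum_(r <- index_iota 1 n.+2 | (r <= (below (word s) j).+1)%N) rank_prob s r =
  atom_prob s / D n * (lower_sum theta alpha j + (below (word s) j)%:R).
Proof.
move=> n0 gw; rewrite active_below// => jl.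
have := sum_rank_below n0 gw (leq_subr j _); rewrite /= subKn// => <-.
have b1 := record_value_bound gw (- j%:Z) ltac:(by rewrite size_word).
rewrite size_word in b1.
by rewrite [RHS](big_nat_widen _ _ n.+2)//; rewrite /below; lia.
Qed.

Lemma rank_sum_above n (s : 'S_n) j : (0 < n)%N -> good_word (word s) ->
  active (above (word s)) j ->
  \sum_(r <- index_iota 1 n.+2 | (n - above (word s) j < r)%N) rank_prob s r =
  atom_prob s / D n * (upper_sum zeta alpha j + (above (word s) j)%:R).
Proof.
move=> n0 gw; rewrite active_above// ?size_word// => ju.
have := sum_rank_above n0 gw (leq_subr j _); rewrite /= subKn// => <-.
by rewrite [RHS](big_nat_widenl _ 1)//; lia.
Qed.

Lemma measurable_atom n (s : 'S_n) : measurable (atom s).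
Proof. exact: hmeas. Qed.

Lemma sum_indic_atom n omega (G : 'S_n -> R) :
  G (pi_ n omega) = \sum_(s : 'S_n) G s * \1_(atom s) omega.
Proof.
rewrite (bigD1 (pi_ n omega))//= big1 ?addr0 => [|s sn].
  by rewrite indicE mem_set ?mulr1.
by rewrite indicE memNset ?mulr0//= => e; move: sn; rewrite e eqxx.
Qed.

Lemma bdm_pi n (G : 'S_n -> R) : bdm (fun omega => G (pi_ n omega)).
Proof.
under eq_fun do rewrite sum_indic_atom.
by apply: bdm_sum => s _; apply: bdmM (bdm_cst _) (bdm_indic _); exact: measurable_atom.
Qed.

Lemma Ex_atom_step n (s : 'S_n) (F : seq nat -> R) :
  Ex P (fun omega => \1_(atom s) omega * F (word (pi_ n.+1 omega))) =
  \sum_(1 <= r < n.+2) rank_prob s r * F (step_word (word s) r).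
Proof.
have mA r := measurable_rank_atom s r.
transitivity (Ex P (fun omega => \sum_(r <- index_iota 1 n.+2)
    F (step_word (word s) r) * \1_(rank_atom s r) omega)).
  congr Ex; apply/funext => omega.
  have [iP e] := word_step n (hcoh omega).
  set i := initial_rank _ _ in iP e.
  have [sE|sE] := pselect (atom s omega); last first.
    rewrite indicE memNset// mul0r big1// => r _.
    by rewrite indicE memNset ?mulr0// => -[].
  rewrite indicE mem_set// mul1r e.
  rewrite (bigD1_seq i) ?iota_uniq ?mem_index_iota//=.
  rewrite indicE (mem_set (conj sE erefl : rank_atom s i omega)).
  rewrite mulr1 big1 ?addr0 => [|r ri]; first by rewrite (sE : pi_ n omega = s).
  by rewrite indicE memNset ?mulr0// => -[_ e']; move: ri; rewrite -e' eqxx.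
rewrite Ex_sum => [|r _]; last exact: bdmM (bdm_cst _) (bdm_indic _).
by apply: eq_bigr => r _; rewrite ExZ ?Ex_indic 1?mulrC//; exact: bdm_indic.
Qed.

(** Read off from the process, as the case [F = 1], so that the weights of the law need not be added
    up again. *)
Lemma sum_rank_prob n (s : 'S_n) : \sum_(1 <= r < n.+2) rank_prob s r = atom_prob s.
Proof.
have := Ex_atom_step s (fun=> 1).
under eq_fun do rewrite mulr1.
by rewrite Ex_indic; [under eq_bigr do rewrite mulr1|exact: measurable_atom].
Qed.

Definition level_b (j : nat) : R := 1 - alpha (- j%:Z).
Definition level_b' (j : nat) : R := 1 - alpha j%:Z.

Definition word_mom (p0 q0 : nat) (p p' : nat -> nat) (l u : nat) (w : seq nat) : R :=
  state_mom (lower_sum theta alpha) level_b (upper_sum zeta alpha) level_b' p0 q0 p p' l u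
    (below w) (above w).

Lemma level_b_gt0 j : 0 < level_b j.+1.
Proof. by have [h _ _] := hdom; apply: h. Qed.

Lemma level_b'_gt0 j : 0 < level_b' j.+1.
Proof. by have [h _ _] := hdom; apply: h. Qed.

Lemma lower_sum_gt0 j : 0 < lower_sum theta alpha j.
Proof. by have [_ h _] := hdom; apply: h. Qed.

Lemma upper_sum_gt0 j : 0 < upper_sum zeta alpha j.
Proof. by have [_ _ h] := hdom; apply: h. Qed.

Lemma lower_sum_level j :
  lower_sum theta alpha j.+1 + level_b j.+1 = lower_sum theta alpha j + 1.
Proof. by rewrite /lower_sum big_nat_recr//= /level_b; ring. Qed.

Lemma upper_sum_level j :
  upper_sum zeta alpha j.+1 + level_b' j.+1 = upper_sum zeta alpha j + 1.
Proof. by rewrite /upper_sum big_nat_recr//= /level_b'; ring. Qed.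

(** The martingale property on one atom of pi_n. A nonempty atom supplies an outcome, whose
    coherence makes [s] a good word; an empty one contributes 0. *)
Lemma word_mom_atom p0 q0 p p' l u n (s : 'S_n) : (0 < n)%N ->
  Ex P (fun omega => \1_(atom s) omega * word_mom p0 q0 p p' l u (word (pi_ n.+1 omega))) =
  atom_prob s * word_mom p0 q0 p p' l u (word s).
Proof.
move=> n0; rewrite Ex_atom_step.
have [s0|] := pselect (atom s = set0).
  rewrite big1 => [|r _]; first by rewrite /atom_prob s0 measure0 mul0r.
  rewrite /rank_prob (_ : rank_atom s r = set0) ?measure0 ?mul0r//.
  by apply/seteqP; split => // omega [e _]; have : atom s omega by []; rewrite s0.
move=> /eqP/set0P[omega oE].
have gw : good_word (word s) by rewrite -oE; exact: good_word_word (hcoh omega) n0.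
have pw := perm_word_word s.
have sw := size_word s.
have sw0 : (0 < size (word s))%N by rewrite sw.
rewrite -sum_rank_prob -(@state_mom_step _ (lower_sum theta alpha) level_b
  (upper_sum zeta alpha) level_b' (atom_prob s / D n) p0 q0 p p'
  (below (word s)) (above (word s)) (index_iota 1 n.+2) (rank_prob s)
  (fun j r => (r <= (below (word s) j).+1)%N)
  (fun j r => (n - above (word s) j < r)%N)).
- apply: eq_big_nat => r rn; congr (_ * _); rewrite /word_mom; congr state_mom.
    apply/funext => j; rewrite below_step ?sw//.
    by apply: perm_word_step; rewrite ?sw.
  apply/funext => j; rewrite above_step ?sw//.
  by apply: perm_word_step; rewrite ?sw.
- exact: lower_sum_gt0.
- exact: upper_sum_gt0.
- exact: level_b_gt0.
- exact: level_b'_gt0.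
- exact: lower_sum_level.
- exact: upper_sum_level.
- exact: belowS.
- exact: aboveS.
- by move=> j r; have := belowS gw j; lia.
- by move=> j r; have := aboveS gw j; lia.
- by move=> r; have := below_above0 gw; rewrite sw; lia.
- by move=> j; exact: rank_sum_below.
- by move=> j; exact: rank_sum_above.
Qed.

(** The martingale property in its working form: [G = 1] gives constant expectations, and past
    increments as [G] give orthogonality. *)
Lemma word_mom_orth p0 q0 p p' l u n (G : 'S_n -> R) : (0 < n)%N ->
  Ex P (fun omega => G (pi_ n omega) * (word_mom p0 q0 p p' l u (word (pi_ n.+1 omega)) -
    word_mom p0 q0 p p' l u (word (pi_ n omega)))) = 0.
Proof.
move=> n0; set h := word_mom _ _ _ _ _ _.
have mA s := measurable_atom s.
have bh m : bdm (fun omega => h (word (pi_ m omega))) by exact: (bdm_pi (fun s => h (word s))).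
transitivity (Ex P (fun omega => \sum_(s : 'S_n) (G s *
    (\1_(atom s) omega * h (word (pi_ n.+1 omega)) -
     h (word s) * \1_(atom s) omega)))).
  congr Ex; apply/funext => omega.
  rewrite sum_indic_atom mulr_suml; apply: eq_bigr => s _.
  have [e|ne] := pselect (atom s omega).
    by rewrite indicE (mem_set e) (e : pi_ n omega = s); ring.
  by rewrite indicE memNset//= !(mulr0, mul0r, subr0).
have b1 s : bdm (fun omega => \1_(atom s) omega * h (word (pi_ n.+1 omega))).
  by apply: bdmM => //; exact: bdm_indic.
have b2 s : bdm (fun omega => h (word s) * \1_(atom s) omega).
  exact: bdmM (bdm_cst _) (bdm_indic _).
rewrite Ex_sum => [|s _]; last by apply: bdmM (bdm_cst _) _; exact: bdmB.
rewrite big1// => s _.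
rewrite ExZ ?ExB//; last exact: bdmB.
rewrite word_mom_atom// ExZ ?Ex_indic//; last exact: bdm_indic.
by rewrite -/h [h _ * _]mulrC subrr mulr0.
Qed.

Lemma Ex_word_mom p0 q0 p p' l u n : (0 < n)%N ->
  Ex P (fun omega => word_mom p0 q0 p p' l u (word (pi_ n omega))) =
  mom theta zeta p0 q0 *
  \prod_(0 <= j < l) mom (lower_sum theta alpha j.+1) (level_b j.+1) (p j) 0 *
  \prod_(0 <= j < u) mom (upper_sum zeta alpha j.+1) (level_b' j.+1) (p' j) 0.
Proof.
have bh m : bdm (fun omega => word_mom p0 q0 p p' l u (word (pi_ m omega))).
  exact: (bdm_pi (fun s => word_mom p0 q0 p p' l u (word s))).
case: n => // n _; elim: n => [|n <-]; last first.
  apply/eqP; rewrite -subr_eq0 -ExB//.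
  rewrite -(@word_mom_orth p0 q0 p p' l u n.+1 (fun=> 1))//.
  by under [X in _ == Ex _ X]eq_fun do rewrite mul1r.
(* At n = 1 every count is 0, so the martingale starts at a constant: the product of the moments of
   the beta laws before any update. *)
rewrite -[RHS](Ex_cst P); congr Ex; apply/funext => omega.
have gw : good_word (word (pi_ 1 omega)) by exact: good_word_word (hcoh omega) _.
have y0 j : below (word (pi_ 1 omega)) j = 0%N /\ above (word (pi_ 1 omega)) j = 0%N.
  have := below_above0 gw; rewrite size_word /= => e.
  elim: j => [|j [IH1 IH2]]; first by lia.
  by have := belowS gw j; have := aboveS gw j; rewrite IH1 IH2; lia.
rewrite /word_mom /state_mom /level_mom !(y0 _).1 !(y0 _).2 !addr0.
have -> : lower_sum theta alpha 0 = theta by rewrite /lower_sum big_geq ?addr0.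
have -> : upper_sum zeta alpha 0 = zeta by rewrite /upper_sum big_geq ?addr0.
congr (_ * _ * _);
by apply: eq_bigr => j _; rewrite ?(y0 _).1 ?(y0 _).2 subn0 /= ?mulr0n !addr0.
Qed.

End Law.

(** * Almost sure convergence of martingales with increments O(1/n) *)

Section CubeSubsequence.
Context {R : realType}.

Lemma sum_inv_sqr_le (n : nat) : \sum_(k < n) (k.+1%:R ^+ 2)^-1 <= 2 :> R.
Proof.
case: n => [|n]; first by rewrite big_ord0.
suff : \sum_(k < n.+1) (k.+1%:R ^+ 2)^-1 <= 2 - n.+1%:R^-1 :> R.
  by move=> /le_trans; apply; rewrite gerBl invr_ge0.
elim: n => [|n IH]; first by rewrite big_ord_recr big_ord0/= expr1n invr1; lra.
rewrite big_ord_recr/=; apply: (le_trans (lerD IH (lexx _))).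
rewrite -subr_ge0 -[n.+2%:R]natr1.
set m : R := n.+1%:R; have m1 : 1 <= m by rewrite ler1n.
have -> : 2 - (m + 1)^-1 - (2 - m^-1 + ((m + 1) ^+ 2)^-1) = (m * (m + 1) ^+ 2)^-1.
  by field; lra.
by rewrite invr_ge0 mulr_ge0 ?exprn_ge0//; lra.
Qed.

(** Gaps of order k^2 at height k^3: with increments O(1/n), a martingale oscillates by O(1/k)
    between consecutive cubes, and its change from one cube to the next has variance O(1/k^4),
    summable even with the weight k^2. *)
Definition cube (k : nat) : nat := (k.+1 ^ 3)%N.

Lemma cube_gap k : (cube k <= cube k.+1 <= cube k + 7 * k.+1 ^ 2)%N.
Proof. rewrite /cube !expnS expn0; nia. Qed.

Lemma cube_bracket n : (0 < n)%N -> exists k, (cube k <= n < cube k.+1)%N.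
Proof.
move=> n0; pose Q k := (cube k <= n)%N.
have exQ : exists k, Q k by exists 0%N; rewrite /Q /cube exp1n.
have ubQ k : Q k -> (k <= n)%N by rewrite /Q /cube !expnS expn0; nia.
case: (ex_maxnP exQ ubQ) => k Qk maxk; exists k; rewrite -/(Q k) Qk/= ltnNge.
by apply/negP => /maxk; rewrite ltnn.
Qed.

Lemma increment_le (x : nat -> R) C m k : 0 <= C ->
  (forall n, (0 < n)%N -> `|x n.+1 - x n| <= C / n%:R) -> (0 < m)%N ->
  `|x (m + k)%N - x m| <= C * k%:R / m%:R.
Proof.
move=> C0 xC m0; elim: k => [|k IH]; first by rewrite addn0 subrr normr0 mulr0 mul0r.
rewrite addnS (_ : _ - _ = (x (m + k).+1 - x (m + k)%N) + (x (m + k)%N - x m)); last by ring.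
apply: le_trans (ler_normD _ _) _.
rewrite -natr1 mulrDr mulr1 mulrDl [leRHS]addrC; apply: lerD => //.
apply: (le_trans (xC _ _)); first by rewrite addn_gt0 m0.
by rewrite ler_wpM2l// lef_pV2 ?posrE ?ltr0n ?addn_gt0 ?m0// ler_nat leq_addr.
Qed.

(* Increments of order 1/n make the sequence nearly constant between consecutive
   cubes, and AM-GM turns the weighted square sum into absolute summability along
   the cubes. *)
Lemma cvg_cubes (x : nat -> R) C M :
  (forall n, (0 < n)%N -> `|x n.+1 - x n| <= C / n%:R) ->
  (forall n, \sum_(k < n) k.+1%:R ^+ 2 * (x (cube k.+1) - x (cube k)) ^+ 2 <= M) ->
  cvgn x.
Proof.
move=> xC sumM.
have C0 : 0 <= C by have := xC 1%N isT; rewrite divr1; exact: le_trans.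
pose y k := x (cube k).
have : cvgn (series (fun k => y k.+1 - y k)).
  apply: normed_cvg; apply: nondecreasing_is_cvgn.
    by apply: nondecreasing_series => n _ _; exact: normr_ge0.
  exists (2 + M) => _ [n _ <-]; rewrite /= [leLHS]/series/= big_mkord.
  apply: le_trans (lerD (sum_inv_sqr_le n) (sumM n)); rewrite -big_split/=.
  apply: ler_sum => k _; rewrite -/(y _) -/(y _).
  set t := y _ - y _; set m : R := k.+1%:R.
  have m0 : 0 < m by rewrite ltr0n.
  have := sqr_ge0 (m^-1 - m * `|t|).
  have -> : (m^-1 - m * `|t|) ^+ 2 = (m ^+ 2)^-1 + m ^+ 2 * `|t| ^+ 2 - 2 * `|t|.
    by field; lra.
  rewrite real_normK ?num_real//; set a := m ^- 2; set b := m ^+ 2 * t ^+ 2; have := normr_ge0 t; lra.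
rewrite (_ : series _ = fun n => y n - y 0%N); last first.
  by apply/funext => n; rewrite /series/= telescope_sumr.
move=> cs; have : cvgn (fun n => (y n - y 0%N) + y 0%N) by apply: is_cvgD => //; exact: is_cvg_cst.
under eq_fun do rewrite subrK.
move=> /cvg_ex[/= l yl]; apply/cvg_ex; exists l.
apply/cvgrPdist_le => /= e e0.
have e2 : 0 < e / 2 by rewrite divr_gt0.
have /cvgrPdist_le /(_ _ e2)[K1 _ K1P] := yl.
(* From [K2] on, the bound 7 C / (k + 1) for the oscillation after the cube of index k is at most e
   / 2; the 7 is that of [cube_gap]. *)
pose K2 := (Num.truncn (7 * C / (e / 2))).+1.
pose K := maxn K1 K2.
exists (cube K) => // n /= Kn.
have n0 : (0 < n)%N by apply: leq_trans Kn; rewrite /cube expn_gt0.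
have [k /andP[kn nk]] := cube_bracket n0.
have Kk : (K <= k)%N.
  rewrite leqNgt; apply/negP => kK; move: (leq_ltn_trans Kn nk); rewrite /cube ltn_exp2r//; lia.
rewrite (_ : l - x n = (l - y k) - (x n - y k)); last by ring.
apply: le_trans (ler_normB _ _) _; rewrite [leRHS]splitr; apply: lerD.
  by apply: K1P => /=; apply: leq_trans Kk; exact: leq_maxl.
have c0 : (0 < cube k)%N by rewrite expn_gt0.
have := increment_le (n - cube k)%N C0 xC c0; rewrite subnKC// => /le_trans; apply.
have d7 : (n - cube k <= 7 * k.+1 ^ 2)%N by have := cube_gap k; lia.
have Kb : 7 * C / (e / 2) <= k.+1%:R.
  apply: ltW; apply: (lt_le_trans (truncnS_gt _)).
  by rewrite ler_nat; apply: (leq_trans _ (leqW Kk)); exact: leq_maxr.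
have k0 : 0 < k.+1%:R :> R by rewrite ltr0n.
apply: (@le_trans _ _ (C * (7 * k.+1 ^ 2)%N%:R / (cube k)%:R)).
  by rewrite ler_wpM2r ?invr_ge0// ler_wpM2l// ler_nat.
rewrite /cube natrM !natrX.
rewrite (_ : C * (7 * k.+1%:R ^+ 2) / k.+1%:R ^+ 3 = 7 * C / k.+1%:R); last by field; lra.
by rewrite ler_pdivrMr// [e / 2 * _]mulrC -ler_pdivrMr.
Qed.

End CubeSubsequence.

Section MartingaleConvergence.
Context {R : realType} {d : measure_display} {Omega : measurableType d}.
Variables (P : probability Omega R) (X : nat -> Omega -> R) (C : R).
Hypothesis bX : forall n, bdm (X n).
Hypothesis XC : forall n omega, (0 < n)%N -> `|X n.+1 omega - X n omega| <= C / n%:R.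
Hypothesis orthX : forall m n, (0 < m <= n)%N ->
  Ex P (fun omega => (X n omega - X m omega) * (X n.+1 omega - X n omega)) = 0.

Let C0 : 0 <= C.
Proof. by have := @XC 1%N point isT; rewrite divr1; exact: le_trans. Qed.

(** Orthogonality removes the cross terms, and each of the [k] squared increments is at most (C /
    m)^2. *)
Lemma variance_increment m k : (0 < m)%N ->
  Ex P (fun omega => (X (m + k)%N omega - X m omega) ^+ 2) <= C ^+ 2 * k%:R / m%:R ^+ 2.
Proof.
move=> m0; elim: k => [|k IH].
  rewrite addn0 mulr0 mul0r; under eq_fun do rewrite subrr expr0n/=.
  by rewrite Ex_cst.
set n := (m + k)%N.
have mn : (0 < m <= n)%N by rewrite m0 leq_addr.
have bB i j : bdm (fun omega => X i omega - X j omega) by exact: bdmB.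
under eq_fun => omega.
  rewrite addnS -/n (_ : (X n.+1 omega - X m omega) ^+ 2 = (X n omega - X m omega) ^+ 2 +
     (2 * ((X n omega - X m omega) * (X n.+1 omega - X n omega)) + (X n.+1 omega - X n omega) ^+ 2));
     last by ring.
  over.
have bM := bdmM (bB n m) (bB n.+1 n).
have b2 i j : bdm (fun omega => (X i omega - X j omega) ^+ 2) by exact: bdmX.
have b2M := bdmM (bdm_cst 2) bM.
rewrite ExD//; last exact: bdmD.
rewrite ExD// ExZ// orthX// mulr0 add0r -natr1 mulrDr mulr1 mulrDl.
apply: lerD; first exact: IH.
rewrite -[leRHS](Ex_cst P); apply: Ex_le => //; first exact: bdm_cst.
move=> omega; rewrite -real_normK ?num_real// -exprVn -exprMn.
rewrite lerXn2r ?nnegrE// ?divr_ge0//.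
apply: (le_trans (XC _ _)); first by lia.
by rewrite ler_wpM2l// lef_pV2 ?posrE ?ltr0n// ?ler_nat; lia.
Qed.

(** The weighted squared increments along the cubes have a finite total expectation, so their sum is
    finite almost surely, and [cvg_cubes] applies outcome by outcome. *)
Lemma martingale_cvg : {ae P, forall omega, cvgn (X ^~ omega)}.
Proof.
pose f k omega := k.+1%:R ^+ 2 * (X (cube k.+1) omega - X (cube k) omega) ^+ 2.
have f0 k omega : 0 <= f k omega by rewrite mulr_ge0 ?sqr_ge0.
have bf k : bdm (f k) by apply: bdmM (bdm_cst _) _; apply: bdmX; exact: bdmB.
have mf k : measurable_fun setT (EFin \o f k) by apply/measurable_EFinP; exact: (bf k).1.
have Ef k : Ex P (f k) <= 7 * C ^+ 2 * (k.+1%:R ^+ 2)^-1.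
  rewrite ExZ; last by apply: bdmX; exact: bdmB.
  have c0 : (0 < cube k)%N by rewrite expn_gt0.
  have [c1 c2] := andP (cube_gap k).
  have := variance_increment (cube k.+1 - cube k) c0; rewrite subnKC// => /ler_wpM2l le.
  apply: (le_trans (le _ (sqr_ge0 _))).
  have k0 : 0 < k.+1%:R :> R by rewrite ltr0n.
  apply: (@le_trans _ _ (k.+1%:R ^+ 2 * (C ^+ 2 * (7 * k.+1 ^ 2)%N%:R / (cube k)%:R ^+ 2))).
    rewrite ler_wpM2l ?sqr_ge0// ler_wpM2r ?invr_ge0 ?sqr_ge0// ler_wpM2l ?sqr_ge0//.
    by rewrite ler_nat; lia.
  rewrite /cube natrM !natrX -subr_ge0.
  rewrite (_ : _ - _ = 0)//; field; lra.
have intf : (\int[P]_omega \sum_(k <oo) (f k omega)%:E < +oo)%E.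
  rewrite integral_nneseries//; last by move=> n omega _; rewrite lee_fin.
  apply: (@le_lt_trans _ _ (7 * C ^+ 2 * 2)%:E); last exact: ltry.
  apply: lime_le; first by apply: is_cvg_nneseries => n _ _; apply: integral_ge0 => omega _; rewrite lee_fin.
  apply: nearW => n; under eq_bigr do rewrite -EFin_Ex//.
  rewrite sumEFin lee_fin big_mkord.
  apply: (@le_trans _ _ (\sum_(k < n) (7 * C ^+ 2 * (k.+1%:R ^+ 2)^-1))).
    by apply: ler_sum => k _; exact: Ef.
  by rewrite -mulr_sumr ler_wpM2l ?sum_inv_sqr_le// mulr_ge0 ?sqr_ge0.
have if_ : P.-integrable setT (fun omega => \sum_(k <oo) (f k omega)%:E)%E.
  apply/integrableP; split.
    by apply: ge0_emeasurable_sum => [k omega _ _|k _]; [rewrite lee_fin|exact: mf].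
  rewrite (eq_integral (fun omega => \sum_(k <oo) (f k omega)%:E)%E)// => omega _.
  by rewrite gee0_abs//; apply: nneseries_ge0 => n _ _; rewrite lee_fin.
have := integrable_ae measurableT if_; apply: filterS => omega /(_ I) fin.
apply: (@cvg_cubes _ _ C (fine (\sum_(k <oo) (f k omega)%:E)%E)); first by move=> n; exact: XC.
move=> n; rewrite -lee_fin fineK// -sumEFin.
rewrite -(big_mkord xpredT (fun k => (f k omega)%:E)).
by apply: nneseries_lim_ge => k _ _; rewrite lee_fin.
Qed.

End MartingaleConvergence.

(** * Moments determine laws on [0, 1] *)

(** Uniqueness of finite measures on a pi-system. The total masses are compared separately, as the
    half-lines used for laws do not include the whole space. *)
Lemma measure_unique_setI d (R : realType) (T : measurableType d) (G : set (set T))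
    (m1 m2 : {measure set T -> \bar R}) :
  G `<=` measurable -> setI_closed G -> m1 setT = m2 setT -> (m1 setT < +oo)%E ->
  (forall A, G A -> m1 A = m2 A) -> forall A, <<s G >> A -> m1 A = m2 A.
Proof.
move=> Gm IG m12T m1oo m12 A sA.
have GE : [set X | G X /\ X `<=` setT] = G.
  by apply/seteqP; split => [X []//|X GX]; split.
have := @g_sigma_algebra_measure_unique_trace _ _ _ G setT measurableT.
rewrite GE => /(_ R Gm IG m1 m2 m12T m12 m1oo); apply => //.
Qed.

(** * Polynomials approximating the indicator of a half-line *)

Section StepPolynomial.
Context {R : realType}.
Implicit Types c x : R.

(* On [0, 1], with K = step_exp c n, the product K x^n tends to 0 for x < c and is at
   least n for x >= c; so (1 - x^n)^K tends pointwise to the indicator of x < c. *)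
Definition step_exp c (n : nat) : nat := (Num.truncn (n%:R / c ^+ n)).+1.

Definition step_poly c (n : nat) : {poly R} := (1 - 'X^n) ^+ step_exp c n.

Lemma step_polyE c n x : (step_poly c n).[x] = (1 - x ^+ n) ^+ step_exp c n.
Proof. by rewrite /step_poly !hornerE. Qed.

Lemma step_poly_bound c n x : 0 <= x <= 1 -> 0 <= (step_poly c n).[x] <= 1.
Proof.
move=> /andP[x0 x1]; rewrite step_polyE.
have xn0 : 0 <= x ^+ n by rewrite exprn_ge0.
have xn1 : x ^+ n <= 1 by rewrite exprn_ile1.
by rewrite exprn_ge0 ?exprn_ile1//; lra.
Qed.

Lemma bernoulli_ge (y : R) (n : nat) : 0 <= y -> 1 + n%:R * y <= (1 + y) ^+ n.
Proof.
move=> y0; elim: n => [|n IH]; first by rewrite mul0r addr0 expr0.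
rewrite exprS -natr1; apply: le_trans (ler_wpM2l _ IH); last by lra.
by have := mulr_ge0 (ler0n R n) (sqr_ge0 y); rewrite expr2; lra.
Qed.

Lemma bernoulli_le (y : R) (n : nat) : 0 <= y <= 1 -> 1 - n%:R * y <= (1 - y) ^+ n.
Proof.
move=> /andP[y0 y1]; elim: n => [|n IH]; first by rewrite mul0r subr0 expr0.
rewrite exprS -natr1; apply: le_trans (ler_wpM2l _ IH); last by lra.
by have := mulr_ge0 (ler0n R n) (sqr_ge0 y); rewrite expr2; lra.
Qed.

Lemma cvg_natM_geometric (z : R) : 0 <= z < 1 -> n%:R * z ^+ n @[n --> \oo] --> 0.
Proof.
move=> /andP[z0 z1].
have [->|zn0] := eqVneq z 0.
  apply: cvg_near_cst; exists 1%N => // n /= n0.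
  by rewrite expr0n (gtn_eqF n0) mulr0.
have zp : 0 < z by rewrite lt_neqAle eq_sym zn0.
(* n z^n = (n w^n) w^n, where n w^n stays below 1 / h by Bernoulli's inequality for 1 + h = 1 /
   w. *)
pose w := Num.sqrt z.
have wp : 0 < w by rewrite sqrtr_gt0.
have w1 : w < 1 by rewrite -sqrtr1 ltr_sqrt.
have zw : z = w ^+ 2 by rewrite sqr_sqrtr.
pose h := w^-1 - 1.
have h0 : 0 < h by rewrite subr_gt0 invf_gt1.
have bnd n : n%:R * w ^+ n <= h^-1.
  have := bernoulli_ge n (ltW h0); rewrite (_ : 1 + h = w^-1); last by rewrite /h; ring.
  rewrite exprVn => le; rewrite -[leRHS]mul1r ler_pdivlMr//.
  by rewrite mulrAC -ler_pdivlMr ?exprn_gt0// mul1r; lra.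
apply: (@squeeze_cvgr _ _ _ _ (fun=> 0) (fun n => h^-1 * w ^+ n)).
- apply: nearW => n; rewrite mulr_ge0 ?exprn_ge0//= zw -exprM mulnC exprM expr2 mulrA.
  by rewrite ler_wpM2r ?exprn_ge0// ltW.
- exact: cvg_cst.
- rewrite -[X in _ --> X](mulr0 h^-1); apply: cvgMr; apply: cvg_expr; rewrite ger0_norm// ltW//.
Qed.

(** Bernoulli's inequality serves twice: for x < c it bounds the value below by 1 - K x^n, and for x
    >= c, after 1 - y <= 1 / (1 + y), it bounds the value above by 1 / (n + 1). *)
Lemma cvg_step_poly c x : 0 < c <= 1 -> 0 <= x <= 1 ->
  (step_poly c n).[x] @[n --> \oo] --> ((x < c)%R%:R : R).
Proof.
move=> /andP[c0 c1] /andP[x0 x1].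
have K1 n : n%:R / c ^+ n <= (step_exp c n)%:R by apply/ltW/truncnS_gt.
have K2 n : (step_exp c n)%:R <= n%:R / c ^+ n + 1.
  by rewrite /step_exp -natr1 lerD2r truncn_le// divr_ge0// exprn_ge0// ltW.
have cn n : 0 < c ^+ n by rewrite exprn_gt0.
have xn0 n : 0 <= x ^+ n by rewrite exprn_ge0.
have xn1 n : x ^+ n <= 1 by rewrite exprn_ile1.
have [xc|cx] := ltP x c.
  apply: (@squeeze_cvgr _ _ _ _ (fun n => 1 - (n%:R * (x / c) ^+ n + x ^+ n)) (fun=> 1)).
  - apply: nearW => n; have /andP[_ ->] := step_poly_bound c n (introT andP (conj x0 x1)).
    rewrite andbT step_polyE.
    apply: le_trans (bernoulli_le _ _); last by rewrite xn0 xn1.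
    rewrite lerD2l lerN2.
    rewrite (_ : _ + _ = (n%:R / c ^+ n + 1) * x ^+ n); last by rewrite expr_div_n; ring.
    by rewrite ler_wpM2r.
  - rewrite -[X in _ --> X]subr0; apply: cvgB; first exact: cvg_cst.
    rewrite -[X in _ --> X](addr0 0); apply: cvgD.
      by apply: cvg_natM_geometric; rewrite divr_ge0 ?(ltW c0)//= ltr_pdivrMr// mul1r.
    by apply: cvg_expr; rewrite ger0_norm//; exact: lt_le_trans c1.
  - exact: cvg_cst.
apply: (@squeeze_cvgr _ _ _ _ (fun=> 0) (fun n => n.+1%:R^-1)).
- apply: nearW => n; have /andP[-> _] /= := step_poly_bound c n (introT andP (conj x0 x1)).
  rewrite step_polyE.
  have le1 : 1 - x ^+ n <= (1 + x ^+ n)^-1.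
    rewrite -[leRHS]mul1r ler_pdivlMr; last by rewrite ltr_pwDl.
    by have := sqr_ge0 (x ^+ n); rewrite expr2; lra.
  apply: (@le_trans _ _ ((1 + x ^+ n)^-1 ^+ step_exp c n)).
    by rewrite lerXn2r ?nnegrE ?subr_ge0// invr_ge0 addr_ge0.
  rewrite exprVn lef_pV2 ?posrE ?exprn_gt0 ?ltr_pwDl//.
  apply: le_trans (bernoulli_ge _ (xn0 n)).
  rewrite -nat1r lerD2l; apply: (@le_trans _ _ ((step_exp c n)%:R * c ^+ n)).
    by rewrite -ler_pdivrMr.
  by rewrite ler_wpM2l// lerXn2r ?nnegrE// ltW.
- exact: cvg_cst.
- exact: cvg_harmonic.
Qed.

End StepPolynomial.

Section WeightedPush.
Context {d : measure_display} {T : measurableType d} {R : realType}.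
Context {d' : measure_display} {T' : measurableType d'}.
Variables (mu : {measure set T -> \bar R}) (W : T -> R) (X : T -> T').
Hypotheses (iW : mu.-integrable setT (EFin \o W)) (W0 : forall t, 0 <= W t).
Hypothesis mX : measurable_fun setT X.

(** The weight lets one uniqueness argument cover the law of a variable under P, a density with
    respect to Lebesgue measure, and P weighted by a product of other variables. *)
Definition weighted_push (B : set T') : \bar R :=
  (\int[mu]_(t in X @^-1` B) (W t)%:E)%E.

Let mXB B : measurable B -> measurable (X @^-1` B).
Proof. by move=> mB; rewrite -[_ @^-1` _]setTI; exact: mX. Qed.

Let mW : measurable_fun setT (EFin \o W).
Proof. exact: measurable_int iW. Qed.

Let weighted_push0 : weighted_push set0 = 0%E.
Proof. by rewrite /weighted_push preimage_set0 integral_set0. Qed.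

Let weighted_push_ge0 B : (0 <= weighted_push B)%E.
Proof. by apply: integral_ge0 => t _; rewrite lee_fin. Qed.

Let weighted_push_sigma_additive : semi_sigma_additive weighted_push.
Proof.
move=> F mF tF mUF; rewrite /weighted_push preimage_bigcup ge0_integral_bigcup//.
- apply: is_cvg_nneseries => n _ _; exact: weighted_push_ge0.
- by move=> k; exact: mXB.
- by apply: measurable_funTS.
- by move=> t _; rewrite lee_fin.
- by apply/trivIsetP => i j _ _ ij; rewrite -preimage_setI;
    move/trivIsetP : tF => /(_ i j I I ij) ->; rewrite preimage_set0.
Qed.

HB.instance Definition _ := isMeasure.Build _ _ _ weighted_push
  weighted_push0 weighted_push_ge0 weighted_push_sigma_additive.

Definition weighted_measure : {measure set T' -> \bar R} := weighted_push.

Lemma weighted_measureE B : weighted_measure B = (\int[mu]_(t in X @^-1` B) (W t)%:E)%E.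
Proof. by []. Qed.

End WeightedPush.

Section MomentIntegrals.
Context {d : measure_display} {T : measurableType d} {R : realType}.
Variables (mu : {measure set T -> \bar R}) (W X : T -> R).
Hypotheses (iW : mu.-integrable setT (EFin \o W)) (W0 : forall t, 0 <= W t).
Hypothesis mX : measurable_fun setT X.

Let mXB B : measurable B -> measurable (X @^-1` B).
Proof. by move=> mB; rewrite -[_ @^-1` _]setTI; exact: mX. Qed.

Let mW : measurable_fun setT (EFin \o W).
Proof. exact: measurable_int iW. Qed.

Hypothesis X01 : forall t, W t != 0 -> 0 <= X t <= 1.

Let Wint (p : nat) : mu.-integrable setT (fun t => (W t * X t ^+ p)%:E).
Proof.
apply: (le_integrable _ _ _ iW) => //.
  by apply/measurable_EFinP/measurable_funM; [exact/measurable_EFinP|exact: measurable_funX].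
move=> t _ /=; rewrite lee_fin normrM; have [->|/X01/andP[x0 x1]] := eqVneq (W t) 0.
  by rewrite normr0 mul0r.
by rewrite ler_piMr// ger0_norm ?exprn_ge0// exprn_ile1.
Qed.

Lemma integral_weight_horner (p : {poly R}) :
  (\int[mu]_t (W t * p.[X t])%:E = \sum_(i < size p) (p`_i)%:E * \int[mu]_t (W t * X t ^+ i)%:E)%E.
Proof.
under eq_integral.
  move=> t _; rewrite horner_coef mulr_sumr -sumEFin.
  under eq_bigr do rewrite mulrCA EFinM.
  over.
rewrite integral_sum//=; last by move=> i; exact: integrableZl.
by apply: eq_bigr => i _; rewrite integralZl.
Qed.

Lemma cvg_integral_step_poly c : 0 < c <= 1 ->
  (\int[mu]_t (W t * (step_poly c n).[X t])%:E)%E @[n --> \oo] --> weighted_measure iW W0 mX `]-oo, c[%classic.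
Proof.
move=> c01.
have mI : measurable (X @^-1` `]-oo, c[) by exact: mXB.
rewrite weighted_measureE integral_mkcond.
have mWp (p : {poly R}) : measurable_fun setT (fun t => (W t * p.[X t])%:E).
  apply/measurable_EFinP/measurable_funM; first exact/measurable_EFinP.
  under eq_fun do rewrite horner_coef.
  by apply: measurable_sum => i; apply: measurable_funM => //; exact: measurable_funX.
have mf : measurable_fun setT ((fun t => (W t)%:E) \_ (X @^-1` `]-oo, c[%classic)).
  by apply/(measurable_restrictT _ _).1 => //; apply: measurable_funTS.
have f_f : {ae mu, forall t, setT t -> (W t * (step_poly c n).[X t])%:E @[n --> \oo] -->
    ((fun t => (W t)%:E) \_ (X @^-1` `]-oo, c[%classic)) t}.
  apply: aeW => t _.
  have -> : (((fun t => (W t)%:E) \_ (X @^-1` `]-oo, c[%classic)) t = (W t * (X t < c)%R%:R)%:E)%E.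
    rewrite patchE; case: ifPn => [/set_mem|/negP tX] /=.
      by rewrite in_itv/= => ->; rewrite mulr1.
    case: ltP => xc; last by rewrite mulr0.
    by exfalso; apply: tX; apply/mem_set; rewrite /= in_itv.
  apply/fine_cvgP; split; first exact: nearW.
  have [->|/X01 x01] := eqVneq (W t) 0.
    by rewrite mul0r; apply: cvg_near_cst; apply: nearW => n /=; rewrite mul0r.
  by apply: cvgMr; exact: cvg_step_poly.
have f_g : {ae mu, forall t n, setT t -> (`|(W t * (step_poly c n).[X t])%:E| <= (W t)%:E)%E}.
  apply: aeW => t n _; rewrite lee_fin normrM.
  have [->|/X01 x01] := eqVneq (W t) 0; first by rewrite normr0 mul0r.
  have /andP[p0 p1] := step_poly_bound c n x01.
  by rewrite ger0_norm// ler_piMr// ger0_norm.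
have [_ _] := dominated_convergence measurableT (fun n => mWp (step_poly c n)) mf f_f iW f_g.
exact.
Qed.

End MomentIntegrals.

(** Half-lines generate the Borel sets. For 0 < c <= 1 the mass of []-oo, c[] is a limit of
    integrals of polynomials; for other c it is 0 or the total mass. The range is prescribed where
    the weight is nonzero, because under Lebesgue measure the identity leaves [0, 1]. *)
Lemma moments_determine {R : realType} d1 d2 (T1 : measurableType d1) (T2 : measurableType d2)
    (mu1 : {measure set T1 -> \bar R}) (mu2 : {measure set T2 -> \bar R})
    (W1 X1 : T1 -> R) (W2 X2 : T2 -> R) :
  mu1.-integrable setT (EFin \o W1) -> mu2.-integrable setT (EFin \o W2) ->
  (forall t, 0 <= W1 t) -> (forall t, 0 <= W2 t) ->
  measurable_fun setT X1 -> measurable_fun setT X2 ->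
  (forall t, W1 t != 0 -> 0 <= X1 t <= 1) -> (forall t, W2 t != 0 -> 0 <= X2 t <= 1) ->
  (forall p, \int[mu1]_t (W1 t * X1 t ^+ p)%:E = \int[mu2]_t (W2 t * X2 t ^+ p)%:E)%E ->
  forall B, measurable B ->
    (\int[mu1]_(t in X1 @^-1` B) (W1 t)%:E = \int[mu2]_(t in X2 @^-1` B) (W2 t)%:E)%E.
Proof.
move=> iW1 iW2 W10 W20 mX1 mX2 X101 X201 mom12 B mB.
pose m1 := weighted_measure iW1 W10 mX1; pose m2 := weighted_measure iW2 W20 mX2.
rewrite -[LHS]/(m1 B) -[RHS]/(m2 B).
(* The moment of order 0 is the total mass. *)
have eT : m1 setT = m2 setT.
  have := mom12 0%N; under eq_integral do rewrite expr0 mulr1.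
  by under [X in _ = X -> _]eq_integral do rewrite expr0 mulr1.
have le01 d (T : measurableType d) (mu : {measure set T -> \bar R}) (W X : T -> R)
    (iW : mu.-integrable setT (EFin \o W)) (W0 : forall t, 0 <= W t)
    (mX : measurable_fun setT X) (X01 : forall t, W t != 0 -> 0 <= X t <= 1) c : c <= 0 ->
    weighted_measure iW W0 mX `]-oo, c[%classic = 0%E.
  move=> c0; rewrite weighted_measureE integral_mkcond.
  rewrite (eq_integral (cst 0%E)) ?integral0// => t _; rewrite patchE.
  case: ifPn => // /set_mem; rewrite /= in_itv/= => xc.
  have [->//|/X01/andP[x0 _]] := eqVneq (W t) 0.
  by have := le_lt_trans x0 (lt_le_trans xc c0); rewrite ltxx.
have ge1 d (T : measurableType d) (mu : {measure set T -> \bar R}) (W X : T -> R)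
    (iW : mu.-integrable setT (EFin \o W)) (W0 : forall t, 0 <= W t)
    (mX : measurable_fun setT X) (X01 : forall t, W t != 0 -> 0 <= X t <= 1) c : 1 < c ->
    weighted_measure iW W0 mX `]-oo, c[%classic = weighted_measure iW W0 mX setT.
  move=> c1; rewrite !weighted_measureE [LHS]integral_mkcond preimage_setT.
  apply: eq_integral => t _; rewrite patchE.
  case: ifPn => // /negP; have [->//|/X01/andP[_ x1]] := eqVneq (W t) 0.
  by case; apply/mem_set; rewrite /= in_itv/=; exact: le_lt_trans c1.
apply: (@measure_unique_setI _ _ _ (@RGenInftyO.G R)) => //.
- by move=> _ [x ->]; exact: measurable_itv.
- move=> _ _ [x ->] [y ->]; exists (Num.min x y).
  by apply/seteqP; split => z; rewrite /= !in_itv/= lt_min; [move=> [-> ->]|move=> /andP].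
- have -> : m1 setT = (\int[mu1]_t (W1 t)%:E)%E by rewrite weighted_measureE preimage_setT.
  by rewrite integrable_lty.
- move=> _ [c ->].
  have [c0|c0] := leP c 0; first by rewrite !le01.
  have [c1|c1] := leP c 1; last by rewrite !ge1.
  have c01 : 0 < c <= 1 by rewrite c0.
  have h1 := @cvg_integral_step_poly _ _ _ _ _ _ iW1 W10 mX1 X101 c c01.
  have h2 := @cvg_integral_step_poly _ _ _ _ _ _ iW2 W20 mX2 X201 c c01.
  rewrite -(cvg_lim _ h1)// -(cvg_lim _ h2)//; congr (limn _); apply/funext => n.
  by rewrite !integral_weight_horner//; under eq_bigr do rewrite mom12.
- have : (@RGenInftyO.G R).-sigma.-measurable B by rewrite -RGenInftyO.measurableE.
  by [].
Qed.

(** * Gamma and beta integrals *)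

Section LebesgueInvariance.
Context {R : realType}.
Notation mu := (@lebesgue_measure R).
Implicit Types (f : R -> \bar R) (c k : R).

Lemma ge0_integral_comp (phi : R -> R) f : measurable_fun setT phi ->
  measurable_fun setT f -> (forall x, (0 <= f x)%E) ->
  (\int[mu]_x f (phi x) =
   \int[pushforward mu (phi : measurableTypeR R -> measurableTypeR R)]_x f x)%E.
Proof.
move=> mphi mf f0.
by rewrite (@ge0_integral_pushforward _ _ (measurableTypeR R) (measurableTypeR R) R phi mphi mu setT f).
Qed.

Lemma ge0_integral_translation f c : measurable_fun setT f -> (forall x, (0 <= f x)%E) ->
  (\int[mu]_x f (x - c)%R = \int[mu]_x f x)%E.
Proof.
move=> mf f0.
have mphi : measurable_fun setT (fun x : R => x - c) by exact: measurable_funB.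
rewrite (ge0_integral_comp mphi)//.
apply: (@eq_measure_integral _ (measurableTypeR R) _ setT mu) => A mA _.
apply/esym/(@lebesgue_measure_unique _ _ _ A mA) => //= _ [[a b]] _ <-.
rewrite /pushforward (_ : _ @^-1` _ = `]a + c, b + c]%classic); last first.
  by apply/seteqP; split => x; rewrite /= !in_itv/= ltrBrDr lerBlDr.
rewrite !lebesgue_measure_itv/= !lte_fin ltrD2r.
by case: ifPn => // _; rewrite -!EFinD; congr EFin; ring.
Qed.

Lemma ge0_integral_scaling f k : 0 < k -> measurable_fun setT f -> (forall x, (0 <= f x)%E) ->
  (k%:E * \int[mu]_x f (k * x)%R = \int[mu]_x f x)%E.
Proof.
move=> k0 mf f0.
have mphi : measurable_fun setT (fun x : R => k * x) by exact: measurable_funM.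
rewrite (ge0_integral_comp mphi)//.
rewrite -(@ge0_integral_mscale _ (measurableTypeR R) _ _ setT _ (NngNum (ltW k0)))//.
apply: (@eq_measure_integral _ (measurableTypeR R) _ setT mu) => A mA _.
apply/esym/(@lebesgue_measure_unique _ _ _ A mA) => //= _ [[a b]] _ <-.
rewrite /mscale/= /pushforward (_ : _ @^-1` _ = `]a / k, b / k]%classic); last first.
  by apply/seteqP; split => x; rewrite /= !in_itv/= ltr_pdivrMr// ler_pdivlMr// ![_ * k]mulrC.
rewrite !lebesgue_measure_itv/= !lte_fin ltr_pM2r ?invr_gt0//.
case: ifPn => _; last by rewrite mule0.
by rewrite -!EFinB -EFinM; congr EFin; field; rewrite gt_eqF.
Qed.

End LebesgueInvariance.

Section GammaBeta.
Context {R : realType}.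
Notation mu := (@lebesgue_measure R).
Implicit Types (a b t x : R).

(** Extending the integrands by 0 to the whole line lets translation, scaling and Tonelli apply with
    no change of domain; integrals in [\bar R] let the identities precede finiteness. *)
Definition gamma_kernel a t : R := if 0 < t then t `^ (a - 1) * expR (- t) else 0.
Definition beta_kernel a b x : R :=
  if 0 < x < 1 then x `^ (a - 1) * (1 - x) `^ (b - 1) else 0.

Definition gamma_int a : \bar R := (\int[mu]_t (gamma_kernel a t)%:E)%E.
Definition beta_int a b : \bar R := (\int[mu]_x (beta_kernel a b x)%:E)%E.

Lemma gamma_kernel_ge0 a t : 0 <= gamma_kernel a t.
Proof. by rewrite /gamma_kernel; case: ifP => // _; rewrite mulr_ge0 ?powR_ge0 ?expR_ge0. Qed.

Lemma beta_kernel_ge0 a b x : 0 <= beta_kernel a b x.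
Proof. by rewrite /beta_kernel; case: ifP => // _; rewrite mulr_ge0 ?powR_ge0. Qed.

Lemma measurable_gamma_kernel a : measurable_fun setT (gamma_kernel a).
Proof.
apply: measurable_fun_ifT; [exact: measurable_fun_ltr| |exact: measurable_cst].
apply: measurable_funM; first exact: measurable_powR.
by apply: measurableT_comp => //; exact: measurable_funN.
Qed.

Lemma measurable_beta_kernel a b : measurable_fun setT (beta_kernel a b).
Proof.
apply: measurable_fun_ifT; [|apply: measurable_funM|exact: measurable_cst].
- by apply: measurable_and; exact: measurable_fun_ltr.
- exact: measurable_powR.
- apply: (@measurableT_comp _ _ _ _ _ _ (@powR R ^~ (b - 1))); first exact: measurable_powR.
  exact: measurable_funB.
Qed.

Lemma gamma_int_ge0 a : (0 <= gamma_int a)%E.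
Proof. by apply: integral_ge0 => t _; rewrite lee_fin gamma_kernel_ge0. Qed.

Lemma beta_int_ge0 a b : (0 <= beta_int a b)%E.
Proof. by apply: integral_ge0 => t _; rewrite lee_fin beta_kernel_ge0. Qed.

(** The substitution s = t x pulls out t^(a + b - 1) exp(-t), by homogeneity of the powers. *)
Lemma gamma_kernel_conv a b t : 0 < t ->
  (\int[mu]_s (gamma_kernel a s * gamma_kernel b (t - s))%:E =
   (gamma_kernel (a + b) t)%:E * beta_int a b)%E.
Proof.
move=> t0.
have m1 : measurable_fun setT (fun s => (gamma_kernel a s * gamma_kernel b (t - s))%:E).
  apply/measurable_EFinP/measurable_funM; first exact: measurable_gamma_kernel.
  apply: (@measurableT_comp _ _ _ _ _ _ (gamma_kernel b)); first exact: measurable_gamma_kernel.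
  exact: measurable_funB.
rewrite -(ge0_integral_scaling t0)//; last first.
  by move=> x; rewrite lee_fin mulr_ge0 ?gamma_kernel_ge0.
transitivity (\int[mu]_x ((gamma_kernel (a + b) t)%:E * (beta_kernel a b x)%:E))%E; last first.
  rewrite ge0_integralZl//; first by apply/measurable_EFinP; exact: measurable_beta_kernel.
    by move=> x _; rewrite lee_fin beta_kernel_ge0.
  by rewrite lee_fin gamma_kernel_ge0.
rewrite -ge0_integralZl//; last 3 first.
- have mk : measurable_fun setT (fun x : R => t * x) by exact: measurable_funM.
  exact: (measurableT_comp m1 mk).
- by move=> x _; rewrite lee_fin mulr_ge0 ?gamma_kernel_ge0.
- by rewrite lee_fin ltW.
apply: eq_integral => x _; rewrite -!EFinM; congr EFin.
rewrite /gamma_kernel /beta_kernel pmulr_rgt0// t0.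
have -> : t - t * x = t * (1 - x) by ring.
rewrite pmulr_rgt0// subr_gt0.
case: ltP => x0 /=; last by rewrite mul0r !mulr0.
case: ltP => x1 /=; last by rewrite !mulr0.
rewrite !powRM ?(ltW t0) ?(ltW x0) ?subr_ge0 ?(ltW x1)//.
have -> : t `^ (a + b - 1) = t `^ 1 * t `^ (a - 1) * t `^ (b - 1).
  by rewrite -!powRD ?(gt_eqF t0) ?implybT//; congr (_ `^ _); ring.
rewrite powRr1 ?(ltW t0)//.
have -> : expR (- t) = expR (- (t * x)) * expR (- (t * (1 - x))).
  by rewrite -expRD; congr expR; ring.
by ring.
Qed.

(** The convolution of two gamma kernels is integrated in both orders. The identity lives in
    [0, +oo]; its case b = 1 is the source of the functional equation and hence of finiteness. *)
Lemma gamma_beta a b : (gamma_int a * gamma_int b = gamma_int (a + b) * beta_int a b)%E.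
Proof.
have mg c : measurable_fun setT (fun t => (gamma_kernel c t)%:E).
  by apply/measurable_EFinP; exact: measurable_gamma_kernel.
have g0 c t : (0 <= (gamma_kernel c t)%:E)%E by rewrite lee_fin gamma_kernel_ge0.
rewrite -ge0_integralZr ?gamma_int_ge0//.
transitivity (\int[mu]_s \int[mu]_t (gamma_kernel a s * gamma_kernel b (t - s))%:E)%E.
  apply: eq_integral => s _.
  rewrite [in LHS]/gamma_int -(ge0_integral_translation (f := fun t => (gamma_kernel b t)%:E) s)//.
  rewrite -ge0_integralZl//.
  apply: (@measurableT_comp _ _ _ _ _ _ (fun t => (gamma_kernel b t)%:E)) => //.
  exact: measurable_funB.
rewrite (@fubini_tonelli _ _ (measurableTypeR R) (measurableTypeR R) R mu mu
  (fun z => (gamma_kernel a z.1 * gamma_kernel b (z.2 - z.1))%:E))/=; last 2 first.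
- apply/measurable_EFinP/measurable_funM.
    by apply: (@measurableT_comp _ _ _ _ _ _ (gamma_kernel a)) => //; exact: measurable_gamma_kernel.
  apply: (@measurableT_comp _ _ _ _ _ _ (gamma_kernel b)); first exact: measurable_gamma_kernel.
  exact: measurable_funB.
- by move=> z; rewrite lee_fin mulr_ge0 ?gamma_kernel_ge0.
rewrite -ge0_integralZr ?beta_int_ge0//.
apply: eq_integral => t _; have [t0|t0] := ltP 0 t; first exact: gamma_kernel_conv.
rewrite [in RHS]/gamma_kernel ltNge t0/= mul0e; apply: integral0_eq => s _.
rewrite /gamma_kernel subr_gt0; case: ltP => s0; last by rewrite mul0r.
by rewrite ifF ?mulr0//; apply/negbTE; rewrite -leNgt; exact: le_trans t0 (ltW s0).
all: exact: mg.
Qed.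

(** The possible singularity at 0 is approached through the intervals [1 / (n + 2), 1],
    nondegenerate already for n = 0: the fundamental theorem of calculus applies on each, and
    monotone convergence passes to the limit. *)
Lemma integral_powR a : 0 < a -> beta_int a 1 = (a^-1)%:E.
Proof.
move=> a0.
have -> : beta_int a 1 = (\int[mu]_(x in `]0%R, 1%R]) (x `^ (a - 1))%:E)%E.
  rewrite -integral_itv_bndo_bndc; last first.
    by apply/measurable_EFinP/measurable_funTS; exact: measurable_powR.
  rewrite integral_mkcond; apply: eq_integral => x _.
  rewrite patchE mem_setE in_itv /beta_kernel /=.
  by case: ifP => // _; rewrite subrr powRr0 mulr1.
pose F (n : nat) := `[n.+2%:R^-1, (1 : R)]%classic.
have -> : `]0, (1 : R)]%classic = \bigcup_n F n.
  apply/seteqP; split => x /=; rewrite in_itv/=; last first.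
    by case=> n _; rewrite /F /= in_itv/= => /andP[h ->]; rewrite (lt_le_trans _ h)// invr_gt0.
  move=> /andP[x0 x1]; exists (Num.truncn x^-1) => //; rewrite /F /= in_itv/= x1 andbT.
  rewrite invf_ple ?posrE//; apply/ltW; apply: lt_le_trans (truncnS_gt _) _.
  by rewrite ler_nat.
have mp D : measurable_fun D (fun x => (x `^ (a - 1))%:E).
  by apply/measurable_EFinP/measurable_funTS; exact: measurable_powR.
have Fcvg : (\int[mu]_(x in F n) (x `^ (a - 1))%:E)%E @[n --> \oo] -->
    (\int[mu]_(x in \bigcup_n F n) (x `^ (a - 1))%:E)%E.
  apply: ge0_nondecreasing_set_cvg_integral => //.
  - move=> n m nm; apply/subsetPset => x; rewrite /F /= !in_itv/= => /andP[h ->].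
    by rewrite andbT (le_trans _ h)// lef_pV2 ?posrE// ler_nat; lia.
  - by move=> n; exact: measurable_itv.
  - by move=> n; exact: mp.
  - by move=> n x _; rewrite lee_fin powR_ge0.
rewrite -(cvg_lim _ Fcvg)//; apply/cvg_lim => //.
have Fi n : (\int[mu]_(x in F n) (x `^ (a - 1))%:E =
    (a^-1 - a^-1 * n.+2%:R^-1 `^ a)%:E)%E.
  have n0 : 0 < n.+2%:R^-1 :> R by rewrite invr_gt0.
  have d x : 0 < x -> is_derive x 1 (fun x => a^-1 * x `^ a) (x `^ (a - 1)).
    move=> x0; have h := is_derive1_powR a x0.
    have h' := is_deriveZ (a^-1) h.
    apply: (is_derive_eq h').
    by rewrite /GRing.scale/= mulrA mulVf ?gt_eqF// mul1r.
  have cF x : 0 < x -> {for x, continuous (fun x => a^-1 * x `^ a)}.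
    move=> /d h; apply/differentiable_continuous/derivable1_diffP.
    by have [] := h.
  rewrite (@continuous_FTC2 _ _ (fun x => a^-1 * x `^ a)).
  - by rewrite powR1 mulr1 EFinB.
  - by rewrite invf_lt1// ltr1n.
  - apply: derivable_within_continuous => x; rewrite in_itv/= => /andP[nx _].
    by apply: derivable_powR; rewrite in_itv/= andbT (lt_le_trans n0).
  - split.
    + by move=> x; rewrite in_itv/= => /andP[nx _]; have [] := d x (lt_trans n0 nx).
    + by apply: cvg_at_right_filter; exact: cF.
    + by apply: cvg_at_left_filter; exact: cF.
  - move=> x; rewrite in_itv/= => /andP[nx _]; rewrite derive1E.
    by have [_ ->] := d x (lt_trans n0 nx).
under eq_cvg do rewrite Fi.
apply/fine_cvgP; split; first exact: nearW.
rewrite -[X in _ --> X]subr0 -[X in _ --> _ - X](mulr0 a^-1).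
apply: cvgB; first exact: cvg_cst.
apply: cvgMr; move/cvg_at_rightP: (powR_cvg0 a0); apply; split => //.
by have := @cvg_harmonic R; rewrite -cvg_shiftS.
Qed.

Lemma gamma_int1 : gamma_int 1 = 1%E.
Proof.
rewrite -(@integral_exponential_pdf R 1)//.
transitivity (\int[mu]_(x in `]0%R, +oo[) (expR (- x))%:E)%E.
  rewrite [RHS]integral_mkcond; apply: eq_integral => x _.
  rewrite patchE mem_setE in_itv /gamma_kernel /= andbT.
  by case: ifP => // _; rewrite subrr powRr0 mul1r.
rewrite integral_itv_obnd_cbnd; last first.
  have mN : measurable_fun setT (fun x : R => - x) by exact: measurable_funN.
  by apply/measurable_EFinP/measurable_funTS; exact: (measurableT_comp (@measurable_expR R) mN).
rewrite integral_mkcond; apply: eq_integral => x _.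
rewrite patchE mem_setE /exponential_pdf patchE mem_setE.
by case: ifP => // _; rewrite mul1r mulN1r.
Qed.

(** The case b = 1 of [gamma_beta], in place of an integration by parts. *)
Lemma gamma_intS a : 0 < a -> gamma_int (a + 1) = (a%:E * gamma_int a)%E.
Proof.
move=> a0; have := gamma_beta a 1; rewrite gamma_int1 mule1 integral_powR// => ->.
by rewrite muleCA -EFinM divff ?mule1// gt_eqF.
Qed.

(** For 0 < c <= 1 the kernel is dominated by x^(c - 1) on ]0, 1[ plus exp(-x); the functional
    equation raises the argument. *)
Lemma gamma_int_lty a : 0 < a -> (gamma_int a < +oo)%E.
Proof.
have mg c : measurable_fun setT (fun t => (gamma_kernel c t)%:E).
  by apply/measurable_EFinP; exact: measurable_gamma_kernel.
have mb c e : measurable_fun setT (fun t => (beta_kernel c e t)%:E).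
  by apply/measurable_EFinP; exact: measurable_beta_kernel.
have base c : 0 < c <= 1 -> (gamma_int c < +oo)%E.
  move=> /andP[c0 c1]; apply: (@le_lt_trans _ _ (beta_int c 1 + gamma_int 1)%E); last first.
    by rewrite integral_powR// gamma_int1 -EFinD ltry.
  rewrite -ge0_integralD//; last 4 first.
  - by move=> t _; rewrite lee_fin beta_kernel_ge0.
  - exact: mb.
  - by move=> t _; rewrite lee_fin gamma_kernel_ge0.
  - exact: mg.
  apply: ge0_le_integral => //.
  - by move=> t _; rewrite lee_fin gamma_kernel_ge0.
  - exact: mg.
  - by apply: emeasurable_funD; [exact: mb|exact: mg].
  - move=> t _; rewrite -EFinD lee_fin /gamma_kernel /beta_kernel subrr !powRr0 mulr1 mul1r.
    case: ltP => t0 /=; last by rewrite addr0.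
    case: ltP => t1.
      rewrite -[leLHS]addr0 lerD ?expR_ge0// ler_piMr ?powR_ge0//.
      by rewrite -expR0 ler_expR oppr_le0 ltW.
    rewrite add0r ler_piMl ?expR_ge0//.
    by apply: (le_trans (ler_powR t1 (_ : _ <= 0))); [lra|rewrite powRr0].
suff main n c : 0 < c <= n.+1%:R -> (gamma_int c < +oo)%E.
  move=> a0; apply: (main (Num.truncn a)); rewrite a0 /=.
  exact/ltW/truncnS_gt.
elim: n c => [|n IH] c; first exact: base.
move=> /andP[c0 cn]; have [c1|c1] := leP c 1; first by apply: base; rewrite c0.
rewrite -(subrK 1 c) gamma_intS ?subr_gt0// lte_mul_pinfty ?lee_fin ?subr_ge0 ?(ltW c1)//.
by apply: IH; rewrite subr_gt0 c1 lerBlDr natr1.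
Qed.

(** For c >= 1 the kernel dominates exp(-t) on ]1, +oo[, whose integral is exp(-1); smaller
    arguments are reached by the functional equation. *)
Lemma gamma_int_gt0 a : 0 < a -> (0 < gamma_int a)%E.
Proof.
have main c : 1 <= c -> (0 < gamma_int c)%E.
  move=> c1; apply: (@lt_le_trans _ _ (expR (- 1))%:E); first by rewrite lte_fin expR_gt0.
  rewrite -[leLHS]mule1 -gamma_int1 /gamma_int.
  have mg e : measurable_fun setT (fun t => (gamma_kernel e t)%:E).
    by apply/measurable_EFinP; exact: measurable_gamma_kernel.
  rewrite -(ge0_integral_translation (f := fun t => (gamma_kernel 1 t)%:E) 1)//; last first.
    by move=> t; rewrite lee_fin gamma_kernel_ge0.
  have mt : measurable_fun setT (fun t => (gamma_kernel 1 (t - 1))%:E).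
    apply: (@measurableT_comp _ _ _ _ _ _ (fun t => (gamma_kernel 1 t)%:E)) => //.
    exact: measurable_funB.
  rewrite -ge0_integralZl//; last by move=> t _; rewrite lee_fin gamma_kernel_ge0.
  apply: ge0_le_integral => //.
  - by move=> t _; rewrite -EFinM lee_fin mulr_ge0 ?gamma_kernel_ge0 ?expR_ge0.
  - exact: measurable_funeM.
  - exact: mg.
  move=> t _; rewrite -EFinM lee_fin /gamma_kernel subrr powRr0 mul1r subr_gt0.
  case: ltP => t1; last by rewrite mulr0; case: ifP => // _; rewrite mulr_ge0 ?powR_ge0 ?expR_ge0.
  rewrite (lt_trans ltr01 t1) -expRD (_ : - 1 + - (t - 1) = - t); last by ring.
  rewrite ler_peMl ?expR_ge0//.
  by apply: (le_trans _ (ler_powR (ltW t1) (_ : 0 <= _))); [rewrite powRr0|lra].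
move=> a0; have [a1|a1] := leP 1 a; first exact: main.
have : (0 < gamma_int (a + 1))%E by apply: main; lra.
by rewrite gamma_intS// pmule_rgt0.
Qed.

Lemma GammaE a : Gamma a = fine (gamma_int a).
Proof.
rewrite /Gamma /Rintegral integral_mkcond; congr fine; apply: eq_integral => t _.
by rewrite patchE mem_setE in_itv /gamma_kernel /= andbT; case: ifP.
Qed.

Lemma Gamma_int a : 0 < a -> gamma_int a = (Gamma a)%:E.
Proof. by move=> a0; rewrite GammaE fineK// ge0_fin_numE ?gamma_int_lty ?gamma_int_ge0. Qed.

Lemma Gamma_gt0 a : 0 < a -> 0 < Gamma a.
Proof. by move=> a0; rewrite -lte_fin -Gamma_int// gamma_int_gt0. Qed.

Lemma Gamma_rising a p : 0 < a -> Gamma (a + p%:R) = rising a p * Gamma a.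
Proof.
move=> a0; elim: p => [|p IH]; first by rewrite addr0 /rising big_ord0 mul1r.
have ap0 : 0 < a + p%:R by rewrite ltr_wpDr.
rewrite (_ : a + p.+1%:R = a + p%:R + 1); last by rewrite -natr1 addrA.
have := Gamma_int (addr_gt0 ap0 ltr01); rewrite gamma_intS// Gamma_int// -EFinM => -[<-].
by rewrite IH risingSr mulrA [_ * rising a p]mulrC.
Qed.

Lemma beta_intE a b : 0 < a -> 0 < b ->
  beta_int a b = (Gamma a * Gamma b / Gamma (a + b))%:E.
Proof.
move=> a0 b0; have ab0 : 0 < a + b by rewrite addr_gt0.
have := gamma_beta a b; rewrite !Gamma_int// -EFinM => e.
have g0 := Gamma_gt0 ab0.
rewrite -[LHS]mul1e -(_ : ((Gamma (a + b))^-1 * Gamma (a + b))%:E = 1%E); last first.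
  by rewrite mulVf// gt_eqF.
by rewrite EFinM -muleA -e -EFinM mulrC.
Qed.

(** Equal to [beta_density] on ]0, 1[ and 0 elsewhere, so that the weight itself confines the
    variable to [0, 1]. *)
Definition beta_weight a b x : R := beta_kernel a b x * (Gamma (a + b) / (Gamma a * Gamma b)).

Lemma beta_weight_ge0 a b x : 0 < a -> 0 < b -> 0 <= beta_weight a b x.
Proof.
move=> a0 b0; rewrite mulr_ge0 ?beta_kernel_ge0// divr_ge0 ?mulr_ge0 ?ltW ?Gamma_gt0//.
by rewrite addr_gt0.
Qed.

Lemma measurable_beta_weight a b : measurable_fun setT (beta_weight a b).
Proof. by apply: measurable_funM => //; exact: measurable_beta_kernel. Qed.

Lemma beta_weight_moment a b p : 0 < a -> 0 < b ->
  (\int[mu]_x (beta_weight a b x * x ^+ p)%:E = (mom a b p 0)%:E)%E.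
Proof.
move=> a0 b0; have ab0 : 0 < a + b by rewrite addr_gt0.
set c := Gamma (a + b) / (Gamma a * Gamma b).
have c0 : 0 <= c by rewrite divr_ge0 ?mulr_ge0 ?ltW ?Gamma_gt0.
transitivity (\int[mu]_x (c%:E * (beta_kernel (a + p%:R) b x)%:E))%E.
  apply: eq_integral => x _; rewrite -EFinM /beta_weight -/c mulrAC mulrC; congr (_ * _)%:E.
  rewrite /beta_kernel; case: ifP => [/andP[x0 x1]|_]; last by rewrite mul0r.
  rewrite mulrAC; congr (_ * _).
  rewrite -powR_mulrn ?ltW// -powRD ?(gt_eqF x0) ?implybT//; congr powR; ring.
rewrite ge0_integralZl//; last 2 first.
- by apply/measurable_EFinP; exact: measurable_beta_kernel.
- by move=> x _; rewrite lee_fin beta_kernel_ge0.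
have ap0 : 0 < a + p%:R by rewrite ltr_wpDr.
rewrite -/(beta_int _ _) beta_intE// -EFinM; congr EFin.
rewrite (addrAC a p%:R b) !Gamma_rising// /mom addn0 /c.
have -> : rising b 0 = 1 by rewrite /rising big_ord0.
move: (Gamma_gt0 a0) (Gamma_gt0 b0) (Gamma_gt0 ab0) (rising_gt0 p ab0).
move: (Gamma a) (Gamma b) (Gamma _) (rising a p) (rising _ p) => A B C r s A0 B0 C0 s0.
by field; rewrite !gt_eqF.
Qed.

Lemma beta_weight_law a b (A : set R) : 0 < a -> 0 < b -> measurable A ->
  (\int[mu]_(x in A `&` `[0%R, 1%R]) (beta_density a b x)%:E =
   \int[mu]_(x in A) (beta_weight a b x)%:E)%E.
Proof.
move=> a0 b0 mA; have ab0 : 0 < a + b by rewrite addr_gt0.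
have mbd : measurable_fun setT (beta_density a b).
  apply: measurable_funM => //; apply: measurable_funM => //; apply: measurable_funM.
    exact: measurable_powR.
  apply: (@measurableT_comp _ _ _ _ _ _ (@powR R ^~ (b - 1))); first exact: measurable_powR.
  exact: measurable_funB.
have mI : measurable (A `&` `[0%R, 1%R]) by apply: measurableI => //; exact: measurable_itv.
rewrite integral_mkcond [RHS]integral_mkcond; apply: ge0_ae_eq_integral => //.
- apply/(measurable_restrictT _ _).1; first exact: mI.
  by apply/measurable_EFinP; apply: measurable_funTS; exact: mbd.
- apply/(measurable_restrictT _ _).1; first exact: mA.
  by apply/measurable_EFinP; apply: measurable_funTS; exact: measurable_beta_weight.
- move=> x _; apply: erestrict_ge0 => {}x _; rewrite lee_fin /beta_density.
  rewrite divr_ge0 ?mulr_ge0 ?powR_ge0//; exact/ltW/Gamma_gt0.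
- by move=> x _; apply: erestrict_ge0 => {}x _; rewrite lee_fin beta_weight_ge0.
(* At the two endpoints the densities may differ, through the value given to a power of 0. *)
have n01 : mu.-negligible [set (0 : R); 1].
  apply/negligibleP; first by apply: measurableU; exact: measurable_set1.
  apply: null_set_setU; [exact: measurable_set1|exact: measurable_set1| |];
    exact: lebesgue_measure_set1.
apply: negligibleS n01 => x /= /not_implyP[_].
apply: contra_notP => /not_orP[/= x0 x1].
rewrite !patchE /beta_weight /beta_kernel /beta_density.
have -> : (x \in A `&` `[0%R, 1%R]) = (x \in A) && (0 < x < 1).
  rewrite in_setI mem_setE in_itv/=; congr (_ && _).
  by rewrite !lt_neqAle; have -> : x != 1 by [apply/eqP]; have -> : 0 != x by [apply/eqP => e; apply: x0].
case: (x \in A) => //=; case: ifP => // _; last by rewrite mul0r.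
by rewrite !mulrA.
Qed.

Lemma integrable_beta_weight a b : 0 < a -> 0 < b ->
  mu.-integrable setT (EFin \o beta_weight a b).
Proof.
move=> a0 b0; apply/integrableP; split.
  by apply/measurable_EFinP; exact: measurable_beta_weight.
rewrite [X in (X < _)%E](_ : _ = (mom a b 0 0)%:E) ?ltry// -beta_weight_moment//.
by apply: eq_integral => x _ /=; rewrite expr0 mulr1 ger0_norm ?beta_weight_ge0.
Qed.

End GammaBeta.

Section BetaLaw.
Context {R : realType} {d : measure_display} {Omega : measurableType d}.
Variables (P : probability Omega R) (X : {RV P >-> R}) (a b : R).
Hypotheses (a0 : 0 < a) (b0 : 0 < b).

Lemma beta_law_moments : (forall omega, 0 <= X omega <= 1) ->
  (forall p, Ex P (fun omega => X omega ^+ p) = mom a b p 0) -> has_beta_law X a b.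
Proof.
move=> X01 Xp A mA; rewrite beta_weight_law//.
have bX : bdm X.
  split; first exact: measurable_funP.
  by exists 1 => omega; have /andP[x0 x1] := X01 omega; rewrite ger0_norm.
have i1 : P.-integrable setT (EFin \o (fun=> 1)) by apply: bdm_integrable; exact: bdm_cst.
have := @moments_determine R _ _ _ (measurableTypeR R) P lebesgue_measure
  (fun=> 1) X (beta_weight a b) id i1 (integrable_beta_weight a0 b0).
move=> /(_ (fun=> ler01) (fun x => beta_weight_ge0 x a0 b0) bX.1).
move=> /(_ (@measurable_id _ _ _) (fun t _ => X01 t)).
have w01 t : beta_weight a b t != 0 -> 0 <= t <= 1.
  rewrite /beta_weight /beta_kernel; case: ifP => [/andP[t0 t1] _|]; last by rewrite mul0r eqxx.
  by rewrite !ltW.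
move=> /(_ w01) => <-//.
  by rewrite integral_cst ?mul1e// -[Y in measurable Y]setTI; exact: bX.1.
move=> p; rewrite beta_weight_moment// -Xp EFin_Ex; last exact: bdmX.
by apply: eq_integral => t _; rewrite mul1r.
Qed.

Lemma beta_law_atom0 : has_beta_law X a b -> P (X @^-1` [set 0]) = 0%E.
Proof.
move=> h; have := h [set 0] (measurable_set1 0); rewrite /distribution /pushforward => ->.
rewrite (beta_weight_law a0 b0) ?integral_set1//; exact: measurable_set1.
Qed.

End BetaLaw.

(** * Independence and conditional independence *)

Section ConditionalLaw.
Context {d : measure_display} {T : measurableType d} {R : realType}.
Variable P : probability T R.

Lemma ge0_integral_mrestr (A : set T) (mA : measurable A) (D : set T) (f : T -> \bar R) :
  measurable D -> measurable_fun setT f -> (forall x, (0 <= f x)%E) ->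
  (\int[mrestr P mA]_(x in D) f x = \int[P]_(x in D `&` A) f x)%E.
Proof.
move=> mD mf f0.
have mDA := measurableI _ _ mD mA; have mDAc := measurableD mD mA.
rewrite -{1}(setDUK (@subIsetl _ D A)) setDIr setDv set0U ge0_integral_setU//; last 2 first.
- by apply: measurable_funTS.
- by apply/disj_setPS => x [[_ Ax] [_ nAx]].
rewrite [X in (_ + X)%E](_ : _ = 0%E) ?adde0.
  apply: eq_measure_integral => E mE ED; rewrite -[LHS]/(P (E `&` A)).
  by rewrite (setIidl (subset_trans ED (@subIsetr _ _ _))).
rewrite -(integral_measure_zero (D `\` A) f).
apply: eq_measure_integral => E mE ED; rewrite -[LHS]/(P (E `&` A)).
rewrite (_ : E `&` A = set0) ?measure0//.
by apply/seteqP; split => // x [/ED[_ nAx] Ax].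
Qed.

Section law.
Context {d' : measure_display} {T' : measurableType d'}.
Variables (A : set T) (mA : measurable A) (Y : {mfun T >-> T'}).

(** The law of [Y] on the event [A], not normalised; it is dominated by the law of [Y], so that
    Radon-Nikodym applies. *)
Definition cond_law (C : set T') : \bar R := P (Y @^-1` C `&` A).

Let mY C : measurable C -> measurable (Y @^-1` C).
Proof. by move=> mC; rewrite -[_ @^-1` _]setTI; exact: measurable_funP. Qed.

Let cond_law0 : cond_law set0 = 0%E.
Proof. by rewrite /cond_law preimage_set0 set0I measure0. Qed.

Let cond_law_ge0 C : (0 <= cond_law C)%E.
Proof. exact: measure_ge0. Qed.

Let cond_law_sigma_additive : semi_sigma_additive cond_law.
Proof.
move=> F mF tF mUF; rewrite /cond_law preimage_bigcup setI_bigcupl.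
apply: measure_semi_sigma_additive.
- by move=> n; apply: measurableI => //; exact: mY.
- apply: trivIset_setIr; apply/trivIsetP => i j _ _ ij; rewrite -preimage_setI.
  by move/trivIsetP : tF => /(_ i j I I ij) ->; rewrite preimage_set0.
- apply: bigcupT_measurable => n; apply: measurableI => //; exact: mY.
Qed.

HB.instance Definition _ := isMeasure.Build _ _ _ cond_law
  cond_law0 cond_law_ge0 cond_law_sigma_additive.

Let cond_law_fin : fin_num_fun cond_law.
Proof. by move=> C mC; apply: fin_num_measure; apply: measurableI => //; exact: mY. Qed.

HB.instance Definition _ := Measure_isFinite.Build _ _ _ cond_law cond_law_fin.

Definition cond_law_measure : {finite_measure set T' -> \bar R} := cond_law.

Lemma ge0_integral_cond_law (C : set T') (g : T' -> \bar R) :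
  measurable C -> measurable_fun setT g -> (forall y, (0 <= g y)%E) ->
  (\int[cond_law_measure]_(y in C) g y = \int[P]_(x in Y @^-1` C `&` A) g (Y x))%E.
Proof.
move=> mC mg g0.
have mgY : measurable_fun setT (fun x => g (Y x)).
  by apply: measurableT_comp => //; exact: measurable_funP.
rewrite -ge0_integral_mrestr//; last exact: mY.
rewrite -(@ge0_integral_pushforward _ _ T T' R Y _ (mrestr P mA) C g)//.
exact: measurable_funTS.
Qed.

End law.
End ConditionalLaw.

(** f is the Radon-Nikodym derivative of [cond_law] with respect to the law of Y. The third property
    makes f(Y) a version of P(A | Y); the last says that on events {Y in C} the indicator of A may
    be replaced by f(Y) inside an integral of g(Y). *)
Lemma cond_density d (T : measurableType d) (R : realType) (P : probability T R)
    (Y : {RV P >-> R}) (A : set T) : measurable A ->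
  exists f : R -> R, [/\ measurable_fun setT f, forall y, 0 <= f y,
    forall C, measurable C -> P (A `&` Y @^-1` C) = (\int[P]_(x in Y @^-1` C) (f (Y x))%:E)%E
  & forall (C : set R) (g : R -> R), measurable C -> measurable_fun setT g ->
      (forall y, 0 <= g y) ->
      (\int[P]_(x in Y @^-1` C `&` A) (g (Y x))%:E =
       \int[P]_(x in Y @^-1` C) (g (Y x) * f (Y x))%:E)%E].
Proof.
move=> mA; pose nu := cond_law_measure P mA Y; pose mu := distribution P Y.
have mY : measurable_fun setT Y by exact: measurable_funP.
have numu : nu `<< mu.
  move=> C nC E mE EC; rewrite -[LHS]/(P (Y @^-1` E `&` A)).
  apply/eqP; rewrite -measure_le0.
  have <- : mu E = 0%E by exact: nC.
  by apply: le_measure; rewrite ?inE//; [apply: measurableI => //|];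
    rewrite -[Y @^-1` E]setTI; exact: mY.
pose f0 := Radon_Nikodym_SigmaFinite.f nu mu.
have f0_ge0 := Radon_Nikodym_SigmaFinite.f_ge0 numu.
have f0_fin := Radon_Nikodym_SigmaFinite.f_fin_num numu.
have if0 := Radon_Nikodym_SigmaFinite.f_integrable numu.
have mf0 : measurable_fun setT f0 := measurable_int _ if0.
have pushE C (g : R -> \bar R) : measurable C -> measurable_fun setT g ->
    (forall y, (0 <= g y)%E) ->
    (\int[mu]_(y in C) g y = \int[P]_(x in Y @^-1` C) g (Y x))%E.
  move=> mC mg g0; rewrite /mu /distribution.
  by rewrite (@ge0_integral_pushforward _ _ _ _ _ _ mY P C g)//; exact: measurable_funTS.
exists (fine \o f0); split.
- by apply: measurableT_comp => //; exact: measurable_fine.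
- by move=> y; rewrite /= fine_ge0// f0_ge0.
- move=> C mC; rewrite setIC -[LHS]/(nu C) (Radon_Nikodym_SigmaFinite.f_integral numu)//.
  by rewrite pushE//; apply: eq_integral => x _; rewrite /= fineK//; exact: f0_fin.
- move=> C g mC mg g0.
  have mg' : measurable_fun setT (EFin \o g) by exact/measurable_EFinP.
  rewrite -(@ge0_integral_cond_law _ _ _ P _ _ A mA Y C (EFin \o g))//.
  rewrite -(Radon_Nikodym_SigmaFinite.change_of_variables numu)//; last first.
    exact: measurable_funTS.
  rewrite pushE//.
  + by apply: eq_integral => x _; rewrite /= EFinM fineK//; exact: f0_fin.
  + exact: emeasurable_funM.
  + by move=> y; rewrite mule_ge0 ?lee_fin// f0_ge0.
Qed.

(** * From product moments to independence and conditional independence *)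

Section Independence.
Context {R : realType} {d : measure_display} {Omega : measurableType d}.
Variables (P : probability Omega R) (I : eqType) (V : I -> {RV P >-> R}).

Let mV i : measurable_fun setT (V i).
Proof. exact: measurable_funP. Qed.

Let mVB i B : measurable B -> measurable (V i @^-1` B).
Proof. by move=> mB; rewrite -[_ @^-1` _]setTI; exact: mV. Qed.

Section FromMoments.
Hypothesis V01 : forall i omega, 0 <= V i omega <= 1.
Hypothesis momV : forall (J : seq I) (p : I -> nat), uniq J ->
  Ex P (fun omega => \prod_(i <- J) V i omega ^+ p i) =
  \prod_(i <- J) Ex P (fun omega => V i omega ^+ p i).

Let bV i : bdm (V i).
Proof.
split; first exact: mV.
by exists 1 => omega; have /andP[x0 x1] := V01 i omega; rewrite ger0_norm.
Qed.

Let ind (B : I -> set R) i omega : R := \1_(V i @^-1` B i) omega.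

(** Powers are turned into indicators one variable at a time. Under the weight formed by the other
    factors, the moments of V_j are K times those under P, so its weighted law is K times its law.
    [J2] holds the powers still to be converted, with arbitrary exponents as the induction
    demands. *)
Lemma mixed_moments (B : I -> set R) (J1 J2 : seq I) (p : I -> nat) :
  (forall i, measurable (B i)) -> uniq (J1 ++ J2) ->
  Ex P (fun omega => \prod_(i <- J1) ind B i omega * \prod_(i <- J2) V i omega ^+ p i) =
  \prod_(i <- J1) Ex P (ind B i) * \prod_(i <- J2) Ex P (fun omega => V i omega ^+ p i).
Proof.
move=> mB; elim: J1 J2 p => [|j J1 IH] J2 p uJ.
  by under eq_fun do rewrite big_nil mul1r; rewrite momV// big_nil mul1r.
have bind i : bdm (ind B i) by apply: bdm_indic; exact: mVB.
have bX (J : seq I) q : bdm (fun omega => \prod_(i <- J) V i omega ^+ q i).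
  by apply: bdm_prod => i _; exact: bdmX.
have bI (J : seq I) : bdm (fun omega => \prod_(i <- J) ind B i omega).
  by apply: bdm_prod => i _; exact: bind.
pose W omega := \prod_(i <- J1) ind B i omega * \prod_(i <- J2) V i omega ^+ p i.
have bW : bdm W by exact: bdmM.
have W0 omega : 0 <= W omega.
  apply: mulr_ge0; apply: prodr_ge0 => i _; first by rewrite /ind indicE.
  by rewrite exprn_ge0//; have /andP[] := V01 i omega.
have uJ1 : uniq (J1 ++ J2) by move: uJ => /= /andP[].
have jJ : j \notin J1 ++ J2 by move: uJ => /= /andP[].
pose K := Ex P W.
have K0 : 0 <= K by exact: Ex_ge0.
have KE : K = \prod_(i <- J1) Ex P (ind B i) * \prod_(i <- J2) Ex P (fun omega => V i omega ^+ p i).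
  by rewrite /K /W IH.
have momW q : Ex P (fun omega => W omega * V j omega ^+ q) = K * Ex P (fun omega => V j omega ^+ q).
  pose p' i := if i == j then q else p i.
  have p'E i : i \in J2 -> p' i = p i.
    by move=> iJ; rewrite /p' ifN//; apply: contraNneq jJ => <-; rewrite mem_cat iJ orbT.
  have := IH (j :: J2) p'; rewrite uniq_catC /= mem_cat orbC -mem_cat jJ uniq_catC uJ1.
  move=> /(_ isT) IHj.
  transitivity (Ex P (fun omega => \prod_(i <- J1) ind B i omega *
     \prod_(i <- (j :: J2)) V i omega ^+ p' i)).
    congr Ex; apply/funext => omega; rewrite big_cons /W.
    have -> : \prod_(i <- J2) V i omega ^+ p' i = \prod_(i <- J2) V i omega ^+ p i.
      by apply: eq_big_seq => i iJ; rewrite p'E.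
    by rewrite {1}/p' eqxx mulrCA mulrC.
  rewrite IHj KE big_cons -mulrA; congr (_ * _).
  rewrite mulrC {2}/p' eqxx; congr (_ * _).
  by apply: eq_big_seq => i iJ; rewrite p'E.
have iK : P.-integrable setT (EFin \o (fun=> K)) by apply: bdm_integrable; exact: bdm_cst.
have := moments_determine (bdm_integrable P bW) iK W0 (fun=> K0) (mV j) (mV j)
  (fun t _ => V01 j t) (fun t _ => V01 j t).
have h p0 : (\int[P]_t (W t * V j t ^+ p0)%:E = \int[P]_t (K * V j t ^+ p0)%:E)%E.
  rewrite -!EFin_Ex; [|exact: bdmM (bdm_cst _) (bdmX _ _)|exact: bdmM (bdmX _ _)].
  by rewrite momW ExZ//; exact: bdmX.
move=> /(_ h _ (mB j)).
rewrite integral_mkcond [in RHS]integral_mkcond => e.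
have eW : Ex P (fun omega => ind B j omega * W omega) = K * Ex P (ind B j).
  rewrite -ExZ//; apply: EFin_inj; rewrite !EFin_Ex; [|exact: bdmM (bdm_cst _) _|exact: bdmM].
  transitivity (\int[P]_x (((fun t => (W t)%:E) \_ (V j @^-1` B j)) x))%E.
    by apply: eq_integral => x _; rewrite patchE /ind indicE; case: ifP; rewrite ?mul1r ?mul0r.
  by rewrite e; apply: eq_integral => x _; rewrite patchE /ind indicE; case: ifP; rewrite ?mulr1 ?mulr0.
rewrite big_cons -mulrA -KE mulrC -eW; congr Ex; apply/funext => omega.
by rewrite big_cons /W mulrA.
Qed.

Lemma independent_moments : mutually_independent V.
Proof.
move=> J B uJ mB.
have mcap : measurable (\bigcap_(i in [set` J]) (V i @^-1` B i)).
  by apply: fin_bigcap_measurable => // i _; exact: mVB.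
rewrite -[LHS]fineK ?fin_num_measure// -Ex_indic//.
transitivity (Ex P (fun omega => \prod_(i <- J) ind B i omega * \prod_(i <- [::]) V i omega ^+ 0))%:E.
  congr (Ex P _)%:E; apply/funext => omega; rewrite big_nil mulr1 /ind.
  rewrite indicE; case: (boolP (omega \in _)) => [/set_mem h|/negP h] /=.
    by rewrite big_seq big1// => i iJ; rewrite indicE mem_set//; exact: h.
  have [i iJ nB] : exists2 i, i \in J & ~ (V i @^-1` B i) omega.
    apply: contrapT => nex; apply: h; apply/mem_set => i iJ.
    by apply: contrapT => nB; apply: nex; exists i.
  by rewrite (big_rem i)//= indicE memNset// mul0r.
rewrite (@mixed_moments B J [::] (fun=> 0%N))// ?cats0// big_nil mulr1.
rewrite -prodEFin; apply: eq_bigr => i _.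
by rewrite /ind Ex_indic ?fineK// ?fin_num_measure//; exact: mVB.
Qed.

End FromMoments.
Definition cylinders (K : set I) : set (set Omega) := [set A | exists J B,
  [/\ uniq J, {in J, forall i, K i}, forall i, measurable (B i)
    & A = \bigcap_(i in [set` J]) (V i @^-1` B i)]].

Lemma cylinders_measurable K : cylinders K `<=` measurable.
Proof.
move=> _ [J [B [_ _ mB ->]]].
by apply: fin_bigcap_measurable => // i _; exact: mVB.
Qed.

Lemma cylinders1 i B : measurable B -> cylinders [set i] (V i @^-1` B).
Proof.
move=> mB; exists [:: i], (fun=> B); split => //.
  by move=> j; rewrite inE => /eqP ->.
apply/seteqP; split => omega; first by move=> h j /=; rewrite inE => /eqP ->.
by move=> /(_ i); apply; rewrite /= inE.
Qed.

Lemma cylindersT K : cylinders K setT.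
Proof.
exists [::], (fun=> setT); split => //.
by apply/seteqP; split => // omega _ i.
Qed.

Lemma sub_cylinders (K1 K2 : set I) : K1 `<=` K2 -> cylinders K1 `<=` cylinders K2.
Proof.
move=> K12 _ [J [B [uJ JK mB ->]]]; exists J, B; split => // i /JK; exact: K12.
Qed.

Lemma cylinders_setI K : setI_closed (cylinders K).
Proof.
move=> _ _ [J1 [B1 [u1 K1 m1 ->]]] [J2 [B2 [u2 K2 m2 ->]]].
exists (undup (J1 ++ J2)), (fun i => (if i \in J1 then B1 i else setT) `&`
  (if i \in J2 then B2 i else setT)); split.
- exact: undup_uniq.
- by move=> i; rewrite mem_undup mem_cat => /orP[/K1|/K2].
- by move=> i; apply: measurableI; case: ifP.
apply/seteqP; split => omega.
  by move=> [h1 h2] i _; split; case: ifP => // iJ; [apply: h1|apply: h2].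
move=> h; split => i iJ.
  by have := h i; rewrite /= mem_undup mem_cat iJ => /(_ isT)[].
by have := h i; rewrite /= mem_undup mem_cat iJ orbT => /(_ isT)[].
Qed.

Hypothesis indV : mutually_independent V.

Lemma cylinders_indep (K1 K2 : set I) A B : (forall i, K1 i -> ~ K2 i) ->
  cylinders K1 A -> cylinders K2 B -> (P (A `&` B) = P A * P B)%E.
Proof.
move=> K12 [J1 [B1 [u1 JK1 m1 ->]]] [J2 [B2 [u2 JK2 m2 ->]]].
have d12 : {in J1, forall i, i \notin J2}.
  by move=> i iJ; apply/negP => /JK2; exact/K12/JK1.
have d21 : {in J2, forall i, i \notin J1}.
  by move=> i iJ; apply/negP => /d12; rewrite iJ.
pose C i := if i \in J1 then B1 i else B2 i.
have E1 i : i \in J1 -> C i = B1 i by rewrite /C => ->.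
have E2 i : i \in J2 -> C i = B2 i by move=> /d21/negbTE; rewrite /C => ->.
have mC i : measurable (C i) by rewrite /C; case: ifP.
rewrite !indV//.
have -> : (\bigcap_(i in [set` J1]) (V i @^-1` B1 i)) `&` (\bigcap_(i in [set` J2]) (V i @^-1` B2 i)) =
    \bigcap_(i in [set` J1 ++ J2]) (V i @^-1` C i).
  apply/seteqP; split => omega.
    move=> [h1 h2] i /=; rewrite mem_cat => /orP[iJ|iJ].
      by rewrite E1//; exact: h1.
    by rewrite E2//; exact: h2.
  move=> h; split => i /= iJ.
    by rewrite -E1//; apply: h; rewrite /= mem_cat iJ.
  by rewrite -E2//; apply: h; rewrite /= mem_cat iJ orbT.
rewrite indV//; last first.
  by rewrite cat_uniq u1 u2 andbT; apply/hasPn => i /d21.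
rewrite big_cat/=; congr (_ * _)%E; apply: eq_big_seq => i iJ; first by rewrite E1.
by rewrite E2.
Qed.

Section Given.
Variable i0 : I.
Notation Y := (V i0).

(** A pi-system generating the sigma-algebra of Y and the V_i with i in K; the condition on Y is
    kept apart because both sides of the conditional independence share it. *)
Definition cylinders_with (K : set I) : set (set Omega) :=
  [set A | exists A0 C, [/\ cylinders K A0, measurable C & A = A0 `&` Y @^-1` C]].

Lemma cylinders_with_sub K : cylinders_with K `<=` cylinders (K `|` [set i0]).
Proof.
move=> _ [A [C [cA mC ->]]]; apply: cylinders_setI.
  by apply: sub_cylinders cA => i; left.
by apply: sub_cylinders (cylinders1 i0 mC) => i; right.
Qed.

Lemma cylinders_with_measurable K : cylinders_with K `<=` measurable.
Proof. by move=> A /cylinders_with_sub; exact: cylinders_measurable. Qed.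

Lemma cylinders_with_setI K : setI_closed (cylinders_with K).
Proof.
move=> _ _ [A [C [cA mC ->]]] [B [D [cB mD ->]]].
exists (A `&` B), (C `&` D); split.
- exact: cylinders_setI.
- exact: measurableI.
- by rewrite preimage_setI setIACA.
Qed.

Lemma sigma_cylinders_measurable K A : <<s cylinders_with K >> A -> measurable A.
Proof.
apply: smallest_sub; first exact: sigma_algebra_measurable.
exact: cylinders_with_measurable.
Qed.

(** Here [B] may involve Y while [A] does not. With A fixed, P(B n A) and P(A) P(B) are finite
    measures in B that agree on a pi-system. *)
Lemma sigma_cylinders_indep (K1 K2 : set I) A B :
  (forall i, K1 i -> ~ K2 i) -> ~ K1 i0 ->
  cylinders K1 A -> <<s cylinders_with K2 >> B -> (P (A `&` B) = P A * P B)%E.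
Proof.
move=> K12 K1i cA sB.
have mA : measurable A := cylinders_measurable cA.
pose k : {nonneg R} := NngNum (fine_ge0 (measure_ge0 P A)).
have kE : (k%:num)%:E = P A by rewrite /= fineK// fin_num_measure.
have e1 : mrestr P mA setT = mscale k P setT.
  rewrite -[LHS]/(P (setT `&` A)) -[RHS]/((k%:num)%:E * P setT)%E setTI kE.
  by rewrite [P setT]probability_setT mule1.
have e2 : (mrestr P mA setT < +oo)%E.
  by rewrite -[X in (X < _)%E]/(P (setT `&` A)) setTI ltey_eq fin_num_measure.
rewrite setIC -[LHS]/(mrestr P mA B) -kE -[RHS]/(mscale k P B).
apply: (measure_unique_setI (@cylinders_with_measurable K2) (@cylinders_with_setI K2) e1 e2) sB.
move=> D /cylinders_with_sub cD.
rewrite -[LHS]/(P (D `&` A)) -[RHS]/((k%:num)%:E * P D)%E kE setIC.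
by rewrite (cylinders_indep _ cA cD)// => i K1i' [/(K12 _ K1i')//|/= e]; rewrite e in K1i'.
Qed.

(** For A = A0 n {Y in C} both sides equal P(A0) times the integral of g(Y) over {Y in C}, as A0 is
    independent of B and Y together. Both sides are finite measures in A, so the equality extends to
    the generated sigma-algebra. *)
Lemma density_cylinders (K1 K2 : set I) A B (g : R -> R) :
  (forall i, K1 i -> ~ K2 i) -> ~ K1 i0 ->
  <<s cylinders_with K1 >> A -> <<s cylinders_with K2 >> B ->
  measurable_fun setT g -> (forall y, 0 <= g y) ->
  (forall C, measurable C -> P (B `&` Y @^-1` C) = (\int[P]_(x in Y @^-1` C) (g (Y x))%:E)%E) ->
  P (A `&` B) = (\int[P]_(x in A) (g (Y x))%:E)%E.
Proof.
move=> K12 K1i sA sB mg g0 gB.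
have mB := sigma_cylinders_measurable sB.
have gBT : P B = (\int[P]_x (g (Y x))%:E)%E.
  by have := gB _ measurableT; rewrite preimage_setT setIT.
have mgY : measurable_fun setT (fun x => g (Y x)) by apply: measurableT_comp.
have Boo : (P B < +oo)%E by rewrite ltey_eq fin_num_measure.
have ig : P.-integrable setT (EFin \o (fun x => g (Y x))).
  apply/integrableP; split; first exact/measurable_EFinP.
  under eq_integral do rewrite /= ger0_norm//.
  by rewrite -gBT.
have mid : measurable_fun setT (@id Omega) by exact: measurable_id.
pose m2 := weighted_measure ig (fun x => g0 (Y x)) mid.
rewrite -[RHS]/(m2 A).
have e1 : mrestr P mB setT = m2 setT by rewrite -[LHS]/(P (setT `&` B)) setTI gBT.
have e2 : (mrestr P mB setT < +oo)%E by rewrite -[X in (X < _)%E]/(P (setT `&` B)) setTI.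
rewrite -[LHS]/(mrestr P mB A).
apply: (measure_unique_setI (@cylinders_with_measurable K1) (@cylinders_with_setI K1) e1 e2) sA.
move=> _ [A0 [C [cA mC ->]]].
rewrite -[LHS]/(P (_ `&` B)) -setIA [_ `&` B]setIC.
rewrite (sigma_cylinders_indep K12 K1i cA); last first.
  have sC : <<s cylinders_with K2 >> (Y @^-1` C).
    apply: sub_sigma_algebra; exists setT, C; split => //; first exact: cylindersT.
    by rewrite setTI.
  exact: (@measurableI _ (g_sigma_algebraType (cylinders_with K2)) _ _ sB sC).
have mA0 : measurable A0 := cylinders_measurable cA.
rewrite gB// -[RHS]/(\int[P]_(x in A0 `&` Y @^-1` C) (g (Y x))%:E)%E setIC.
rewrite -(@ge0_integral_cond_law _ _ _ P _ _ A0 mA0 Y C (EFin \o g))//; last exact/measurable_EFinP.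
pose k : {nonneg R} := NngNum (fine_ge0 (measure_ge0 P A0)).
have kE : (k%:num)%:E = P A0 by rewrite /= fineK// fin_num_measure.
rewrite -kE.
rewrite -(@ge0_integral_pushforward _ _ _ _ _ _ (mV i0) P C (EFin \o g))//; last 2 first.
- by apply: measurable_funTS; apply/measurable_EFinP.
- by move=> y _; rewrite lee_fin.
rewrite -ge0_integral_mscale//; last 2 first.
- by apply: measurable_funTS; apply/measurable_EFinP.
- by move=> y _; rewrite lee_fin.
apply: eq_measure_integral => D mD _.
rewrite -[RHS]/(P (Y @^-1` D `&` A0)) -[LHS]/((k%:num)%:E * P (Y @^-1` D))%E kE setIC.
rewrite (@cylinders_indep K1 [set i0])//; last exact: cylinders1.
by move=> i K1i' /= e; rewrite e in K1i'.
Qed.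

(** On A n B n {Y in C} the event B is first absorbed into its density g, by [density_cylinders],
    and A then into f, by the last property in [cond_density]. *)
Lemma cond_independent_cylinders (K1 K2 : set I) (F G : set (set Omega)) :
  (forall i, K1 i -> ~ K2 i) -> ~ K1 i0 ->
  F `<=` <<s cylinders_with K1 >> -> G `<=` <<s cylinders_with K2 >> ->
  cond_independent Y F G.
Proof.
move=> K12 K1i FK GK A B /FK sA /GK sB.
have [f [mf f0 fA fint]] := cond_density Y (sigma_cylinders_measurable sA).
have [g [mg g0 gB _]] := cond_density Y (sigma_cylinders_measurable sB).
exists f, g; split; [by split|by split|split; first exact: measurable_funM].
move=> C mC; rewrite setIAC.
have sC : <<s cylinders_with K1 >> (Y @^-1` C).
  apply: sub_sigma_algebra; exists setT, C; split => //; first exact: cylindersT.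
  by rewrite setTI.
have sAC : <<s cylinders_with K1 >> (A `&` Y @^-1` C).
  exact: (@measurableI _ (g_sigma_algebraType (cylinders_with K1)) _ _ sA sC).
rewrite (density_cylinders K12 K1i sAC sB mg g0 gB) setIC fint//.
by apply: eq_integral => x _; rewrite mulrC.
Qed.

End Given.
End Independence.

(** * Limits of the moment functions *)

Section MomLimits.
Context {R : realType}.
Implicit Types (A B : R).

Lemma mom10 A B : mom A B 1 0 = A / (A + B).
Proof. by rewrite /mom /rising !big_ord_recr !big_ord0 /= !mul1r mulr1 !addr0. Qed.

Lemma mom01 A B : mom A B 0 1 = B / (A + B).
Proof. by rewrite /mom /rising !big_ord_recr !big_ord0 /= !mul1r !addr0. Qed.

Lemma cvg_rising (A S : nat -> R) (t : R) p :
  (S n)^-1 @[n --> \oo] --> (0 : R) -> A n / S n @[n --> \oo] --> t ->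
  rising (A n) p / S n ^+ p @[n --> \oo] --> t ^+ p.
Proof.
move=> S0 At; elim: p => [|p IH].
  rewrite expr0; apply: cvg_near_cst; apply: nearW => n.
  by rewrite /rising big_ord0 expr0 divr1.
have -> : (fun n => rising (A n) p.+1 / S n ^+ p.+1) =
    (fun n => (rising (A n) p / S n ^+ p) * (A n / S n + p%:R * (S n)^-1)).
  by apply/funext => n; rewrite risingSr exprSr invfM; ring.
rewrite exprSr; apply: cvgM => //.
rewrite -[X in _ --> X]addr0; apply: cvgD => //.
by rewrite -[X in _ --> X](mulr0 p%:R); apply: cvgMr.
Qed.

(** A beta law whose parameters have a large sum concentrates at its mean A / (A + B): in a rising
    factorial the shifts are negligible against that sum. *)
Lemma cvg_mom (A B : nat -> R) (t : R) p q :
  (\forall n \near \oo, 0 < A n + B n) ->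
  (A n + B n)^-1 @[n --> \oo] --> (0 : R) -> A n / (A n + B n) @[n --> \oo] --> t ->
  mom (A n) (B n) p q @[n --> \oo] --> t ^+ p * (1 - t) ^+ q.
Proof.
move=> Spos S0 At; pose S n := A n + B n.
have SS : S n / S n @[n --> \oo] --> (1 : R).
  by apply: cvg_near_cst; apply: filterS Spos => n Sn; rewrite divff// gt_eqF.
have Bt : B n / S n @[n --> \oo] --> 1 - t.
  have -> : (fun n => B n / S n) = (fun n => S n / S n - A n / S n).
    by apply/funext => n; rewrite -mulrBl; congr (_ / _); rewrite /S; ring.
  exact: cvgB.
have SSr : (rising (S n) (p + q) / S n ^+ (p + q))^-1 @[n --> \oo] --> (1 : R).
  rewrite -[X in _ --> X]invr1; apply: cvgV; first exact: oner_neq0.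
  by rewrite -[X in _ --> X](expr1n R (p + q)); exact: cvg_rising.
have : rising (A n) p / S n ^+ p * (rising (B n) q / S n ^+ q) *
    (rising (S n) (p + q) / S n ^+ (p + q))^-1 @[n --> \oo] --> t ^+ p * (1 - t) ^+ q * 1.
  by apply: cvgM => //; apply: cvgM; exact: cvg_rising.
rewrite mulr1 => lim; apply: cvg_trans lim.
apply: near_eq_cvg; apply: filterS Spos => n Sn.
have Sn0 : S n != 0 by rewrite gt_eqF.
have Sp k : S n ^+ k != 0 by rewrite expf_neq0.
rewrite /mom -/(S n) exprD !invfM invrK.
have := Sp p; have := Sp q; move: (S n ^+ p) (S n ^+ q) (rising _ p) (rising _ q) (rising (S n) _)^-1.
by move=> x y r s u y0 x0; field; rewrite x0 y0.
Qed.

Lemma cvg_mom_ratio (A B : nat -> R) (w w' : R) p q : 0 < w ->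
  (A n + B n) / n%:R @[n --> \oo] --> w -> A n / n%:R @[n --> \oo] --> w' ->
  mom (A n) (B n) p q @[n --> \oo] --> (w' / w) ^+ p * (1 - w' / w) ^+ q.
Proof.
move=> w0 Sw Aw.
have n0 : n%:R^-1 @[n --> \oo] --> (0 : R) by rewrite -cvg_shiftS; exact: cvg_harmonic.
have Spos : \forall n \near \oo, 0 < A n + B n.
  have Sgt : \forall n \near \oo, 0 < (A n + B n) / n%:R by exact: (cvgr_gt w Sw).
  apply: filterS2 (nbhs_infty_gt 0) Sgt => n n0' Sn.
  by move: Sn; rewrite pmulr_lgt0// invr_gt0 ltr0n.
have npos : \forall n \near \oo, (n%:R : R) != 0.
  by apply: filterS (nbhs_infty_gt 0) => n n0'; rewrite pnatr_eq0 -lt0n.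
have Sw' : ((A n + B n) / n%:R)^-1 @[n --> \oo] --> w^-1 by apply: cvgV => //; rewrite gt_eqF.
apply: cvg_mom => //.
  have : n%:R^-1 * ((A n + B n) / n%:R)^-1 @[n --> \oo] --> 0 * w^-1 by exact: cvgM.
  rewrite mul0r; apply: cvg_trans; apply: near_eq_cvg.
  apply: filterS2 npos Spos => n n0' Sn.
  by field; rewrite n0' gt_eqF.
have : A n / n%:R * ((A n + B n) / n%:R)^-1 @[n --> \oo] --> w' / w by exact: cvgM.
apply: cvg_trans; apply: near_eq_cvg.
apply: filterS2 npos Spos => n n0' Sn.
by field; rewrite n0' gt_eqF.
Qed.

Lemma cvg_shift_ratio (u : nat -> R) (x l : R) : u n / n%:R @[n --> \oo] --> l ->
  (x + u n) / n%:R @[n --> \oo] --> l.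
Proof.
move=> ul.
have -> : (fun n => (x + u n) / n%:R) = (fun n => x * n%:R^-1 + u n / n%:R).
  by apply/funext => n; rewrite mulrDl.
rewrite -[X in _ --> X]add0r; apply: cvgD => //.
rewrite -[X in _ --> X](mulr0 x); apply: cvgMr.
by rewrite -cvg_shiftS; exact: cvg_harmonic.
Qed.

End MomLimits.

(** * The martingale with all exponents 1, compared with y_j / n *)

Section ChainProduct.
Context {R : realType}.
Variables (a b : nat -> R) (c : R).
Hypothesis a0 : forall j, 0 < a j.
Hypothesis b0 : forall j, 0 < b j.+1.
Hypothesis abS : forall j, a j.+1 + b j.+1 = a j + 1.
Hypothesis c0 : 0 < c.

(** The conditional expectation of W_j given the counts; [c] is the level-0 parameter of the
    opposite side. *)
Definition chain_prod (n : nat) (y : nat -> nat) (j : nat) : R :=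
  (a 0%N + (y 0%N)%:R) / (a 0%N + c + n%:R - 1) *
  \prod_(0 <= i < j) level_mom a b (fun=> 1%N) y i.

Definition valid_counts (n : nat) (y : nat -> nat) :=
  [/\ (0 < n)%N, (y 0%N <= n.-1)%N & forall j, (y j.+1 <= (y j).-1)%N].

Lemma valid_counts_le n y j : valid_counts n y -> (y j <= n)%N.
Proof.
case=> n0 y0 yS; elim: j => [|j IH]; first by lia.
by have := yS j; lia.
Qed.

Lemma chain_prodS n y j :
  chain_prod n y j.+1 = chain_prod n y j * level_mom a b (fun=> 1%N) y j.
Proof. by rewrite /chain_prod big_nat_recr//= mulrA. Qed.

Lemma level_mom_bound p y j : 0 <= level_mom a b p y j <= 1.
Proof.
by rewrite /level_mom mom_ge0 ?mom_le1// ltr_wpDr.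
Qed.

Lemma level_denom y j : (y j.+1 <= (y j).-1)%N ->
  a j.+1 + (y j.+1)%:R + (b j.+1 + ((y j).-1 - y j.+1)%N%:R) = a j + 1 + (y j).-1%:R.
Proof. by move=> ys; rewrite natrB//; have := abS j; lra. Qed.

Lemma denom_ge n : (0 < n)%N -> Num.min 1 (a 0%N + c) * n%:R <= a 0%N + c + n%:R - 1.
Proof.
move=> n0; have n1 : 1 <= n%:R :> R by rewrite ler1n.
have ac := addr_gt0 (a0 0) c0.
have [h|h] := leP 1 (a 0%N + c); first by lra.
suff : 0 <= (1 - (a 0%N + c)) * (n%:R - 1) by lra.
by rewrite mulr_ge0//; lra.
Qed.

Lemma denom_gt0 n : (0 < n)%N -> 0 < a 0%N + c + n%:R - 1.
Proof.
move=> n0; apply: lt_le_trans (denom_ge n0).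
by rewrite mulr_gt0 ?ltr0n// lt_min ltr01 addr_gt0.
Qed.

(** On open levels each factor is a quotient of consecutive urn weights, so the product
    telescopes. *)
Lemma chain_prod_active n y j : valid_counts n y -> active y j ->
  chain_prod n y j = (a j + (y j)%:R) / (a 0%N + c + n%:R - 1).
Proof.
move=> vy; have [n0 _ yS] := vy; elim: j => [_|j IH].
  by rewrite /chain_prod big_geq// mulr1.
rewrite /active /= => yj.
have aj : active y j.
  by rewrite /active; case: j yj {IH} => // j yj /=; have := yS j; lia.
rewrite chain_prodS IH// /level_mom mom10 level_denom//.
have -> : a j + 1 + (y j).-1%:R = a j + (y j)%:R.
  by rewrite -addrA nat1r prednK.
have d0 := denom_gt0 n0; have e0 : 0 < a j + (y j)%:R by rewrite ltr_wpDr.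
by field; rewrite !gt_eqF.
Qed.

Lemma chain_prod_ge0 n y j : valid_counts n y -> 0 <= chain_prod n y j.
Proof.
move=> [n0 _ _]; rewrite /chain_prod mulr_ge0//.
  by apply: divr_ge0; [rewrite addr_ge0// ltW|exact/ltW/denom_gt0].
by apply: prodr_ge0 => i _; have /andP[] := level_mom_bound (fun=> 1%N) y i.
Qed.

(** On open levels the telescoped value is compared directly. From a level with count 0 on, the
    product can only decrease, and it is O(1/n) there already. *)
Lemma chain_prod_close j : exists C, 0 <= C /\ forall n y, valid_counts n y ->
  `|chain_prod n y j - (y j)%:R / n%:R| <= C / n%:R.
Proof.
(* By [denom_ge] the denominator a_0 + c + n - 1 is at least k n for all n >= 1, which explains the
   division by [k] in [C]. *)
pose k := Num.min 1 (a 0%N + c).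
have k0 : 0 < k by rewrite lt_min ltr01 addr_gt0.
pose C i := (a i + `|a 0%N + c - 1|) / k.
have C0 i : 0 <= C i by rewrite divr_ge0// ?addr_ge0// ltW.
have act i n y : valid_counts n y -> active y i ->
    `|chain_prod n y i - (y i)%:R / n%:R| <= C i / n%:R.
  move=> vy ai; have [n0 _ _] := vy; rewrite chain_prod_active//.
  have d0 := denom_gt0 n0; set D := a 0%N + c + n%:R - 1 in d0 *.
  have np : 0 < n%:R :> R by rewrite ltr0n.
  have yn : (y i)%:R <= n%:R :> R by rewrite ler_nat valid_counts_le.
  have -> : (a i + (y i)%:R) / D - (y i)%:R / n%:R =
      (a i * n%:R - (y i)%:R * (a 0%N + c - 1)) / (D * n%:R).
    by rewrite /D; field; rewrite -/D !gt_eqF.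
  rewrite normrM [`|_^-1|]gtr0_norm; last by rewrite invr_gt0 mulr_gt0.
  rewrite invfM mulrA ler_wpM2r ?invr_ge0//.
  rewrite ler_pdivrMr// /C -mulrA.
  apply: (@le_trans _ _ ((a i + `|a 0%N + c - 1|) * n%:R)).
    apply: le_trans (ler_normB _ _) _; rewrite mulrDl lerD//.
      by rewrite ger0_norm// mulr_ge0// ltW.
    by rewrite normrM ger0_norm// mulrC ler_wpM2l.
  rewrite ler_wpM2l ?addr_ge0 ?(ltW (a0 _))// mulrC ler_pdivlMr// mulrC.
  exact: denom_ge.
elim: j => [|j [C' [C'0 IH]]]; first by exists (C 0%N); split=> // n y vy; exact: act.
exists (C' + C j.+1); split; first exact: addr_ge0.
move=> n y vy; have [n0 _ yS] := vy.
have np : 0 < n%:R :> R by rewrite ltr0n.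
have [yj|yj] := posnP (y j); last first.
  apply: le_trans (act j.+1 n y vy yj) _.
  by rewrite ler_wpM2r ?invr_ge0// lerDr.
have -> : y j.+1 = 0%N by have := yS j; rewrite yj; lia.
have := IH n y vy; rewrite yj mul0r !subr0 !ger0_norm ?chain_prod_ge0//.
move=> le; rewrite chain_prodS; apply: le_trans (_ : chain_prod n y j <= _).
  by rewrite ler_piMr ?chain_prod_ge0//; have /andP[] := level_mom_bound (fun=> 1%N) y j.
by apply: le_trans le _; rewrite ler_wpM2r ?invr_ge0// lerDl.
Qed.

Lemma chain_prod_increment j : exists C, forall n y y', valid_counts n y -> valid_counts n.+1 y' ->
  (y j <= y' j <= (y j).+1)%N -> `|chain_prod n.+1 y' j - chain_prod n y j| <= C / n%:R.
Proof.
have [C [C0 close]] := chain_prod_close j.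
(* One [C] for each exchange of the product for the ratio y_j / n, and 1 for the change of this
   ratio when the count grows by at most one. *)
exists (C + 1 + C) => n y y' vy vy' /andP[yy' y'y].
have [n0 _ _] := vy; have np : 0 < n%:R :> R by rewrite ltr0n.
have nS : n%:R <= n.+1%:R :> R by rewrite ler_nat.
rewrite (_ : _ - _ = (chain_prod n.+1 y' j - (y' j)%:R / n.+1%:R) +
  ((y' j)%:R / n.+1%:R - (y j)%:R / n%:R) - (chain_prod n y j - (y j)%:R / n%:R)); last by ring.
apply: le_trans (ler_normB _ _) _; rewrite !mulrDl; apply: lerD; last exact: close.
apply: le_trans (ler_normD _ _) _; apply: lerD.
  apply: le_trans (close _ _ vy') _.
  by rewrite ler_wpM2l// lef_pV2 ?posrE ?ltr0n.
have yn : (y j)%:R <= n%:R :> R by rewrite ler_nat valid_counts_le.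
have l1 : (y j)%:R <= (y' j)%:R :> R by rewrite ler_nat.
have l2 : (y' j)%:R <= (y j)%:R + 1 :> R by rewrite natr1 ler_nat.
have y0 : 0 <= (y j)%:R :> R by [].
rewrite -natr1; move: (y j)%:R (y' j)%:R n%:R np yn l1 l2 y0 => u v m m0 um l1 l2 u0.
have -> : v / (m + 1) - u / m = ((v - u) * m - u) / (m + 1) / m by field; lra.
rewrite normrM [`|m^-1|]gtr0_norm ?invr_gt0// ler_wpM2r ?invr_ge0 ?(ltW m0)//.
rewrite normrM [`|(m + 1)^-1|]gtr0_norm ?invr_gt0 ?addr_gt0//.
rewrite ler_pdivrMr ?addr_gt0// mul1r ler_norml; apply/andP; split.
  have : 0 <= (v - u) * m by rewrite mulr_ge0//; lra.
  by lra.
suff : 0 <= (1 - (v - u)) * m by lra.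
by rewrite mulr_ge0//; lra.
Qed.

Lemma cvg_ratio_chain (y : nat -> nat -> nat) j (l : R) :
  (forall n, (0 < n)%N -> valid_counts n (y n)) ->
  chain_prod n (y n) j @[n --> \oo] --> l -> (y n j)%:R / n%:R @[n --> \oo] --> l.
Proof.
move=> vy cl; have [C [C0 close]] := chain_prod_close j.
have -> : (fun n => (y n j)%:R / n%:R) =
    (fun n => chain_prod n (y n) j - (chain_prod n (y n) j - (y n j)%:R / n%:R)).
  by apply/funext => n; ring.
rewrite -[X in _ --> X]subr0; apply: cvgB => //.
apply/norm_cvg0P.
apply: (@squeeze_cvgr _ _ _ _ (fun=> 0) (fun n => C * n%:R^-1)).
- exists 1%N => // n /= n0; rewrite normr_ge0 /=; exact/close/vy.
- exact: cvg_cst.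
- rewrite -[X in _ --> X](mulr0 C); apply: cvgMr.
  by rewrite -cvg_shiftS; exact: cvg_harmonic.
Qed.

Lemma cvg_level_mom (p : nat -> nat) (y : nat -> nat -> nat) j (w w' : R) :
  (forall n, (0 < n)%N -> valid_counts n (y n)) -> 0 < w ->
  (y n j)%:R / n%:R @[n --> \oo] --> w -> (y n j.+1)%:R / n%:R @[n --> \oo] --> w' ->
  level_mom a b p (y n) j @[n --> \oo] --> (w' / w) ^+ p j.
Proof.
move=> vy w0 yw yw'.
have -> : (w' / w) ^+ p j = (w' / w) ^+ p j * (1 - w' / w) ^+ 0 by rewrite expr0 mulr1.
apply: cvg_mom_ratio => //; last exact: cvg_shift_ratio.
have := cvg_shift_ratio (a j) yw; apply: cvg_trans; apply: near_eq_cvg.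
have ygt : \forall n \near \oo, 0 < (y n j)%:R / n%:R :> R by exact: (cvgr_gt w yw).
apply: filterS2 (nbhs_infty_gt 0) ygt => n n0 yn.
have yj : (0 < y n j)%N by move: yn; rewrite pmulr_lgt0 ?invr_gt0 ?ltr0n.
have [_ _ yS] := vy n n0.
by rewrite level_denom// -addrA nat1r prednK.
Qed.

End ChainProduct.

(** * Limits of the record counts *)

Section AlmostSureLimits.
Context {R : realType} {d : measure_display} {Omega : measurableType d}.
Variable P : probability Omega R.
Implicit Types (X : nat -> Omega -> R) (W : Omega -> R).

(* Keeps the factors T_k and Z_k in [0, 1] also off the almost sure event of convergence. *)
Definition clip (x : R) : R := Num.min 1 (Num.max 0 x).

Lemma clip_bound x : 0 <= clip x <= 1.
Proof. by rewrite /clip le_min ler01 le_max lexx ge_min lexx. Qed.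

Lemma clip_id x : 0 <= x <= 1 -> clip x = x.
Proof. by move=> /andP[x0 x1]; rewrite /clip max_r// min_r. Qed.

Lemma measurable_clip W : measurable_fun setT W -> measurable_fun setT (fun omega => clip (W omega)).
Proof.
move=> mW; apply: (@measurable_minr _ _ _ setT (cst 1) (fun omega => Num.max 0 (W omega))) => //.
exact: (@measurable_maxr _ _ _ setT (cst 0) W).
Qed.

Lemma measurable_ratio W1 W2 : measurable_fun setT W1 -> measurable_fun setT W2 ->
  (forall omega, 0 <= W2 omega) -> measurable_fun setT (fun omega => W1 omega / W2 omega).
Proof.
move=> m1 m2 W20; apply: measurable_funM => //.
(* On nonnegative reals inversion is the power -1, at 0 too, where both are 0 by convention. *)
under eq_fun do rewrite -powR_inv1//.
by apply: (@measurableT_comp _ _ _ _ _ _ (@powR R ^~ (-1))) => //; exact: measurable_powR.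
Qed.

(** The upper limit is measurable and defined at every outcome; clipping supplies the bounds
    everywhere at once. *)
Lemma as_limit_version X : (forall n, bdm (X n)) -> (forall n omega, 0 <= X n omega <= 1) ->
  {ae P, forall omega, cvgn (X ^~ omega)} ->
  exists W, [/\ measurable_fun setT W, forall omega, 0 <= W omega <= 1
    & {ae P, forall omega, X n omega @[n --> \oo] --> W omega}].
Proof.
move=> bX X01 cX; exists (fun omega => clip (limn_sup (X ^~ omega))); split.
- apply: measurable_clip; apply: measurable_fun_limn_sup.
  + by move=> omega _; exists 1 => _ [n _ <-]; have /andP[] := X01 n omega.
  + by move=> omega _; exists 0 => _ [n _ <-]; have /andP[] := X01 n omega.
  + by move=> n; exact: (bX n).1.
- by move=> omega; exact: clip_bound.
apply: filterS cX => omega cvX; rewrite cvg_limn_supE// clip_id//.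
apply/andP; split.
  by apply: limr_ge => //; apply: nearW => n; have /andP[] := X01 n omega.
by apply: limr_le => //; apply: nearW => n; have /andP[] := X01 n omega.
Qed.

Lemma Ex_limit X W (c : R) : (forall n, bdm (X n)) -> (forall n omega, 0 <= X n omega <= 1) ->
  bdm W -> {ae P, forall omega, X n omega @[n --> \oo] --> W omega} ->
  (forall n, (0 < n)%N -> Ex P (X n) = c) -> Ex P W = c.
Proof.
move=> bX X01 bW XW Xc.
have mE (f : Omega -> R) : bdm f -> measurable_fun setT (EFin \o f).
  by move=> [mf _]; exact/measurable_EFinP.
have h1 : {ae P, forall omega, setT omega -> EFin (X n omega) @[n --> \oo] --> EFin (W omega)}.
  by apply: filterS XW => omega h _ /=; apply/fine_cvgP; split => //; exact: nearW.
have h2 : {ae P, forall omega n, setT omega -> (`|EFin (X n omega)| <= cst 1 omega)%E}.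
  apply: aeW => omega n _; rewrite /= lee_fin; have /andP[x0 x1] := X01 n omega.
  by rewrite ger0_norm.
have [_ _ lim] := dominated_convergence measurableT (fun n => mE _ (bX n)) (mE _ bW) h1
  (bdm_integrable P (bdm_cst 1)) h2.
apply: EFin_inj; rewrite EFin_Ex//.
rewrite -[LHS](cvg_lim _ lim)//; apply/cvg_lim => //.
apply: cvg_near_cst; apply: filterS (nbhs_infty_gt 0) => n n0.
by rewrite /= -EFin_Ex// Xc.
Qed.

End AlmostSureLimits.

Section RecordLimits.
Context {R : realType} {d : measure_display} {Omega : measurableType d}.
Variables (theta zeta : R) (alpha : int -> R).
Variables (P : probability Omega R) (pi_ : forall n : nat, Omega -> 'S_n).
Hypothesis hdom : principal_domain theta zeta alpha.
Hypothesis hmeas : forall (n : nat) (s : 'S_n), measurable [set omega | pi_ n omega = s].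
Hypothesis hcoh : forall omega : Omega, coherent (fun n => pi_ n omega).
Hypothesis hlaw : initial_rank_law P theta zeta alpha pi_.

Notation a := (lower_sum theta alpha).
Notation a' := (upper_sum zeta alpha).
Notation b := (level_b alpha).
Notation b' := (level_b' alpha).
Let a0 := lower_sum_gt0 hdom.
Let a0' := upper_sum_gt0 hdom.
Let b0 := level_b_gt0 hdom.
Let b0' := level_b'_gt0 hdom.
Let abS := lower_sum_level theta alpha.
Let abS' := upper_sum_level zeta alpha.

Definition mom_process p0 q0 p p' l u (n : nat) (omega : Omega) : R :=
  word_mom theta zeta alpha p0 q0 p p' l u (word (pi_ n omega)).

Lemma mom_process_bdm p0 q0 p p' l u n : bdm (mom_process p0 q0 p p' l u n).
Proof. exact: (bdm_pi hmeas (fun s => word_mom theta zeta alpha p0 q0 p p' l u (word s))). Qed.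

Lemma mom_process_bound p0 q0 p p' l u n omega : 0 <= mom_process p0 q0 p p' l u n omega <= 1.
Proof.
rewrite /mom_process /word_mom /state_mom.
have m0 : 0 <= mom (a 0 + (below (word (pi_ n omega)) 0)%:R)
    (a' 0 + (above (word (pi_ n omega)) 0)%:R) p0 q0 <= 1.
  by rewrite mom_ge0 ?mom_le1// ltr_wpDr.
have prod01 (F : nat -> R) k : (forall i, 0 <= F i <= 1) -> 0 <= \prod_(0 <= i < k) F i <= 1.
  move=> F01; apply/andP; split; first by apply: prodr_ge0 => i _; have /andP[] := F01 i.
  by rewrite big_seq; apply: prodr_ile1 => i _; exact: F01.
have mul01 (x z : R) : 0 <= x <= 1 -> 0 <= z <= 1 -> 0 <= x * z <= 1.
  by move=> /andP[x0 x1] /andP[z0 z1]; rewrite mulr_ge0// mulr_ile1.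
by apply: (mul01 _ _ (mul01 _ _ m0 _)); apply: prod01 => i; exact: level_mom_bound.
Qed.

Lemma valid_below n omega : (0 < n)%N -> valid_counts n (below (word (pi_ n omega))).
Proof.
move=> n0; have gw := good_word_word (hcoh omega) n0.
by split => //; [have := below_above0 gw; rewrite size_word; lia|exact: belowS].
Qed.

Lemma valid_above n omega : (0 < n)%N -> valid_counts n (above (word (pi_ n omega))).
Proof.
move=> n0; have gw := good_word_word (hcoh omega) n0.
by split => //; [have := below_above0 gw; rewrite size_word; lia|exact: aboveS].
Qed.

Lemma counts_step n omega j : (0 < n)%N ->
  (below (word (pi_ n omega)) j <= below (word (pi_ n.+1 omega)) j <=
     (below (word (pi_ n omega)) j).+1)%N /\
  (above (word (pi_ n omega)) j <= above (word (pi_ n.+1 omega)) j <=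
     (above (word (pi_ n omega)) j).+1)%N.
Proof.
move=> n0; have gw := good_word_word (hcoh omega) n0.
have [iP e] := word_step n (hcoh omega).
have := perm_word_word (pi_ n.+1 omega); rewrite e => pw'.
have step01 k (c : bool) : (k <= k + c <= k.+1)%N by case: c; lia.
by rewrite below_step ?above_step ?size_word ?perm_word_word//; split; exact: step01.
Qed.

Lemma counts0 n omega : (0 < n)%N ->
  (below (word (pi_ n omega)) 0)%:R + (above (word (pi_ n omega)) 0)%:R = n%:R - 1 :> R.
Proof.
move=> n0; have gw := good_word_word (hcoh omega) n0.
have := below_above0 gw; rewrite size_word => e.
by rewrite -natrD e -subn1 natrB.
Qed.

Lemma mom_process_lower j n omega : (0 < n)%N ->
  mom_process 1 0 (fun=> 1%N) (fun=> 0%N) j 0 n omega =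
  chain_prod a b (a' 0) n (below (word (pi_ n omega))) j.
Proof.
move=> n0; rewrite /mom_process /word_mom /state_mom /chain_prod [X in _ * X = _]big_geq// mulr1 mom10.
congr (_ / _ * _); have := counts0 omega n0; lra.
Qed.

Lemma mom_process_upper j n omega : (0 < n)%N ->
  mom_process 0 1 (fun=> 0%N) (fun=> 1%N) 0 j n omega =
  chain_prod a' b' (a 0) n (above (word (pi_ n omega))) j.
Proof.
move=> n0; rewrite /mom_process /word_mom /state_mom /chain_prod [X in _ * X * _]big_geq// mulr1 mom01.
congr (_ / _ * _); have := counts0 omega n0; lra.
Qed.

Lemma mom_process_cvg p0 q0 p p' l u C :
  (forall n omega, (0 < n)%N -> `|mom_process p0 q0 p p' l u n.+1 omega -
     mom_process p0 q0 p p' l u n omega| <= C / n%:R) ->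
  {ae P, forall omega, cvgn (fun n => mom_process p0 q0 p p' l u n omega)}.
Proof.
move=> XC; apply: (@martingale_cvg _ _ _ P (mom_process p0 q0 p p' l u) C) => //.
  exact: mom_process_bdm.
move=> m n /andP[m0 mn].
(* By coherence pi_m is the ranking of the first m entries of pi_n, so the increment from m to n is
   a function of pi_n. *)
pose G (s : 'S_n) := word_mom theta zeta alpha p0 q0 p p' l u (word s) -
  word_mom theta zeta alpha p0 q0 p p' l u (ranking (take m (word s))).
rewrite -(word_mom_orth hdom hmeas hcoh hlaw p0 q0 p p' l u G (leq_trans m0 mn)).
by congr Ex; apply/funext => omega; rewrite /G -(hcoh omega mn).
Qed.

Lemma lower_limit j : exists W : Omega -> R, [/\ measurable_fun setT W, forall omega, 0 <= W omega <= 1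
  & {ae P, forall omega, (below (word (pi_ n omega)) j)%:R / n%:R @[n --> \oo] --> (W omega : R)}].
Proof.
have [C incr] := chain_prod_increment a0 b0 abS (a0' 0) j.
have cX : {ae P, forall omega, cvgn (fun n => mom_process 1 0 (fun=> 1%N) (fun=> 0%N) j 0 n omega)}.
  apply: (@mom_process_cvg _ _ _ _ _ _ C) => n omega n0; rewrite !mom_process_lower//.
  by apply: incr; [exact: valid_below|exact: valid_below|exact: (counts_step omega j n0).1].
have [W [mW W01 XW]] := as_limit_version (mom_process_bdm _ _ _ _ _ _)
  (mom_process_bound _ _ _ _ _ _) cX.
exists W; split => //; apply: filterS XW => omega XW.
apply: (cvg_ratio_chain a0 b0 abS (a0' 0) (y := fun n => below (word (pi_ n omega)))) => [n n0|].
  exact: valid_below.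
apply: cvg_trans XW; apply: near_eq_cvg; apply: filterS (nbhs_infty_gt 0) => n n0.
by rewrite mom_process_lower.
Qed.

Lemma upper_limit j : exists W : Omega -> R, [/\ measurable_fun setT W, forall omega, 0 <= W omega <= 1
  & {ae P, forall omega, (above (word (pi_ n omega)) j)%:R / n%:R @[n --> \oo] --> (W omega : R)}].
Proof.
have [C incr] := chain_prod_increment a0' b0' abS' (a0 0) j.
have cX : {ae P, forall omega, cvgn (fun n => mom_process 0 1 (fun=> 0%N) (fun=> 1%N) 0 j n omega)}.
  apply: (@mom_process_cvg _ _ _ _ _ _ C) => n omega n0; rewrite !mom_process_upper//.
  by apply: incr; [exact: valid_above|exact: valid_above|exact: (counts_step omega j n0).2].
have [W [mW W01 XW]] := as_limit_version (mom_process_bdm _ _ _ _ _ _)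
  (mom_process_bound _ _ _ _ _ _) cX.
exists W; split => //; apply: filterS XW => omega XW.
apply: (cvg_ratio_chain a0' b0' abS' (a0 0) (y := fun n => above (word (pi_ n omega)))) => [n n0|].
  exact: valid_above.
apply: cvg_trans XW; apply: near_eq_cvg; apply: filterS (nbhs_infty_gt 0) => n n0.
by rewrite mom_process_upper.
Qed.

End RecordLimits.

Section LevelLimits.
Context {R : realType}.
Variables (a b : nat -> R).
Hypothesis a0 : forall j, 0 < a j.
Hypothesis b0 : forall j, 0 < b j.+1.
Hypothesis abS : forall j, a j.+1 + b j.+1 = a j + 1.

Lemma cvg_prod_nat (f : nat -> nat -> R) (g : nat -> R) l :
  (forall j, (j < l)%N -> f n j @[n --> \oo] --> g j) ->
  \prod_(0 <= j < l) f n j @[n --> \oo] --> \prod_(0 <= j < l) g j.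
Proof.
elim: l => [|l IH] fg.
  have -> : (fun n => \prod_(0 <= j < 0) f n j) = (fun=> 1) by apply/funext => n; rewrite big_geq.
  by rewrite big_geq//; exact: cvg_cst.
have -> : (fun n => \prod_(0 <= j < l.+1) f n j) = (fun n => \prod_(0 <= j < l) f n j * f n l).
  by apply/funext => n; rewrite big_nat_recr.
rewrite big_nat_recr//=; apply: cvgM; last exact: fg.
by apply: IH => j jl; apply: fg; exact: ltnW.
Qed.

Lemma limit_ratio_le (y : nat -> nat -> nat) j (w w' : R) :
  (forall n, (0 < n)%N -> valid_counts n (y n)) ->
  (y n j)%:R / n%:R @[n --> \oo] --> w -> (y n j.+1)%:R / n%:R @[n --> \oo] --> w' -> w' <= w.
Proof.
move=> vy yw yw'; apply: (ler_cvg_to yw' yw); apply: filterS (nbhs_infty_gt 0) => n n0.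
have [_ _ yS] := vy n n0.
by rewrite ler_wpM2r// ler_nat (leq_trans (yS j))// leq_pred.
Qed.

(** Positivity is tied to the exponent because a factor with exponent 0 is constantly 1; a single
    level can thus be treated before the limits at the others are known to be positive. *)
Lemma cvg_levels (p : nat -> nat) (y : nat -> nat -> nat) l (w : nat -> R) :
  (forall n, (0 < n)%N -> valid_counts n (y n)) -> (forall j, 0 <= w j) ->
  (forall j, (y n j)%:R / n%:R @[n --> \oo] --> w j) ->
  (forall j, (j < l)%N -> (0 < p j)%N -> 0 < w j) ->
  \prod_(0 <= j < l) level_mom a b p (y n) j @[n --> \oo] -->
    \prod_(0 <= j < l) clip (w j.+1 / w j) ^+ p j.
Proof.
move=> vy w0 yw wp; apply: cvg_prod_nat => j jl.
have [p0|/negP/negP] := boolP (p j == 0%N); last rewrite -lt0n => p0.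
  rewrite (eqP p0) expr0; have -> : (fun n => level_mom a b p (y n) j) = (fun=> 1).
    by apply/funext => n; rewrite /level_mom (eqP p0) mom00// ltr_wpDr.
  exact: cvg_cst.
rewrite clip_id; first exact: cvg_level_mom (wp _ jl p0) (yw j) (yw j.+1).
rewrite divr_ge0//= ler_pdivrMr ?wp// mul1r; exact: limit_ratio_le (yw j) (yw j.+1).
Qed.

Lemma prod_single (F : nat -> nat -> R) j p : (forall i, F i 0%N = 1) ->
  \prod_(0 <= i < j.+1) F i (if i == j then p else 0%N) = F j p.
Proof.
move=> F0; rewrite big_nat_recr//= eqxx big_nat big1 ?mul1r// => i /andP[_ ij].
by rewrite ltn_eqF.
Qed.

End LevelLimits.

Section LimitVariables.
Context {R : realType} {d : measure_display} {Omega : measurableType d}.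
Variables (theta zeta : R) (alpha : int -> R).
Variables (P : probability Omega R) (pi_ : forall n : nat, Omega -> 'S_n).
Hypothesis hdom : principal_domain theta zeta alpha.
Hypothesis hmeas : forall (n : nat) (s : 'S_n), measurable [set omega | pi_ n omega = s].
Hypothesis hcoh : forall omega : Omega, coherent (fun n => pi_ n omega).
Hypothesis hlaw : initial_rank_law P theta zeta alpha pi_.

Notation a := (lower_sum theta alpha).
Notation a' := (upper_sum zeta alpha).
Notation b := (level_b alpha).
Notation b' := (level_b' alpha).
Let a0 := lower_sum_gt0 hdom.
Let a0' := upper_sum_gt0 hdom.
Let b0 := level_b_gt0 hdom.
Let b0' := level_b'_gt0 hdom.
Let abS := lower_sum_level theta alpha.
Let abS' := upper_sum_level zeta alpha.

Definition limits_at (w w' : nat -> R) (omega : Omega) : Prop :=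
  (forall j, (below (word (pi_ n omega)) j)%:R / n%:R @[n --> \oo] --> w j) /\
  (forall j, (above (word (pi_ n omega)) j)%:R / n%:R @[n --> \oo] --> w' j).

Lemma limits_sum w w' omega : limits_at w w' omega -> w 0%N + w' 0%N = 1.
Proof.
move=> [yw zw]; have sw : _ @[_ --> _] --> w 0%N + w' 0%N := cvgD (yw 0%N) (zw 0%N).
have n1 : n%:R^-1 @[n --> \oo] --> (0 : R) by rewrite -cvg_shiftS; exact: cvg_harmonic.
have s1 : (1 - n%:R^-1 : R) @[n --> \oo] --> (1 - 0 : R) by apply: cvgB n1; exact: cvg_cst.
rewrite subr0 in s1; rewrite -(cvg_lim (@Rhausdorff R) (sw _)).
apply: (cvg_lim (@Rhausdorff R)); apply: cvg_trans s1; apply: near_eq_cvg.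
apply: filterS (nbhs_infty_gt 0) => n n0 /=.
rewrite -mulrDl (counts0 hcoh omega n0) mulrBl divff ?mul1r// pnatr_eq0; lia.
Qed.

Lemma mom_process_limit p0 q0 p p' l u w w' omega : limits_at w w' omega ->
  (forall j, 0 <= w j) -> (forall j, 0 <= w' j) ->
  (forall j, (j < l)%N -> (0 < p j)%N -> 0 < w j) ->
  (forall j, (j < u)%N -> (0 < p' j)%N -> 0 < w' j) ->
  mom_process theta zeta alpha pi_ p0 q0 p p' l u n omega @[n --> \oo] -->
    w 0%N ^+ p0 * w' 0%N ^+ q0 * \prod_(0 <= j < l) clip (w j.+1 / w j) ^+ p j *
    \prod_(0 <= j < u) clip (w' j.+1 / w' j) ^+ p' j.
Proof.
move=> lw w0 w0' wp wp'; have [yw zw] := lw.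
apply: cvgM; last first.
  by apply: (cvg_levels a0' b0' abS' (y := fun n => above (word (pi_ n omega)))) => // n n0;
    exact: valid_above.
apply: cvgM; last first.
  by apply: (cvg_levels a0 b0 abS (y := fun n => below (word (pi_ n omega)))) => // n n0;
    exact: valid_below.
have -> : w' 0%N = 1 - w 0%N / 1 by rewrite divr1 -(limits_sum lw); ring.
have {1}-> : w 0%N = w 0%N / 1 by rewrite divr1.
apply: cvg_mom_ratio => //; last exact: cvg_shift_ratio.
have -> : (fun n => (a 0%N + (below (word (pi_ n omega)) 0)%:R +
    (a' 0%N + (above (word (pi_ n omega)) 0)%:R)) / n%:R) =
  (fun n => (a 0%N + (below (word (pi_ n omega)) 0)%:R) / n%:R +
    (a' 0%N + (above (word (pi_ n omega)) 0)%:R) / n%:R) by apply/funext => n; rewrite mulrDl.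
have := cvgD (cvg_shift_ratio (a 0%N) (yw 0%N)) (cvg_shift_ratio (a' 0%N) (zw 0%N)).
by rewrite (limits_sum lw); apply.
Qed.

Variables W W' : nat -> Omega -> R.
Hypothesis mW : forall j, measurable_fun setT (W j).
Hypothesis mW' : forall j, measurable_fun setT (W' j).
Hypothesis W01 : forall j omega, 0 <= W j omega <= 1.
Hypothesis W01' : forall j omega, 0 <= W' j omega <= 1.
Hypothesis limW : {ae P, forall omega, limits_at (W ^~ omega) (W' ^~ omega) omega}.

Let W0 j omega : 0 <= W j omega.
Proof. by have /andP[] := W01 j omega. Qed.

Let W0' j omega : 0 <= W' j omega.
Proof. by have /andP[] := W01' j omega. Qed.

Definition clip_ratio (w : nat -> Omega -> R) (j : nat) (omega : Omega) : R :=
  clip (w j.+1 omega / w j omega).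

Lemma measurable_ratio_clip (w : nat -> Omega -> R) j : (forall i, measurable_fun setT (w i)) ->
  (forall i omega, 0 <= w i omega) -> measurable_fun setT (clip_ratio w j).
Proof. by move=> mw w0; apply: measurable_clip; exact: measurable_ratio. Qed.

Lemma bdm01 (f : Omega -> R) : measurable_fun setT f -> (forall omega, 0 <= f omega <= 1) -> bdm f.
Proof.
by move=> mf f01; split => //; exists 1 => omega; have /andP[x0 x1] := f01 omega; rewrite ger0_norm.
Qed.

Lemma limit_moments p0 q0 p p' l u :
  {ae P, forall omega, forall j, (j < l)%N -> (0 < p j)%N -> 0 < W j omega} ->
  {ae P, forall omega, forall j, (j < u)%N -> (0 < p' j)%N -> 0 < W' j omega} ->
  Ex P (fun omega => W 0%N omega ^+ p0 * W' 0%N omega ^+ q0 *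
    \prod_(0 <= j < l) clip_ratio W j omega ^+ p j * \prod_(0 <= j < u) clip_ratio W' j omega ^+ p' j) =
  mom theta zeta p0 q0 * \prod_(0 <= j < l) mom (a j.+1) (b j.+1) (p j) 0 *
  \prod_(0 <= j < u) mom (a' j.+1) (b' j.+1) (p' j) 0.
Proof.
move=> Wp Wp'.
apply: (@Ex_limit _ _ _ P (mom_process theta zeta alpha pi_ p0 q0 p p' l u)).
- exact: mom_process_bdm.
- exact: mom_process_bound.
- apply: bdmM; first apply: bdmM; first apply: bdmM.
  + by apply: bdmX; exact: bdm01.
  + by apply: bdmX; exact: bdm01.
  + by apply: bdm_prod => j _; apply/bdmX/bdm01 => [|omega]; [exact: measurable_ratio_clip|exact: clip_bound].
  + by apply: bdm_prod => j _; apply/bdmX/bdm01 => [|omega]; [exact: measurable_ratio_clip|exact: clip_bound].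
- apply: filterS3 limW Wp Wp' => omega lw wp wp'.
  exact: (mom_process_limit lw (W0 ^~ omega) (W0' ^~ omega) wp wp').
- by move=> n n0; exact: Ex_word_mom.
Qed.

Lemma ae_gt0 (f : Omega -> R) (x y : R) (mf : measurable_fun setT f) : 0 < x -> 0 < y ->
  (forall omega, 0 <= f omega <= 1) -> (forall p, Ex P (fun omega => f omega ^+ p) = mom x y p 0) ->
  {ae P, forall omega, 0 < f omega}.
Proof.
move=> x0 y0 f01 fp.
pose X : {RV P >-> R} := HB.pack f (isMeasurableFun.Build _ _ _ _ f mf).
have /(beta_law_atom0 x0 y0) X0 : has_beta_law X x y by exact: beta_law_moments.
exists (X @^-1` [set 0]); split => //.
move=> omega /= /negP; rewrite -leNgt => fle; apply/eqP; rewrite eq_le fle.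
by have /andP[] := f01 omega.
Qed.

Lemma moment_lower0 p : Ex P (fun omega => W 0%N omega ^+ p) = mom theta zeta p 0.
Proof.
have := @limit_moments p 0 (fun=> 0%N) (fun=> 0%N) 0 0.
rewrite !big_geq// !mulr1 => <-; try exact: aeW.
by congr Ex; apply/funext => omega; rewrite !big_geq// !mulr1.
Qed.

Lemma moment_upper0 p : Ex P (fun omega => W' 0%N omega ^+ p) = mom zeta theta p 0.
Proof.
have -> : mom zeta theta p 0 = mom theta zeta 0 p.
  by rewrite /mom addn0 add0n [zeta + _]addrC [rising zeta p * _]mulrC.
have := @limit_moments 0 p (fun=> 0%N) (fun=> 0%N) 0 0.
rewrite !big_geq// !mulr1 => <-; try exact: aeW.
by congr Ex; apply/funext => omega; rewrite !big_geq// !mulr1 mul1r.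
Qed.

Lemma theta_gt0 : 0 < theta.
Proof. by have := a0 0; rewrite /lower_sum big_geq ?addr0. Qed.

Lemma zeta_gt0 : 0 < zeta.
Proof. by have := a0' 0; rewrite /upper_sum big_geq ?addr0. Qed.

Lemma moment_lower j p : {ae P, forall omega, 0 < W j omega} ->
  Ex P (fun omega => clip_ratio W j omega ^+ p) = mom (a j.+1) (b j.+1) p 0.
Proof.
move=> Wj.
have := @limit_moments 0 0 (fun i => if i == j then p else 0%N) (fun=> 0%N) j.+1 0.
rewrite (prod_single (F := fun i q => mom (a i.+1) (b i.+1) q 0)); last by move=> i; exact: mom00.
rewrite (mom00 theta_gt0 zeta_gt0) (@big_geq _ _ _ 0 0)// mul1r mulr1 => <-.
- congr Ex; apply/funext => omega; rewrite (@big_geq _ _ _ 0 0)// mulr1 !mul1r.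
  by rewrite (prod_single (F := fun i q => clip_ratio W i omega ^+ q)).
- by apply: filterS Wj => omega Wj i _; case: eqP => // ->.
- exact: aeW.
Qed.

Lemma moment_upper j p : {ae P, forall omega, 0 < W' j omega} ->
  Ex P (fun omega => clip_ratio W' j omega ^+ p) = mom (a' j.+1) (b' j.+1) p 0.
Proof.
move=> Wj.
have := @limit_moments 0 0 (fun=> 0%N) (fun i => if i == j then p else 0%N) 0 j.+1.
rewrite (prod_single (F := fun i q => mom (a' i.+1) (b' i.+1) q 0)); last by move=> i; exact: mom00.
rewrite (mom00 theta_gt0 zeta_gt0) (@big_geq _ _ _ 0 0)// !mul1r => <-.
- congr Ex; apply/funext => omega; rewrite (@big_geq _ _ _ 0 0)// !mul1r.
  by rewrite (prod_single (F := fun i q => clip_ratio W' i omega ^+ q)).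
- exact: aeW.
- by apply: filterS Wj => omega Wj i _; case: eqP => // ->.
Qed.

Lemma ratio_pos_step (w : nat -> Omega -> R) j omega : (forall i, 0 <= w i omega) ->
  0 < clip_ratio w j omega -> 0 < w j.+1 omega.
Proof.
move=> w0 rj; rewrite lt_neqAle w0 andbT eq_sym; apply/eqP => e.
by move: rj; rewrite /clip_ratio e mul0r clip_id ?lexx ?ler01// ltxx.
Qed.

(** Laws and positivity alternate: W_j > 0 gives the moments of the next ratio, whose beta law makes
    the ratio, and with it W_(j+1), almost surely positive. *)
Lemma lower_gt0 j : {ae P, forall omega, 0 < W j omega}.
Proof.
elim: j => [|j IH].
  exact: (ae_gt0 (mW 0) theta_gt0 zeta_gt0 (W01 0) moment_lower0).
have := ae_gt0 (measurable_ratio_clip j mW W0) (a0 j.+1) (b0 j)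
  (fun omega => clip_bound _) (fun p => moment_lower p IH).
by apply: filterS => omega; apply: ratio_pos_step => i; exact: W0.
Qed.

Lemma upper_gt0 j : {ae P, forall omega, 0 < W' j omega}.
Proof.
elim: j => [|j IH].
  exact: (ae_gt0 (mW' 0) zeta_gt0 theta_gt0 (W01' 0) moment_upper0).
have := ae_gt0 (measurable_ratio_clip j mW' W0') (a0' j.+1) (b0' j)
  (fun omega => clip_bound _) (fun p => moment_upper p IH).
by apply: filterS => omega; apply: ratio_pos_step => i; exact: W0'.
Qed.

(** Once positivity is known at every level, all exponents may be positive at the same time. *)
Lemma joint_moments p0 p p' l u :
  Ex P (fun omega => W 0%N omega ^+ p0 *
    \prod_(0 <= j < l) clip_ratio W j omega ^+ p j * \prod_(0 <= j < u) clip_ratio W' j omega ^+ p' j) =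
  Ex P (fun omega => W 0%N omega ^+ p0) *
  \prod_(0 <= j < l) Ex P (fun omega => clip_ratio W j omega ^+ p j) *
  \prod_(0 <= j < u) Ex P (fun omega => clip_ratio W' j omega ^+ p' j).
Proof.
rewrite (eq_bigr _ (fun j _ => moment_lower (p j) (lower_gt0 j))).
rewrite (eq_bigr _ (fun j _ => moment_upper (p' j) (upper_gt0 j))) moment_lower0.
rewrite -limit_moments.
- by congr Ex; apply/funext => omega; rewrite expr0 mulr1.
- by apply: filterS (ae_foralln lower_gt0) => omega h j _ _.
- by apply: filterS (ae_foralln upper_gt0) => omega h j _ _.
Qed.

Lemma telescope_ratio (w : nat -> Omega -> R) omega m : (forall j, 0 < w j omega) ->
  (forall j, w j.+1 omega <= w j omega) ->
  w m omega = w 0%N omega * \prod_(0 <= j < m) clip_ratio w j omega.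
Proof.
move=> w0 wS; elim: m => [|m IH]; first by rewrite big_geq// mulr1.
rewrite big_nat_recr//= mulrA -IH /clip_ratio clip_id; first by rewrite mulrC divfK// gt_eqF.
by rewrite ler_pdivrMr// mul1r wS divr_ge0// ltW.
Qed.

Lemma ae_telescope : {ae P, forall omega, forall m,
  W m omega = W 0%N omega * \prod_(0 <= j < m) clip_ratio W j omega /\
  W' m omega = (1 - W 0%N omega) * \prod_(0 <= j < m) clip_ratio W' j omega}.
Proof.
apply: filterS3 limW (ae_foralln lower_gt0) (ae_foralln upper_gt0) => omega lw wp wp' m.
have [yw zw] := lw; split.
  apply: telescope_ratio => // j.
  by apply: (limit_ratio_le (y := fun n => below (word (pi_ n omega))) _ (yw j) (yw j.+1)) => n n0;
    exact: valid_below.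
have -> : 1 - W 0%N omega = W' 0%N omega by rewrite -(limits_sum lw) addrC addKr.
apply: telescope_ratio => // j.
by apply: (limit_ratio_le (y := fun n => above (word (pi_ n omega))) _ (zw j) (zw j.+1)) => n n0;
  exact: valid_above.
Qed.

End LimitVariables.

(** * The limit variables *)

Section IntProducts.
Variable A : comPzRingType.

Definition int_range (L : nat) : seq int :=
  0 :: [seq - (j.+1)%:Z | j <- iota 0 L] ++ [seq (j.+1)%:Z | j <- iota 0 L].

Lemma mem_int_range L k : (k \in int_range L) = (absz k <= L)%N.
Proof.
rewrite inE mem_cat; apply/idP/idP.
  by case/or3P => [/eqP ->//|/mapP[j]|/mapP[j]]; rewrite mem_iota => jL ->; lia.
case: (ltgtP k 0) => [k0 kL|k0 kL|->//].
- by apply/orP; right; apply/orP; left; apply/mapP; exists (absz k).-1; rewrite ?mem_iota; lia.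
- by apply/orP; right; apply/orP; right; apply/mapP; exists (absz k).-1; rewrite ?mem_iota; lia.
Qed.

Lemma uniq_int_range L : uniq (int_range L).
Proof.
rewrite /= cat_uniq mem_cat negb_or !map_inj_uniq ?iota_uniq ?andbT => [|i j|i j]; try by lia.
apply/and3P; split.
- by apply/andP; split; apply/negP => /mapP[j _]; lia.
- by [].
- by apply/hasPn => _ /mapP[j _ ->]; apply/negP => /mapP[i _]; lia.
Qed.

Lemma prod_int_range (f : int -> A) L : \prod_(k <- int_range L) f k =
  f 0 * \prod_(0 <= j < L) f (- (j.+1)%:Z) * \prod_(0 <= j < L) f (j.+1)%:Z.
Proof. by rewrite big_cons big_cat !big_map /index_iota subn0 mulrA. Qed.

(** Exponent 0 outside [J] extends a product over any finite set of indices to a full block from -L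
    to L, the shape of [joint_moments]. *)
Lemma prod_int_support (F : int -> nat -> A) (J : seq int) (p : int -> nat) L : uniq J ->
  (forall k, F k 0%N = 1) -> (forall k, k \in J -> (absz k <= L)%N) ->
  \prod_(k <- J) F k (p k) = \prod_(k <- int_range L) F k (if k \in J then p k else 0%N).
Proof.
move=> uJ F0 JL.
transitivity (\prod_(k <- int_range L | k \in J) F k (p k)).
  rewrite -[RHS]big_filter; apply: perm_big; apply: uniq_perm => //.
    by rewrite filter_uniq// uniq_int_range.
  move=> k; rewrite mem_filter mem_int_range andbC.
  by case kJ: (k \in J); rewrite ?andbF// JL.
by rewrite big_mkcond; apply: eq_bigr => k _; case: ifP => // _; rewrite F0.
Qed.

End IntProducts.

Section Assembly.
Context {R : realType} {d : measure_display} {Omega : measurableType d}.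
Variables (theta zeta : R) (alpha : int -> R).
Variables (P : probability Omega R) (pi_ : forall n : nat, Omega -> 'S_n).
Hypothesis hdom : principal_domain theta zeta alpha.
Hypothesis hmeas : forall (n : nat) (s : 'S_n), measurable [set omega | pi_ n omega = s].
Hypothesis hcoh : forall omega : Omega, coherent (fun n => pi_ n omega).
Hypothesis hlaw : initial_rank_law P theta zeta alpha pi_.
Variables W W' : nat -> Omega -> R.
Hypothesis mW : forall j, measurable_fun setT (W j).
Hypothesis mW' : forall j, measurable_fun setT (W' j).
Hypothesis W01 : forall j omega, 0 <= W j omega <= 1.
Hypothesis W01' : forall j omega, 0 <= W' j omega <= 1.
Hypothesis limW : {ae P, forall omega, limits_at pi_ (W ^~ omega) (W' ^~ omega) omega}.

Definition mk_rv (f : Omega -> R) (mf : measurable_fun setT f) : {RV P >-> R} :=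
  HB.pack f (isMeasurableFun.Build _ _ _ _ f mf).

Let mT j : measurable_fun setT (clip_ratio W j).
Proof. by apply: measurable_ratio_clip => // i omega; have /andP[] := W01 i omega. Qed.

Let mZ j : measurable_fun setT (clip_ratio W' j).
Proof. by apply: measurable_ratio_clip => // i omega; have /andP[] := W01' i omega. Qed.

(** T_(-m) is the ratio of W_m to W_(m-1), which [clip_ratio] indexes by m - 1. *)
Definition lower_factor (k : int) : {RV P >-> R} := mk_rv (mT (absz k).-1).
Definition upper_factor (k : int) : {RV P >-> R} := mk_rv (mZ (absz k).-1).
Definition factor (k : int) : {RV P >-> R} :=
  if k == 0 then mk_rv (mW 0%N) else if k < 0 then lower_factor k else upper_factor k.

Lemma factor01 k omega : 0 <= factor k omega <= 1.
Proof.
by rewrite /factor; case: ifP => _ //=; case: ifP => _; exact: clip_bound.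
Qed.

Lemma factor_independent : mutually_independent factor.
Proof.
apply: independent_moments => [|J p uJ]; first exact: factor01.
pose L := \max_(k <- J) absz k.
have JL k : k \in J -> (absz k <= L)%N by move=> kJ; exact: (leq_bigmax_seq _ kJ).
rewrite (prod_int_support (F := fun k q => Ex P (fun omega => factor k omega ^+ q)) p uJ _ JL); last first.
  by move=> k; exact: Ex_cst.
under eq_fun => omega do
  rewrite (prod_int_support (F := fun k q => factor k omega ^+ q) p uJ (fun k => expr0 _) JL) prod_int_range.
rewrite prod_int_range.
have := joint_moments hdom hmeas hcoh hlaw mW mW' W01 W01' limW.
exact.
Qed.

(** Built from the factors instead of the limits W and W', so that rho_k is a function of the
    factors at every outcome and not only almost surely; the inclusion of sigma-algebras behind the
    conditional independence relies on this. *)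
Definition limit_value (k : int) (omega : Omega) : R :=
  if k < 0 then W 0%N omega * \prod_(1 <= j < (absz k).+1) factor (- j%:Z) omega
  else 1 - (1 - W 0%N omega) * \prod_(1 <= j < (absz k).+1) factor j%:Z omega.

Lemma measurable_limit_value k : measurable_fun setT (limit_value k).
Proof.
rewrite /limit_value; case: (k < 0).
  apply: measurable_funM => //.
  by apply: (@measurable_prod _ _ _ _ _ (index_iota 1 (absz k).+1)
    (fun j => factor (- j%:Z))) => j _.
apply: measurable_funB => //; apply: measurable_funM; first exact: measurable_funB.
by apply: (@measurable_prod _ _ _ _ _ (index_iota 1 (absz k).+1)
  (fun j => factor j%:Z)) => j _.
Qed.

(** The separate case makes [rho 0] convertible to [factor 0], whereas [limit_value 0] equals W_0
    only after a computation. *)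
Definition rho (k : int) : {RV P >-> R} :=
  if k == 0 then mk_rv (mW 0%N) else mk_rv (measurable_limit_value k).

Lemma rho_lower m : (0 < m)%N ->
  rho (- m%:Z) = (fun omega => W 0%N omega * \prod_(1 <= j < m.+1) lower_factor (- j%:Z) omega)
    :> (Omega -> R).
Proof.
case: m => // m _; apply/funext => omega; rewrite /rho /= /limit_value /=; congr (_ * _).
by apply: eq_big_nat => -[|j].
Qed.

Lemma rho_upper m : (0 < m)%N ->
  rho m%:Z = (fun omega => 1 - (1 - W 0%N omega) * \prod_(1 <= j < m.+1) upper_factor j%:Z omega)
    :> (Omega -> R).
Proof.
case: m => // m _; apply/funext => omega; rewrite /rho /= /limit_value /=; congr (1 - _ * _).
by apply: eq_big_nat => -[|j].
Qed.

Lemma ae_rhoE : {ae P, forall omega, forall m,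
  rho (- m%:Z) omega = W m omega /\ rho m%:Z omega = 1 - W' m omega}.
Proof.
have := ae_telescope hdom hmeas hcoh hlaw mW mW' W01 W01' limW.
apply: filterS2 limW => omega lw tele [|m].
  by rewrite oppr0 /rho /= -(limits_sum hcoh lw); split => //; ring.
rewrite rho_lower// rho_upper//; have [-> ->] := tele m.+1.
by rewrite !(@big_add1 _ _ _ 0 m.+2) /=; split.
Qed.

Lemma ae_record_cvg k : {ae P, forall omega,
  (fun n : nat => (record_value (word (pi_ n omega)) k)%:R / n%:R) @ \oo --> (rho k omega : R)}.
Proof.
apply: filterS2 limW ae_rhoE => omega [yw zw] rhoE.
have rP n j : (0 < n)%N -> (1 <= record_value (word (pi_ n omega)) j <= n)%N.
  move=> n0; have := record_value_bound (good_word_word (hcoh omega) n0) j.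
  by rewrite size_word; apply.
have [m [->|->]] : exists m : nat, k = - m%:Z \/ k = m%:Z.
  by exists (absz k); case: (lerP 0 k); lia.
  (* r_(-m) exceeds the number of values below it by 1, which disappears after division by n. *)
  rewrite (rhoE m).1; have := cvg_shift_ratio 1 (yw m); apply: cvg_trans; apply: near_eq_cvg.
  apply: filterS (nbhs_infty_gt 0) => n n0.
  have /andP[r1 _] := rP n (- m%:Z) n0.
  by rewrite /= /below nat1r prednK.
rewrite (rhoE m).2.
have c1 : (fun=> 1 : R) @ \oo --> (1 : R) by exact: cvg_cst.
have c : 1 - (above (word (pi_ n omega)) m)%:R / n%:R @[n --> \oo] --> 1 - W' m omega by exact: cvgB.
apply: cvg_trans c; apply: near_eq_cvg.
apply: filterS (nbhs_infty_gt 0) => n n0.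
have /andP[_ rn] := rP n m%:Z n0.
by rewrite /= /above size_word natrB// mulrBl divff ?pnatr_eq0 -?lt0n//; ring.
Qed.

Lemma sigma_generated_rho (K : set int) (s : set (set Omega)) :
  (forall k, K k -> @measurable_fun _ _ (g_sigma_algebraType s) (measurableTypeR R) setT (rho k)) ->
  sigma_generated rho K `<=` <<s s >>.
Proof.
move=> mrho; apply: smallest_sub; first exact: smallest_sigma_algebra.
move=> _ [k Kk [B mB <-]]; exact: mrho.
Qed.

Lemma factor_cylinders_measurable (K : set int) k : K k \/ k = 0 ->
  @measurable_fun _ _ (g_sigma_algebraType (cylinders_with factor 0 K)) (measurableTypeR R) setT
    (factor k).
Proof.
move=> Kk _ B mB; rewrite setTI; apply: sub_sigma_algebra.
case: Kk => [Kk|->].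
  exists (factor k @^-1` B), setT; split => //; last by rewrite preimage_setT setIT.
  by apply: sub_cylinders (cylinders1 factor k mB) => _ ->.
exists setT, B; split => //; first exact: cylindersT.
by rewrite setTI.
Qed.

Lemma rho_cond_independent : cond_independent (rho 0) (sigma_generated rho [set k : int | k < 0])
  (sigma_generated rho [set k : int | 0 < k]).
Proof.
have m0 K := @factor_cylinders_measurable K 0 (or_intror erefl).
apply: (cond_independent_cylinders (i0 := 0) factor_independent
  (K1 := [set k : int | k < 0]) (K2 := [set k : int | 0 < k])).
- by move=> k /= k0; apply/negP; rewrite -leNgt ltW.
- by rewrite /= ltxx.
- apply: sigma_generated_rho => k /= k0; rewrite /rho lt_eqF//= /limit_value k0.
  apply: measurable_funM; first exact: m0.
  apply: (@measurable_prod _ (g_sigma_algebraType (cylinders_with factor 0 [set k : int | k < 0])) R setT _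
    (index_iota 1 (absz k).+1) (fun j => factor (- j%:Z))) => j.
  rewrite mem_index_iota => /andP[j0 _]; apply: factor_cylinders_measurable; left => /=; lia.
- apply: sigma_generated_rho => k /= k0; rewrite /rho gt_eqF//= /limit_value ltNge ltW//=.
  apply: measurable_funB => //; apply: measurable_funM; first exact: measurable_funB (m0 _).
  apply: (@measurable_prod _ (g_sigma_algebraType (cylinders_with factor 0 [set k : int | 0 < k])) R setT _
    (index_iota 1 (absz k).+1) (fun j => factor j%:Z)) => j.
  rewrite mem_index_iota => /andP[j0 _]; apply: factor_cylinders_measurable; left => /=; lia.
Qed.

End Assembly.

Theorem proposition10 (R : realType) (theta zeta : R) (alpha : int -> R)
    (hdom : principal_domain theta zeta alpha)
    (d : measure_display) (Omega : measurableType d) (P : probability Omega R)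
    (pi_ : forall n : nat, Omega -> 'S_n)
    (hmeas : forall (n : nat) (s : 'S_n), measurable [set omega | pi_ n omega = s])
    (hcoh : forall omega : Omega, coherent (fun n => pi_ n omega))
    (hlaw : initial_rank_law P theta zeta alpha pi_) :
  exists rho T Z : int -> {RV P >-> R},
    (forall k : int, {ae P, forall omega,
       (fun n : nat => (record_value (word (pi_ n omega)) k)%:R / n%:R) @ \oo
         --> (rho k omega : R)}) /\
    has_beta_law (rho 0) theta zeta /\
    cond_independent (rho 0) (sigma_generated rho [set k : int | k < 0])
                             (sigma_generated rho [set k : int | 0 < k]) /\
    (forall m : nat, (0 < m)%N ->
       {ae P, forall omega,
          rho (- m%:Z) omega =
          rho 0 omega * \prod_(1 <= j < m.+1) T (- j%:Z) omega} /\
       has_beta_law (T (- m%:Z)) (lower_sum theta alpha m) (1 - alpha (- m%:Z))) /\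
    (forall m : nat, (0 < m)%N ->
       {ae P, forall omega,
          rho m%:Z omega =
          1 - (1 - rho 0 omega) * \prod_(1 <= j < m.+1) Z j%:Z omega} /\
       has_beta_law (Z m%:Z) (upper_sum zeta alpha m) (1 - alpha m%:Z)) /\
    mutually_independent (fun k : int =>
      if k == 0 then rho 0 else if k < 0 then T k else Z k).
Proof.
have /choice[W WP] := lower_limit hdom hmeas hcoh hlaw.
have /choice[W' WP'] := upper_limit hdom hmeas hcoh hlaw.
have mW j : measurable_fun setT (W j) by have [] := WP j.
have mW' j : measurable_fun setT (W' j) by have [] := WP' j.
have W01 j : forall omega, 0 <= W j omega <= 1 by have [] := WP j.
have W01' j : forall omega, 0 <= W' j omega <= 1 by have [] := WP' j.
have limW : {ae P, forall omega, limits_at pi_ (W ^~ omega) (W' ^~ omega) omega}.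
  have lW j : {ae P, forall omega,
      (below (word (pi_ n omega)) j)%:R / n%:R @[n --> \oo] --> (W j omega : R)} by have [] := WP j.
  have lW' j : {ae P, forall omega,
      (above (word (pi_ n omega)) j)%:R / n%:R @[n --> \oo] --> (W' j omega : R)} by have [] := WP' j.
  by apply: filterS2 (ae_foralln lW) (ae_foralln lW') => omega yw zw; split.
exists (rho P mW mW' W01 W01'), (lower_factor P mW W01), (upper_factor P mW' W01').
have a0 := lower_sum_gt0 hdom; have a0' := upper_sum_gt0 hdom.
have b0 := level_b_gt0 hdom; have b0' := level_b'_gt0 hdom.
split; [|split; [|split; [|split; [|split]]]].
- exact: (ae_record_cvg hdom hmeas hcoh hlaw).
- apply: beta_law_moments => //; first exact: theta_gt0 hdom.
    exact: zeta_gt0 hdom.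
    by move=> omega; exact: W01.
  by move=> p; exact: (moment_lower0 hdom hmeas hcoh hlaw mW mW' W01 W01' limW p).
- exact: (rho_cond_independent hdom hmeas hcoh hlaw).
- move=> [//|m] m0; split.
    by rewrite rho_lower//; exact: aeW.
  apply: beta_law_moments; [exact: a0|exact: b0|by move=> omega; exact: clip_bound|].
  move=> p; apply: (moment_lower hdom hmeas hcoh hlaw mW mW' W01 W01' limW).
  exact: (lower_gt0 hdom hmeas hcoh hlaw mW mW' W01 W01' limW).
- move=> [//|m] m0; split.
    by rewrite rho_upper//; exact: aeW.
  apply: beta_law_moments; [exact: a0'|exact: b0'|by move=> omega; exact: clip_bound|].
  move=> p; apply: (moment_upper hdom hmeas hcoh hlaw mW mW' W01 W01' limW).
  exact: (upper_gt0 hdom hmeas hcoh hlaw mW mW' W01 W01' limW).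
- exact: (factor_independent hdom hmeas hcoh hlaw).
Qed.
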